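(* Let $p$ be a prime, $h\ge 1$, $q=p^h$, and let $d$ be a positive integer. Let $a\in\mathbb{F}_q$ with $a\neq 0$, and let $f(x)=x^d+ax^{d-1}\in\mathbb{F}_q[x]$. Put $N(d)=\frac{d^2+3}{4}$ if $q=p$, and $N(d)=\frac{d^2}{2}$ for general $q$. If $p\equiv -1\pmod d$ and $p>N(d)$, then the $q$-adic Newton polygon of $L^*(f,t)$ has slopes $\{w_0,w_1,\ldots,w_{d-1}\}$, where \[ w_i=\begin{cases} \frac{(p+1)i}{d(p-1)}, & \text{if } i<\frac d2;\\ \frac{(p+1)i-d}{d(p-1)}=\frac12, & \text{if } i=\frac d2;\\ \frac{(p+1)i-2d}{d(p-1)}, & \text{if } i>\frac d2. \end{cases}\]
   Context: $\mathbb{Q}_{q}$ denotes the unramified extension of $\mathbb{Q}_p$ of degree $h$ with ring of integers $\mathbb{Z}_q$; more generally $\mathbb{Q}_{q^m}$ is the unramified extension of degree $hm$, with ring of integers $\mathbb{Z}_{q^m}$. Let $v$ be the valuation on $\mathbb{C}_p$ normalized by $v(p)=1$. For $f\in\mathbb{F}_q[x]$, its Teichmüller lifting $\hat f\in\mathbb{Z}_q[x]$ is obtained by replacing each coefficient by its Teichmüller lift. For a finite character $\chi:\mathbb{Z}_p\to\mathbb{C}_p^\times$ (of the additive group) of order $p^{m_\chi}$, define for $m\ge1$ the exponential sum $S_m^*(f,\chi)=\sum_{x\in\mu_{q^m-1}}\chi\big(\mathrm{Tr}_{\mathbb{Q}_{q^m}/\mathbb{Q}_p}\hat f(x)\big)$,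 where $\mu_{q^m-1}\subset\mathbb{Z}_{q^m}$ is the group of $(q^m-1)$-th roots of unity, and the $L$-function $L^*(f,\chi,t)=\exp\big(\sum_{m\ge1}S_m^*(f,\chi)\frac{t^m}{m}\big)$; this is a polynomial in $t$. Fix a character $\Psi_1:\mathbb{Z}_p\to\mathbb{C}_p^\times$ of order $p$ and set $L^*(f,t)=L^*(f,\Psi_1,t)$. For a polynomial $\sum_i c_it^i$ with $c_0=1$ and coefficients in $\mathbb{C}_p$, its $q$-adic Newton polygon is the lower convex hull of the points $(i, v(c_i)/h)$; its slopes are the slopes of its segments, each counted with multiplicity equal to the horizontal length of the segment. *)

(* Defs.v *)
From HB Require Import structures.
From mathcomp Require Import all_boot all_order all_algebra.
From mathcomp Require Import boolp classical_sets functions cardinality fsbigop.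
From mathcomp Require Import constructive_ereal.
From mathcomp Require Import ring.

Set Implicit Arguments.
Unset Strict Implicit.
Unset Printing Implicit Defensive.

Import Order.TTheory GRing.Theory Num.Theory.

Local Open Scope classical_set_scope.
Local Open Scope ring_scope.

(* The field C_p is given by its characterization up to isomorphism of valued
   fields (see is_Cp): it is a field C with a map v : C -> Q U {+oo}.  The
   value group of C_p is Q, so v takes its values in \bar rat.  All the p-adic
   fields below are subsets of C. *)
Section ValuedField.
Variables (C : closedFieldType) (v : C -> \bar rat).

Definition is_valuation : Prop :=
  [/\ forall x, v x = +oo%E <-> x = 0,
      forall x y, v (x * y) = (v x + v y)%E
    & forall x y, (Order.min (v x) (v y) <= v (x + y))%E].

Definition cauchy_seq (u : nat -> C) : Prop :=
  forall r : rat, exists N, forall m n, (N <= m)%N -> (N <= n)%N ->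
    (r%:E < v (u m - u n))%E.

Definition converges_to (u : nat -> C) (l : C) : Prop :=
  forall r : rat, exists N, forall n, (N <= n)%N -> (r%:E < v (u n - l))%E.

Definition vclosure (A : set C) : set C :=
  [set x | forall r : rat, exists2 y, A y & (r%:E < v (x - y))%E].

(* When v extends the p-adic valuation and C is complete, the closure of Q in C
   is the completion of Q, that is, Q_p. *)
Definition Qp : set C := vclosure (range (ratr : rat -> C)).

Definition algebraic_over (K : set C) (x : C) : Prop :=
  exists g : {poly C}, [/\ g != 0, forall i, K g`_i & root g x].

(* C_p is the completion of an algebraic closure of Q_p, with v(p) = 1. *)
Definition is_Cp (p : nat) : Prop :=
  [/\ is_valuation,
      v p%:R = 1%E,
      forall u, cauchy_seq u -> exists l, converges_to u l
    & vclosure (algebraic_over Qp) = setT].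

Definition integers_of (K : set C) : set C := K `&` [set x | (0 <= v x)%E].

Definition Zp : set C := integers_of Qp.

Definition is_subfield (K : set C) : Prop :=
  [/\ K 1, forall x y, K x -> K y -> K (x - y)
    & forall x y, K x -> K y -> K (x / y)].

Definition is_basis (K L : set C) (n : nat) (e : 'cV[C]_n) : Prop :=
  (forall i, L (e i 0)) /\
  (forall x, L x -> exists! c : 'rV[C]_n,
      (forall j, K (c 0 j)) /\ x = \sum_j c 0 j * e j 0).

(* Degree n over Q_p, and same value group as Q_p (residue fields are perfect,
   so ramification index 1 is the only condition). *)
Definition is_unramified_ext (n : nat) (L : set C) : Prop :=
  [/\ is_subfield L, Qp `<=` L,
      exists e : 'cV[C]_n, is_basis Qp L e
    & forall x, L x -> exists2 y, Qp y & v x = v y].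

(* Q_{p^n}, the unique unramified extension of Q_p of degree n inside C. *)
Definition Qunr (n : nat) : set C := xget set0 [set L | is_unramified_ext n L].

(* Trace of x in the finite extension L / K: the trace of the matrix of the
   K-linear map y |-> x * y in any K-basis of L. *)
Definition ext_trace (K L : set C) (x : C) : C :=
  xget 0 [set t | exists n (e : 'cV[C]_n) (M : 'M[C]_n),
    [/\ is_basis K L e, forall i j, K (M i j),
        x *: e = M *m e & t = \tr M]].

(* red, restricted to the valuation ring of L, identifies F with the residue
   field of L; the values of red outside this ring are irrelevant. *)
Definition is_residue_map (L : set C) (F : finFieldType) (red : C -> F) : Prop :=
  [/\ red 1 = 1,
      forall x y, integers_of L x -> integers_of L y ->
        red (x + y) = red x + red y /\ red (x * y) = red x * red y,
      forall a, exists2 x, integers_of L x & red x = a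
    & forall x, integers_of L x -> red x = 0 <-> (0 < v x)%E].

Definition teichmuller (L : set C) (F : finFieldType) (red : C -> F) (a : F) : C :=
  xget 0 [set x | [/\ integers_of L x, x ^+ #|F| = x & red x = a]].

Definition teichmuller_poly (L : set C) (F : finFieldType) (red : C -> F)
    (f : {poly F}) : {poly C} :=
  map_poly (teichmuller L red) f.

(* Characters Z_p -> C^* are functions on C, of which only the restriction to
   Zp matters. *)
Definition is_character (chi : C -> C) : Prop :=
  (forall x, Zp x -> chi x != 0) /\
  (forall x y, Zp x -> Zp y -> chi (x + y) = chi x * chi y).

Definition has_order (chi : C -> C) (n : nat) : Prop :=
  [/\ (0 < n)%N, forall x, Zp x -> chi x ^+ n = 1
    & forall k, (0 < k < n)%N -> exists2 x, Zp x & chi x ^+ k != 1].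

Definition mu_unr (p n : nat) : set C :=
  integers_of (Qunr n) `&` [set x | x ^+ (p ^ n - 1) = 1].

(* S_m^*(f, chi) for q = p ^ h, with g the Teichmuller lifting of f *)
Definition exp_sum (p h : nat) (g : {poly C}) (chi : C -> C) (m : nat) : C :=
  \sum_(x \in mu_unr p (h * m)) chi (ext_trace Qp (Qunr (h * m)) g.[x]).

(* Coefficient of t^n in the formal power series
   exp (\sum_(m >= 1) S m * t^m / m): the terms with m > n, and the powers of
   exponent k > n in the exponential series, do not contribute. *)
Definition exp_series_coef (S : nat -> C) (n : nat) : C :=
  (\sum_(k < n.+1) (k`!%:R)^-1 *:
     (\sum_(1 <= m < n.+1) (S m / m%:R) *: 'X^m) ^+ k : {poly C})`_n.

Definition Lstar_coef (p h : nat) (F : finFieldType) (red : C -> F)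
    (f : {poly F}) (chi : C -> C) (n : nat) : C :=
  exp_series_coef
    (exp_sum p h (teichmuller_poly (Qunr h) red f) chi) n.

(* Convex hull of the points (i, v(c_i) / h), c_i the coefficients of P; the
   points at infinity (c_i = 0) are discarded. *)
Definition newton_hull (h : nat) (P : {poly C}) (x y : rat) : Prop :=
  exists w : 'I_(size P) -> rat,
    [/\ forall i, 0 <= w i, forall i : 'I_(size P), P`_i = 0 -> w i = 0, \sum_i w i = 1,
        \sum_i w i * (i : nat)%:R = x
      & \sum_i w i * (fine (v P`_i) / h%:R) = y].

Definition newton_polygon (h : nat) (P : {poly C}) (x y : rat) : Prop :=
  newton_hull h P x y /\ forall y', newton_hull h P x y' -> y <= y'.

(* The vertices of the polygon have integral abscissas, so it is affine on
   each [k, k + 1] with 0 <= k < deg P; listing the slope of each of these unit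
   intervals counts every slope with the horizontal length of its segment. *)
Definition newton_slopes (h : nat) (P : {poly C}) (s : seq rat) : Prop :=
  exists nu : nat -> rat,
    (forall k, (k < size P)%N -> newton_polygon h P k%:R (nu k)) /\
    perm_eq s [seq nu k.+1 - nu k | k <- iota 0 (size P).-1].

End ValuedField.

Definition Nbound (h d : nat) : rat :=
  if h == 1%N then (d%:R ^+ 2 + 3) / 4 else d%:R ^+ 2 / 2.

Definition expected_slope (p d i : nat) : rat :=
  let p' : rat := p%:R in let d' : rat := d%:R in let i' : rat := i%:R in
  if i' < d' / 2 then (p' + 1) * i' / (d' * (p' - 1))
  else if i' == d' / 2 then ((p' + 1) * i' - d') / (d' * (p' - 1))
  else ((p' + 1) * i' - 2 * d') / (d' * (p' - 1)).

Lemma expected_slope_half (p d i : nat) : prime p -> (0 < d)%N ->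
  i%:R = d%:R / 2 :> rat -> expected_slope p d i = 1 / 2.
Proof.
move=> pp d0 e; rewrite /expected_slope e ltxx eqxx.
have d1 : (d%:R : rat) != 0 by rewrite pnatr_eq0 -lt0n.
have p1 : (p%:R - 1 : rat) != 0.
  by rewrite subr_eq0 pnatr_eq1; apply: contraTneq pp => ->.
by rewrite /=; field; rewrite d1 p1.
Qed.

(* Main.v *)
Require Import Defs.
From HB Require Import structures.
From mathcomp Require Import all_boot all_order all_algebra all_fingroup.
From mathcomp Require Import generic_quotient ring_quotient separable cyclic finfield.
From mathcomp Require Import boolp classical_sets functions cardinality fsbigop.
From mathcomp Require Import constructive_ereal.
From mathcomp Require Import ring lra zify.

Set Implicit Arguments.
Unset Strict Implicit.
Unset Printing Implicit Defensive.

Import Order.TTheory GRing.Theory Num.Theory.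

Local Open Scope ring_scope.

(** Up to an arbitrarily small error, Dwork's splitting of the character by the
    Artin-Hasse exponential expresses the exponential sums through traces of
    powers of a finite matrix A, a product of h twisted Frobenius matrices; hence
    L(t) = det(1 - t A) / det(1 - q t A), and the slopes of the numerator are
    smaller than h, so the first d + 1 coefficients of L and of the numerator
    have the same leading terms.  By Cauchy-Binet the n-th coefficient of
    det(1 - t A) is a sum over closed paths of index sets of products of minors.
    The entries W(r,s) have valuation at least
    (c s - floor((r + s) / d)) / (p - 1) with c = (p + 1) / d, and the bound on p
    makes the path that stays at {0, ..., n-1} dominant.  Its minor has an exact
    valuation: modulo the maximal ideal, the rescaled matrix is block triangular,
    with one block anti-triangular and the other reducible to a Vandermonde-like
    determinant.  That L has degree at most d is the usual argument: its Euler
    product is a sum over polynomials, and translating one coefficient multiplies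
    the summand by a nontrivial additive character. *)

(** * Truncated power series *)

(** On the series side nothing has to converge: power series are polynomials modulo a power of X,
    and the Artin-Hasse series is cut at a degree N that leaves an error of valuation at least R = h
    d in the exponential sums. R exceeds every height of the expected polygon, and since n <= d < p
    is a unit, closeness of the sums passes to the coefficients of degree at most d. The Frobenius
    matrices act exactly on polynomials of bounded degree, so the trace formula itself has no error.
    Sums over index sets are replaced by sums over all maps; the factors n! this creates are units.
    The congruence on p makes c an integer, so that the weights come from a Euclidean division by d.
    For a path other than the dominant one the loss is governed by a (a - 1), with a the size of the
    Vandermonde-like block. Since 2 a <= d + 1, the number (2 a - 1)^2 is at most d^2, and N(d) is
    what makes c outweigh this loss. [Qunr] selects an arbitrary unramified extension, so traces are
    computed in every such extension; this is possible because Teichmüller elements have explicit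
    conjugates, their p-power powers. *)

Section TruncatedSeries.
Variable K : fieldType.
Implicit Types (P Q H G : {poly K}) (N : nat).

Definition eqN N P Q := forall n, (n <= N)%N -> P`_n = Q`_n.

Lemma eqN_sym N P Q : eqN N P Q -> eqN N Q P.
Proof. by move=> h n hn; rewrite h. Qed.
Lemma eqN_trans N Q P S : eqN N P Q -> eqN N Q S -> eqN N P S.
Proof. by move=> h h' n hn; rewrite h // h'. Qed.
Lemma eqND N P Q P' Q' : eqN N P Q -> eqN N P' Q' -> eqN N (P + P') (Q + Q').
Proof. by move=> h h' n hn; rewrite !coefD h // h'. Qed.
Lemma eqNM N P Q P' Q' : eqN N P Q -> eqN N P' Q' -> eqN N (P * P') (Q * Q').
Proof.
move=> h h' n hn; rewrite !coefM; apply: eq_bigr => i _.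
by rewrite h ?h' ?(leq_trans (leq_subr _ _)) // (leq_trans _ hn) // -ltnS.
Qed.

(** Unlike the plain derivative, this operator keeps the degree of each monomial, so congruences
    modulo X^(N+1) survive without loss of precision. *)
Definition eulerD P := 'X * P^`().

Lemma coef_eulerD P n : (eulerD P)`_n = P`_n *+ n.
Proof. by rewrite coefXM coef_deriv; case: n => [|n]. Qed.

Lemma eulerDM P Q : eulerD (P * Q) = eulerD P * Q + P * eulerD Q.
Proof. by rewrite /eulerD derivM; ring. Qed.

Lemma eulerD_eqN N P Q : eqN N P Q -> eqN N (eulerD P) (eulerD Q).
Proof. by move=> h n hn; rewrite !coef_eulerD h. Qed.

(* Modulo X^(N+1), H is X times the logarithmic derivative of P. *)
Definition ode N H P := eqN N (eulerD P) (H * P).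

Lemma ode_rec N H P n : ode N H P -> (n <= N)%N ->
  P`_n *+ n = \sum_(i < n.+1) H`_i * P`_(n - i).
Proof. by move=> h hn; rewrite -coef_eulerD h // coefM. Qed.

Lemma ode1 N : ode N 0 1.
Proof. by move=> n hn; rewrite /eulerD derivC mulr0 mul0r. Qed.

Lemma odeM N H1 H2 P Q : ode N H1 P -> ode N H2 Q -> ode N (H1 + H2) (P * Q).
Proof.
move=> h1 h2; rewrite /ode eulerDM.
have -> : (H1 + H2) * (P * Q) = (H1 * P) * Q + P * (H2 * Q) by ring.
by apply: eqND; apply: eqNM.
Qed.

Lemma odeX N H P k : ode N H P -> ode N (H *+ k) (P ^+ k).
Proof.
move=> h; elim: k => [|k IH]; first by rewrite mulr0n expr0; apply: ode1.
by rewrite exprS mulrS; apply: odeM.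
Qed.

Lemma ode_prod N (I : Type) (r : seq I) (H P : I -> {poly K}) :
  (forall i, ode N (H i) (P i)) -> ode N (\sum_(i <- r) H i) (\prod_(i <- r) P i).
Proof.
by move=> h; elim: r => [|i r IH]; rewrite ?big_nil ?big_cons; [apply: ode1|apply: odeM].
Qed.

Lemma ode_eqH N H H' P : eqN N H H' -> ode N H P -> ode N H' P.
Proof. by move=> h o; apply: (eqN_trans o); apply: eqNM. Qed.

Lemma ode_eqP N H P P' : eqN N P P' -> ode N H P -> ode N H P'.
Proof.
move=> h o; apply: eqN_trans (eulerD_eqN (eqN_sym h)) _.
by apply: (eqN_trans o); apply: eqNM.
Qed.

(** As H has constant term 0, the equation expresses n P_n through earlier coefficients. Identities
    between series are proved below by comparing logarithmic derivatives. *)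
Lemma ode_unique N H P Q : (forall n, (0 < n)%N -> n%:R != 0 :> K) -> H`_0 = 0 ->
  P`_0 = Q`_0 -> ode N H P -> ode N H Q -> eqN N P Q.
Proof.
move=> ch h0 e0 hP hQ n; elim/ltn_ind: n => -[|n] IH hn //.
have := ode_rec hP hn; rewrite (big_ord_recl n.+1) h0 mul0r add0r => eP.
have := ode_rec hQ hn; rewrite (big_ord_recl n.+1) h0 mul0r add0r => eQ.
have : P`_n.+1 *+ n.+1 = Q`_n.+1 *+ n.+1.
  rewrite eQ eP; apply: eq_bigr => i _; congr (_ * _).
  by rewrite lift0 subSS IH ?ltnS ?leq_subr // (leq_trans (leq_subr _ _)) // ltnW.
by rewrite -mulr_natr -[RHS]mulr_natr => /mulIf; apply; apply: ch.
Qed.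

Lemma comp_scaleX_coef (c : K) P n : (P \Po (c *: 'X))`_n = c ^+ n * P`_n.
Proof.
rewrite comp_polyE coef_sum.
under eq_bigr => i _ do rewrite exprZn !coefZ coefXn.
have [h|h] := ltnP n (size P).
  rewrite (bigD1 (Ordinal h)) //= eqxx mulr1 big1 ?addr0 1?mulrC // => i hi.
  by rewrite -(inj_eq val_inj) eq_sym /= in hi *; rewrite (negbTE hi) !mulr0.
rewrite big1 => [|i _]; first by rewrite nth_default // mulr0.
by rewrite (gtn_eqF (leq_trans (ltn_ord i) h)) !mulr0.
Qed.

Lemma ode_scale N H P (c : K) : ode N H P -> ode N (H \Po (c *: 'X)) (P \Po (c *: 'X)).
Proof.
move=> h n hn; rewrite -rmorphM /= coef_eulerD !comp_scaleX_coef -h // coef_eulerD.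
by rewrite mulrnAr.
Qed.

Lemma ode_compXn N H P q : (0 < q)%N -> ode N H P -> ode N ((H \Po 'X^q) *+ q) (P \Po 'X^q).
Proof.
move=> q0 h n hn; rewrite mulrnAl coefMn -rmorphM /= coef_eulerD !coef_comp_poly_Xn //.
case: ifP => [/dvdnP[m e]|]; last by rewrite !mul0rn.
rewrite e mulnK // -h ?coef_eulerD -?mulrnA // (leq_trans _ hn) // e leq_pmulr //.
Qed.

Definition expN N G := \sum_(k < N.+1) (k`!%:R)^-1 *: G ^+ k.

Lemma coef_exp_lt G k n : G`_0 = 0 -> (n < k)%N -> (G ^+ k)`_n = 0.
Proof.
move=> g0; elim: k n => [//|k IH] n hn.
rewrite exprS coefM big1 // => -[[|i] hi] _ /=; first by rewrite g0 mul0r.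
rewrite IH ?mulr0 //; case: n hn hi => [//|n] hn hi.
by rewrite subSS (leq_ltn_trans (leq_subr _ _)).
Qed.

Lemma expN_widen N M G : (N <= M)%N -> G`_0 = 0 -> eqN N (expN N G) (expN M G).
Proof.
move=> h g0 n hn; rewrite /expN !coef_sum (big_ord_widen M.+1 (fun k => ((k`!%:R)^-1 *: G ^+ k)`_n)) //.
rewrite [RHS](bigID (fun k : 'I_M.+1 => (k < N.+1)%N)) /= [X in _ = _ + X]big1 ?addr0 //.
move=> i; rewrite -leqNgt => hi; rewrite coefZ coef_exp_lt ?mulr0 //.
exact: leq_ltn_trans hn hi.
Qed.

Lemma expN_eqN N G G' : eqN N G G' -> eqN N (expN N G) (expN N G').
Proof.
move=> h n hn; rewrite /expN !coef_sum; apply: eq_bigr => k _; rewrite !coefZ; congr (_ * _).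
have : eqN N (G ^+ k) (G' ^+ k) by elim: (k : nat) => [|m IH] //; rewrite !exprS; apply: eqNM.
exact.
Qed.

Lemma expN_ode N G : (forall n, (0 < n)%N -> n%:R != 0 :> K) -> G`_0 = 0 ->
  ode N (eulerD G) (expN N G).
Proof.
move=> ch g0; rewrite /ode.
(* Differentiation lowers the truncation index by one, so the equation is exact between the
   truncations at N + 1 and at N, which agree modulo X^(N+1). *)
have e : eulerD (expN N.+1 G) = eulerD G * expN N G.
  rewrite /expN big_ord_recl /= fact0 expr0 invr1 scale1r /eulerD derivD derivC add0r.
  have d0 : (0 : {poly K})^`() = 0 by exact: raddf0.
  rewrite (big_morph (@deriv K) (@derivD K) d0) -mulrA; congr (_ * _); rewrite mulr_sumr; apply: eq_bigr => i _.
  rewrite /bump leq0n add1n factS derivZ deriv_exp /= -scalerAr -[_ *+ i.+1]scaler_nat scalerA.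
  by congr (_ *: _); rewrite natrM invfM mulrAC mulVf ?mul1r // ch.
rewrite -e; apply: eulerD_eqN; apply: expN_widen => //.
Qed.

End TruncatedSeries.

Section ExpSeries.
Variable C : closedFieldType.
Hypothesis ch0 : forall n, (0 < n)%N -> n%:R != 0 :> C.
Variable S : nat -> C.

Let G n : {poly C} := \sum_(1 <= m < n.+1) (S m / m%:R) *: 'X^m.

Let coef_G n i : (G n)`_i = if (0 < i <= n)%N then S i / i%:R else 0.
Proof.
rewrite /G coef_sum; under eq_bigr => m _ do rewrite coefZ coefXn.
rewrite big_mkcond /= .
have [h|h] := boolP (0 < i <= n)%N; last first.
  rewrite big_nat_cond big1 // => m /andP[/andP[m1 mn] _].
  by case: eqP => [e|_]; rewrite ?mulr0 //; move: h; rewrite e m1 -ltnS mn.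
have hi : i \in index_iota 1 n.+1 by rewrite mem_index_iota ltnS.
rewrite (bigD1_seq i) //= ?iota_uniq // eqxx mulr1 big1 ?addr0 // => m hm.
by rewrite eq_sym (negbTE hm) mulr0.
Qed.

Lemma exp_series_coef_expN N n : (n <= N)%N ->
  exp_series_coef S n = (expN N (G N))`_n.
Proof.
move=> h; rewrite -(expN_widen h) ?coef_G //.
rewrite (@expN_eqN _ n (G N) (G n)) // => i hi.
by rewrite !coef_G hi (leq_trans hi h).
Qed.

Lemma exp_series_coef0 : exp_series_coef S 0 = 1.
Proof. by rewrite (exp_series_coef_expN (leqnn 0)) /expN big_ord1 fact0 invr1 scale1r expr0 coef1. Qed.

(** Together with the constant term 1, this recursion is all that is used of the exponential series
    in the definition of L. *)
Lemma exp_series_coef_rec n :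
  exp_series_coef S n.+1 *+ n.+1 =
  \sum_(i < n.+1) S i.+1 * exp_series_coef S (n - i).
Proof.
rewrite (exp_series_coef_expN (leqnn n.+1)).
have g0 : (G n.+1)`_0 = 0 by rewrite coef_G.
rewrite (ode_rec (expN_ode (N := n.+1) ch0 g0) (leqnn _)) big_ord_recl coef_eulerD mulr0n mul0r add0r.
apply: eq_bigr => i _.
rewrite (@exp_series_coef_expN n.+1 (n - i)) ?(leq_trans (leq_subr _ _)) //.
rewrite lift0 subSS coef_eulerD coef_G ltn_ord /=; congr (_ * _).
by rewrite -(mulr_natr (S i.+1 / _)) divfK // ch0.
Qed.
End ExpSeries.

(** * Principal minors of products *)

Section PrincipalMinors.
Variable R : comNzRingType.

Definition minor b n (A : 'M[R]_b) (f g : {ffun 'I_n -> 'I_b}) :=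
  \det (\matrix_(i, j) A (f i) (g j)).

(* n! times the n-th elementary symmetric function of the eigenvalues of A: the sum is
   over all maps, not over subsets, since non-injective maps contribute 0. *)
Definition minor_sum b (A : 'M[R]_b) n := \sum_(f : {ffun 'I_n -> 'I_b}) minor A f f.

Lemma sum_ffun_recl b n (F : {ffun 'I_n.+1 -> 'I_b} -> R) :
  \sum_f F f = \sum_x \sum_(f : {ffun 'I_n -> 'I_b})
    F [ffun i => oapp f x (unlift ord0 i)].
Proof.
rewrite pair_big /=.
rewrite (reindex (fun xf : 'I_b * {ffun 'I_n -> 'I_b} =>
   [ffun i => oapp xf.2 xf.1 (unlift ord0 i)])) //=.
exists (fun f : {ffun 'I_n.+1 -> 'I_b} => (f ord0, [ffun i => f (lift ord0 i)])) => [[x f]|f] _ /=.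
  rewrite ffunE unlift_none /=; congr (_, _); apply/ffunP => i.
  by rewrite !ffunE liftK.
by apply/ffunP => i; rewrite ffunE; case: unliftP => [j ->|->] //=; rewrite ffunE.
Qed.

(** Coset decomposition: every permutation is uniquely a possibly trivial transposition (0 j) times
    a permutation fixing 0; injectivity and a cardinality count suffice. *)
Lemma sum_perm_recl n (F : 'S_n.+1 -> R) :
  \sum_s F s = \sum_j \sum_(s : 'S_n) F (tperm ord0 j * lift_perm ord0 ord0 s)%g.
Proof.
rewrite pair_big /=.
rewrite (reindex (fun js : 'I_n.+1 * 'S_n => tperm ord0 js.1 * lift_perm ord0 ord0 js.2)%g) //=.
apply: onW_bij; apply: inj_card_bij; last first.
  by rewrite card_prod !card_Sn card_ord factS.
move=> [j s] [j' s'] /= e.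
have ej : j = j'.
  have h1 : (tperm ord0 j * lift_perm ord0 ord0 s)%g j = ord0 by rewrite permM tpermR lift_perm_id.
  have h2 : (tperm ord0 j' * lift_perm ord0 ord0 s')%g j' = ord0 by rewrite permM tpermR lift_perm_id.
  by apply: (@perm_inj _ (tperm ord0 j * lift_perm ord0 ord0 s)%g); rewrite h1 e h2.
rewrite ej in e; congr (_, _) => //; move/mulgI: e => e.
apply/permP => i; apply: (@lift_inj _ ord0).
by rewrite -!(lift_perm_lift ord0 ord0) e.
Qed.

(** * Newton's identities without eigenvalues *)

Section Newton.
Variables (b : nat) (A : 'M[R]_b).

(** The expansion of [minor_sum] with [A ^+ j] in place of A as the factor attached to i0.
    Contracting a cycle through i0 raises j, which is how traces of powers appear. *)
Let G n j (i0 : 'I_n) := \sum_(s : 'S_n) (-1) ^+ s *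
  \sum_(f : {ffun 'I_n -> 'I_b}) \prod_i (if i == i0 then A ^+ j else A) (f i) (f (s i)).

Let G_sym n j (i0 i1 : 'I_n) : G j i0 = G j i1.
Proof.
pose t := tperm i0 i1.
have bj : bijective (fun s : 'S_n => s ^ t)%g by exists (fun s => s ^ t)%g => s; rewrite -conjgM tperm2 conjg1.
rewrite /G (reindex (fun s => s ^ t)%g) /=; last exact: onW_bij.
apply: eq_bigr => s _; congr (_ * _).
  by rewrite /conjg !odd_permM odd_permV addbC addbK.
have bf : bijective (fun f : {ffun 'I_n -> 'I_b} => [ffun i => f (t i)]).
  by exists (fun f : {ffun 'I_n -> 'I_b} => [ffun i => f (t i)]) => f; apply/ffunP => i; rewrite !ffunE tpermK.
rewrite (reindex (fun f : {ffun 'I_n -> 'I_b} => [ffun i => f (t i)])) /=; last exact: onW_bij.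
apply: eq_bigr => f _.
rewrite (reindex_inj (@perm_inj _ t)) /=; apply: eq_bigr => i _.
rewrite !ffunE conjgE /t tpermV !permM !tpermK.
by rewrite -(inj_eq (@perm_inj _ t)) tpermK tpermL.
Qed.

(** If 0 is a fixed point of the permutation it contributes a trace. Otherwise summing over the
    index at 0 merges two consecutive factors A and [A ^+ j] of its cycle into [A ^+ j.+1]; the
    cycle is shorter by one and the sign changes. *)
Let G_rec n j : G j (ord0 : 'I_n.+1) = \tr (A ^+ j) * minor_sum A n - \sum_(i0 < n) G j.+1 i0.
Proof.
rewrite /G sum_perm_recl big_ord_recl; congr (_ + _).
  rewrite tperm1; rewrite /minor_sum /minor /determinant.
  under eq_bigr => s _ do rewrite mul1g odd_lift_perm /= sum_ffun_recl exchange_big /= mulr_sumr.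
  rewrite exchange_big /= mulr_sumr; apply: eq_bigr => f _.
  rewrite mulr_sumr; apply: eq_bigr => s _; rewrite mulrCA; congr (_ * _).
  rewrite mulr_suml; apply: eq_bigr => x _.
  rewrite big_ord_recl /= lift_perm_id !ffunE unlift_none /=; congr (_ * _).
  apply: eq_bigr => i _; rewrite /= lift_perm_lift !ffunE !liftK /= mxE //.
rewrite -sumrN; apply: eq_bigr => i0 _; rewrite -sumrN; apply: eq_bigr => s _.
rewrite odd_permM odd_tperm (negbTE (neq_lift _ _)) /= odd_lift_perm /= signrN mulNr.
congr (- (_ * _)); rewrite sum_ffun_recl exchange_big /=; apply: eq_bigr => f _.
rewrite [RHS](bigD1 i0) //= eqxx exprS mxE mulr_suml; apply: eq_bigr => x _.
rewrite big_ord_recl /= permM tpermL lift_perm_lift !ffunE unlift_none !liftK /=.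
rewrite (bigD1 i0) //= permM tpermR lift_perm_id !ffunE unlift_none !liftK /= mulrA; congr (_ * _); first by rewrite mulrC.
apply: eq_bigr => i hi; rewrite permM tpermD ?neq_lift //; last by rewrite (inj_eq (@lift_inj _ _)) eq_sym.
by rewrite lift_perm_lift !ffunE !liftK /= (negbTE hi).
Qed.

Let G1 n : minor_sum A n.+1 = G 1 (ord0 : 'I_n.+1).
Proof.
rewrite /minor_sum /minor /determinant exchange_big /=; apply: eq_bigr => s _; rewrite -mulr_sumr; congr (_ * _).
apply: eq_bigr => f _; apply: eq_bigr => i _; rewrite mxE expr1; by case: ifP.
Qed.

Let G_newton n j : G j.+1 (ord0 : 'I_n.+1) =
  \sum_(i < n.+1) (-1) ^+ i * (n ^_ i)%:R * \tr (A ^+ (j + i).+1) * minor_sum A (n - i).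
Proof.
elim: n j => [|n IH] j.
  by rewrite G_rec big_ord0 subr0 big_ord1 /= ffactn0 expr0 !mul1r addn0.
rewrite G_rec [in RHS]big_ord_recl /= ffactn0 expr0 !mul1r addn0 subn0; congr (_ + _).
rewrite (eq_bigr (fun=> G j.+2 (ord0 : 'I_n.+1))) => [|i _]; last exact: G_sym.
rewrite sumr_const card_ord IH -mulNrn -sumrN -sumrMnl; apply: eq_bigr => i _.
rewrite /bump leq0n add1n subSS [(-1) ^+ _.+1]exprS ffactSS natrM addnS addSn -mulr_natr.
by ring.
Qed.

(** As [minor_sum A n] is n! e_n, these are Newton's identities multiplied by n!, with falling
    factorials instead of denominators. They link the traces of powers to det(1 - t A). *)
Lemma minor_sum_newton n : minor_sum A n.+1 =
  \sum_(i < n.+1) (-1) ^+ i * (n ^_ i)%:R * \tr (A ^+ i.+1) * minor_sum A (n - i).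
Proof. by rewrite G1 G_newton. Qed.

Lemma minor_sum0 : minor_sum A 0 = 1.
Proof.
rewrite /minor_sum (eq_bigr (fun=> 1)) => [|f _]; last by rewrite /minor det_mx00.
by rewrite sumr_const card_ffun !card_ord expn0.
Qed.
End Newton.

(** Among all maps u each n-subset is counted n! times and maps with a repeated value contribute 0;
    hence the factorial on the left. *)
Lemma cauchy_binet n b (X : 'M[R]_(n, b)) (Y : 'M[R]_(b, n)) :
  \det (X *m Y) *+ n`! = \sum_(u : {ffun 'I_n -> 'I_b})
    \det (\matrix_(i, j) X i (u j)) * \det (\matrix_(i, j) Y (u i) j).
Proof.
have e : \det (X *m Y) = \sum_(u : {ffun 'I_n -> 'I_b})
    (\prod_i X i (u i)) * \det (\matrix_(i, j) Y (u i) j).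
  rewrite /determinant; under [RHS]eq_bigr => u _ do rewrite mulr_sumr.
  rewrite exchange_big /=; apply: eq_bigr => s _.
  under eq_bigr => i _ do rewrite mxE.
  rewrite bigA_distr_bigA /= mulr_sumr; apply: eq_bigr => u _.
  rewrite big_split /= mulrCA; congr (_ * (_ * _)); apply: eq_bigr => i _; by rewrite mxE.
(* Every permutation s in the expansion of the first determinant gives the same sum: reindexing u by
   s permutes the rows of the second determinant, and the two signs cancel. *)
under eq_bigr => u _ do rewrite {1}/determinant mulr_suml.
rewrite exchange_big /=.
rewrite (eq_bigr (fun=> \det (X *m Y))) => [|s _]; first by rewrite sumr_const card_Sn.
have bf : bijective (fun f : {ffun 'I_n -> 'I_b} => [ffun i => f ((s^-1)%g i)]).
  exists (fun f : {ffun 'I_n -> 'I_b} => [ffun i => f (s i)]) => f; apply/ffunP => i; rewrite !ffunE ?permK ?permKV //.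
rewrite (reindex (fun f : {ffun 'I_n -> 'I_b} => [ffun i => f ((s^-1)%g i)])) /=; last exact: onW_bij.
rewrite e; apply: eq_bigr => u _.
have -> : \matrix_(i, j) Y ([ffun i => u ((s^-1)%g i)] i) j = row_perm (s^-1)%g (\matrix_(i, j) Y (u i) j).
  by apply/matrixP => i j; rewrite !mxE ffunE.
rewrite row_permE det_mulmx det_perm odd_permV mulrA; congr (_ * _).
rewrite mulrAC -signr_addb addbb expr0 mul1r; apply: eq_bigr => i _.
by rewrite mxE ffunE permK.
Qed.

(** The compound matrix, indexed by all maps rather than increasing ones and therefore
    multiplicative only up to n!. *)
Definition compound b n (A : 'M[R]_b) : 'M[R]_(#|{ffun 'I_n -> 'I_b}|) :=
  \matrix_(x, y) minor A (enum_val x) (enum_val y).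

Lemma compoundM b n (A B : 'M[R]_b) :
  compound n (A *m B) *+ n`! = compound n A *m compound n B.
Proof.
apply/matrixP => x y; rewrite !mulmxnE !mxE.
have -> : minor (A *m B) (enum_val x) (enum_val y) =
  \det ((\matrix_(i, k) A (enum_val x i) k) *m (\matrix_(k, j) B k (enum_val y j))).
  by congr (\det _); apply/matrixP => i j; rewrite !mxE; apply: eq_bigr => k _; rewrite !mxE.
rewrite cauchy_binet (reindex (@enum_val {ffun 'I_n -> 'I_b} {ffun 'I_n -> 'I_b})) /=; last exact/onW_bij/enum_val_bij.
apply: eq_bigr => u _; rewrite /compound !mxE /minor; congr (_ * _); congr (\det _); by apply/matrixP => i j; rewrite !mxE.
Qed.

Lemma mxtrace_compound b n (A : 'M[R]_b) : \tr (compound n A) = minor_sum A n.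
Proof.
rewrite /minor_sum (reindex (@enum_val {ffun 'I_n -> 'I_b} {ffun 'I_n -> 'I_b})) /=; last exact/onW_bij/enum_val_bij.
by apply: eq_bigr => x _; rewrite mxE.
Qed.

Lemma prod_mx_path N h (M : nat -> 'M[R]_N) (a c : 'I_N) :
  (\prod_(i < h) M i) a c = \sum_(u : {ffun 'I_h.+1 -> 'I_N} | (u ord0 == a) && (u ord_max == c))
    \prod_(i < h) M i (u (widen_ord (leqnSn _) i)) (u (lift ord0 i)).
Proof.
elim: h M a => [|h IH] M a.
  rewrite big_ord0 mxE; under eq_bigr => u _ do rewrite big_ord0.
  rewrite (eq_bigl (fun u : {ffun 'I_1 -> 'I_N} => (u == [ffun=> a]) && (a == c))) => [|u].
    case: eqP => _ /=; last by rewrite big_pred0 // => i; rewrite andbF.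
    by rewrite (big_pred1 [ffun=> a]) // => i; rewrite /= andbT.
  rewrite (ord1 ord_max); apply/andP/andP => [[/eqP e1 /eqP e2]|[/eqP -> /eqP ->]]; last by rewrite !ffunE.
  by rewrite -e1 -e2 eqxx; split=> //; apply/eqP/ffunP => i; rewrite ffunE (ord1 i).
rewrite big_ord_recl mxE [RHS]big_mkcond [RHS]sum_ffun_recl /=.
rewrite [RHS](bigD1 a) //= [X in _ = _ + X]big1 ?addr0 => [|x xa]; last first.
  by apply: big1 => u _; rewrite ffunE unlift_none /= (negbTE xa).
rewrite [RHS](partition_big (fun u : {ffun 'I_h.+1 -> 'I_N} => u ord0) xpredT) //=.
apply: eq_bigr => x _; rewrite (IH (fun i => M i.+1)) mulr_sumr big_mkcond [RHS]big_mkcond.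
apply: eq_bigr => u _; rewrite !ffunE unlift_none /= eqxx.
have -> : ord_max = lift ord0 (ord_max : 'I_h.+1) by apply: val_inj; rewrite /= /bump.
rewrite liftK /=; case: eqP => [e|_] //=; case: ifP => // _.
rewrite big_ord_recl ffunE; congr (_ * _).
  by rewrite (_ : widen_ord _ _ = ord0) ?unlift_none ?ffunE ?liftK /= ?e //; apply: val_inj.
apply: eq_bigr => i _; rewrite !ffunE.
have -> : widen_ord (leqnSn h.+1) (lift ord0 i) = lift ord0 (widen_ord (leqnSn h) i) by apply: val_inj.
by rewrite !liftK.
Qed.

Lemma mxtrace_prod_path N h (M : nat -> 'M[R]_N) :
  \tr (\prod_(i < h) M i) = \sum_(u : {ffun 'I_h.+1 -> 'I_N} | u ord0 == u ord_max)
    \prod_(i < h) M i (u (widen_ord (leqnSn _) i)) (u (lift ord0 i)).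
Proof.
rewrite /mxtrace; under eq_bigr => a _ do rewrite prod_mx_path.
rewrite [RHS](partition_big (fun u : {ffun 'I_h.+1 -> 'I_N} => u ord0) xpredT) //=.
apply: eq_bigr => a _; apply: eq_bigl => u; rewrite andbC.
by apply/andP/andP => -[/eqP e1 /eqP e2]; split; apply/eqP; congruence.
Qed.

Lemma compound_prod b n h (A : nat -> 'M[R]_b) :
  compound n (\prod_(i < h.+1) A i) *+ n`! ^ h = \prod_(i < h.+1) compound n (A i).
Proof.
elim: h => [|h IH]; first by rewrite !big_ord1 expn0 mulr1n.
rewrite big_ord_recr /= [RHS]big_ord_recr /= -IH expnS mulrnA.
by rewrite -mulmxE compoundM mulmxE mulrnAl.
Qed.

Lemma minor_sum_prod b n h (A : nat -> 'M[R]_b) :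
  minor_sum (\prod_(i < h.+1) A i) n *+ n`! ^ h =
  \sum_(u : {ffun 'I_h.+2 -> 'I_#|{ffun 'I_n -> 'I_b}|} | u ord0 == u ord_max)
    \prod_(i < h.+1) minor (A i) (enum_val (u (widen_ord (leqnSn _) i)))
                                 (enum_val (u (lift ord0 i))).
Proof.
rewrite -mxtrace_compound -raddfMn /= compound_prod.
rewrite (mxtrace_prod_path _ (fun i => compound n (A i))).
by apply: eq_bigr => u _; apply: eq_bigr => i _; rewrite mxE.
Qed.

End PrincipalMinors.

(** * Valuations and residue fields *)

Section Valuation.
Variables (C : closedFieldType) (v : C -> \bar rat).
Hypothesis hv : is_valuation v.

Definition vge (r : rat) x := (r%:E <= v x)%E.
Definition vgt (r : rat) x := (r%:E < v x)%E.
(** At 0 this is the default value of [fine], so statements about it are paired with nonvanishing,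
    whereas [vge] and [vgt] hold at 0 for every bound. *)
Definition nu (x : C) : rat := fine (v x).

Lemma v0 : v 0 = +oo%E. Proof. by case: hv => h _ _; apply/h. Qed.
Lemma vM x y : v (x * y) = (v x + v y)%E. Proof. by case: hv. Qed.

Lemma v_pinfty x : v x = +oo%E -> x = 0. Proof. by case: hv => h _ _ /h. Qed.

Lemma v1 : v 1 = 0%:E.
Proof.
have := vM 1 1; rewrite mul1r; case e : (v 1) => [r||] //=.
- by rewrite -EFinD => -[h]; congr EFin; lra.
- by move/v_pinfty: e => /eqP; rewrite oner_eq0.
- by have := vM 1 0; rewrite mul1r v0 e.
Qed.

Lemma vE x : x != 0 -> v x = (nu x)%:E.
Proof.
move=> x0; rewrite /nu; case e : (v x) => [r||] //=; first by move/v_pinfty: e x0 => ->; rewrite eqxx.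
by have := vM x x^-1; rewrite mulfV // v1 e; case: (v _).
Qed.

Lemma vgeE r x : x != 0 -> vge r x = (r <= nu x).
Proof. by move=> x0; rewrite /vge vE // lee_fin. Qed.
Lemma vgtE r x : x != 0 -> vgt r x = (r < nu x).
Proof. by move=> x0; rewrite /vgt vE // lte_fin. Qed.
Lemma vge0 r : vge r 0. Proof. by rewrite /vge v0 leey. Qed.
Lemma vgt0 r : vgt r 0. Proof. by rewrite /vgt v0 ltey. Qed.
Lemma vgtW r x : vgt r x -> vge r x. Proof. exact: ltW. Qed.
Lemma vge_le r s x : s <= r -> vge r x -> vge s x.
Proof. by move=> h; apply: le_trans; rewrite lee_fin. Qed.
Lemma vge_lt r s x : s < r -> vge r x -> vgt s x.
Proof. by move=> h; apply: lt_le_trans; rewrite lte_fin. Qed.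
Lemma vgt_le r s x : s <= r -> vgt r x -> vgt s x.
Proof. by move=> h; apply: le_lt_trans; rewrite lee_fin. Qed.

Lemma nuM x y : x != 0 -> y != 0 -> nu (x * y) = nu x + nu y.
Proof.
move=> x0 y0; have := vM x y; rewrite !vE ?mulf_neq0 // -EFinD.
by case.
Qed.
Lemma nu1 : nu 1 = 0. Proof. by rewrite /nu v1. Qed.
Lemma nuV x : nu x^-1 = - nu x.
Proof.
have [->|x0] := eqVneq x 0; first by rewrite invr0 /nu v0 oppr0.
by apply/eqP; rewrite -addr_eq0 -nuM ?invr_eq0 // mulVf // nu1.
Qed.
Lemma nuN x : nu (- x) = nu x.
Proof.
have [->|x0] := eqVneq x 0; first by rewrite oppr0.
have n1 : (-1 : C) != 0 by rewrite oppr_eq0 oner_neq0.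
have e : nu (-1) = 0 by have := nuM n1 n1; rewrite mulrNN mulr1 nu1 => ?; lra.
by rewrite -mulN1r nuM // e add0r.
Qed.
Lemma nuX x n : nu (x ^+ n) = nu x *+ n.
Proof.
have [->|x0] := eqVneq x 0.
  case: n => [|n]; rewrite ?expr0 ?nu1 // expr0n /= /nu v0 //=. by rewrite mul0rn.
elim: n => [|n IH]; first by rewrite expr0 nu1.
by rewrite exprS nuM ?expf_neq0 // IH mulrS.
Qed.
Lemma vN x : v (- x) = v x.
Proof.
have [->|x0] := eqVneq x 0; first by rewrite oppr0.
by rewrite !vE ?oppr_eq0 // nuN.
Qed.

Lemma vgeN r x : vge r (- x) = vge r x. Proof. by rewrite /vge vN. Qed.
Lemma vgtN r x : vgt r (- x) = vgt r x. Proof. by rewrite /vgt vN. Qed.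
Lemma vgeD r x y : vge r x -> vge r y -> vge r (x + y).
Proof. by rewrite /vge => hx hy; case: hv => _ _ /(_ x y); apply: le_trans; rewrite le_min hx. Qed.
Lemma vgtD r x y : vgt r x -> vgt r y -> vgt r (x + y).
Proof. by rewrite /vgt => hx hy; case: hv => _ _ /(_ x y); apply: lt_le_trans; rewrite lt_min hx. Qed.
Lemma vgeB r x y : vge r x -> vge r y -> vge r (x - y).
Proof. by move=> hx hy; apply: vgeD; rewrite ?vgeN. Qed.
Lemma vgtB r x y : vgt r x -> vgt r y -> vgt r (x - y).
Proof. by move=> hx hy; apply: vgtD; rewrite ?vgtN. Qed.
Lemma vge_subC r x y : vge r (x - y) = vge r (y - x).
Proof. by rewrite -vgeN opprB. Qed.
Lemma vgt_subC r x y : vgt r (x - y) = vgt r (y - x).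
Proof. by rewrite -vgtN opprB. Qed.
Lemma vge_trans y r x z : vge r (x - y) -> vge r (y - z) -> vge r (x - z).
Proof. by move=> h1 h2; rewrite -(subrK y x) -addrA; apply: vgeD. Qed.
Lemma vgt_trans y r x z : vgt r (x - y) -> vgt r (y - z) -> vgt r (x - z).
Proof. by move=> h1 h2; rewrite -(subrK y x) -addrA; apply: vgtD. Qed.
Lemma vgeM r s x y : vge r x -> vge s y -> vge (r + s) (x * y).
Proof.
have [->|x0] := eqVneq x 0; first by move=> _ _; rewrite mul0r vge0.
have [->|y0] := eqVneq y 0; first by move=> _ _; rewrite mulr0 vge0.
by rewrite !vgeE ?mulf_neq0 // nuM //; apply: lerD.
Qed.
Lemma vgtM r s x y : vge r x -> vgt s y -> vgt (r + s) (x * y).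
Proof.
have [->|x0] := eqVneq x 0; first by move=> _ _; rewrite mul0r vgt0.
have [->|y0] := eqVneq y 0; first by move=> _ _; rewrite mulr0 vgt0.
by rewrite vgeE // !vgtE ?mulf_neq0 // nuM //; apply: ler_ltD.
Qed.
Lemma vge01 : vge 0 1. Proof. by rewrite /vge v1. Qed.
Lemma vge0M x y : vge 0 x -> vge 0 y -> vge 0 (x * y).
Proof. by move=> hx hy; rewrite -[0]addr0; apply: vgeM. Qed.
Lemma vgeMl r x y : vge 0 x -> vge r y -> vge r (x * y).
Proof. by move=> hx hy; rewrite -[r]add0r; apply: vgeM. Qed.
Lemma vgtMl r x y : vge 0 x -> vgt r y -> vgt r (x * y).
Proof. by move=> hx hy; rewrite -[r]add0r; apply: vgtM. Qed.
Lemma vge0X x n : vge 0 x -> vge 0 (x ^+ n).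
Proof. by move=> hx; elim: n => [|n IH]; rewrite ?expr0 ?vge01 // exprS vge0M. Qed.
Lemma vgeX r x n : vge r x -> vge (r *+ n) (x ^+ n).
Proof. by move=> hx; elim: n => [|n IH]; rewrite ?expr0 ?mulr0n ?vge01 // exprS mulrS vgeM. Qed.
Lemma vge_sum r (I : Type) (s : seq I) (P : pred I) F :
  (forall i, P i -> vge r (F i)) -> vge r (\sum_(i <- s | P i) F i).
Proof. by move=> h; elim/big_rec: _ => [|i x Pi hx]; [apply: vge0|apply: vgeD; first exact: h]. Qed.
Lemma vgt_sum r (I : Type) (s : seq I) (P : pred I) F :
  (forall i, P i -> vgt r (F i)) -> vgt r (\sum_(i <- s | P i) F i).
Proof. by move=> h; elim/big_rec: _ => [|i x Pi hx]; [apply: vgt0|apply: vgtD; first exact: h]. Qed.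
Lemma vge_prod (I : Type) (s : seq I) (P : pred I) F (r : I -> rat) :
  (forall i, P i -> vge (r i) (F i)) -> vge (\sum_(i <- s | P i) r i) (\prod_(i <- s | P i) F i).
Proof.
move=> h; elim: s => [|i s IH]; rewrite ?big_nil ?big_cons ?vge01 //.
by case: ifP => // Pi; apply: vgeM => //; apply: h.
Qed.
Lemma vge0_prod (I : Type) (s : seq I) (P : pred I) F :
  (forall i, P i -> vge 0 (F i)) -> vge 0 (\prod_(i <- s | P i) F i).
Proof. by move=> h; have := vge_prod s h; rewrite big1. Qed.
Lemma vge_nat n : vge 0 n%:R.
Proof. by elim: n => [|n IH]; rewrite ?vge0 // mulrS vgeD ?vge01. Qed.
Lemma vge_Mn r x n : vge r x -> vge r (x *+ n).
Proof. by move=> hx; rewrite -mulr_natl; apply: vgeMl; rewrite ?vge_nat. Qed.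
Lemma vge_int (n : int) : vge 0 n%:~R.
Proof. by case: n => n; rewrite ?NegzE ?mulrNz ?vgeN vge_nat. Qed.

Lemma vge_inv0 x : x != 0 -> nu x = 0 -> vge 0 x^-1.
Proof. by move=> x0 e; rewrite vgeE ?invr_eq0 // nuV e oppr0. Qed.

Lemma vge_divl r x y : y != 0 -> vge r (x / y) = vge (r + nu y) x.
Proof.
move=> y0; have [->|x0] := eqVneq x 0; first by rewrite mul0r !vge0.
by rewrite !vgeE ?mulf_neq0 ?invr_eq0 // nuM ?invr_eq0 // nuV lerBrDr.
Qed.
Lemma vgt_divl r x y : y != 0 -> vgt r (x / y) = vgt (r + nu y) x.
Proof.
move=> y0; have [->|x0] := eqVneq x 0; first by rewrite mul0r !vgt0.
by rewrite !vgtE ?mulf_neq0 ?invr_eq0 // nuM ?invr_eq0 // nuV ltrBrDr.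
Qed.

(** Ultrametric dominance: a perturbation strictly smaller than y affects neither nonvanishing nor
    valuation. Most exact valuations below are deduced from estimates in this way. *)
Lemma nu_close x y : y != 0 -> vgt (nu y) (x - y) -> x != 0 /\ nu x = nu y.
Proof.
move=> y0 h.
have x0 : x != 0.
  by apply/eqP => e; move: h; rewrite e sub0r vgtN vgtE // ltxx.
split=> //; apply/le_anti/andP; split.
  rewrite leNgt; apply/negP => hlt.
  have : vgt (nu y) (x - (x - y)) by apply: vgtB => //; rewrite vgtE.
  by rewrite subKr vgtE // ltxx.
have : vge (nu y) (x - y + y) by apply: vgeD; [apply: vgtW|rewrite vgeE].
by rewrite subrK vgeE.
Qed.

Lemma vge_all0 x : (forall M : nat, vge M%:R x) -> x = 0.
Proof.
move=> h; apply/eqP/negPn/negP => x0.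
have := h (Num.bound (nu x)); rewrite vgeE // leNgt => /negP; apply.
by have := archi_boundP (x := `|nu x|) (normr_ge0 _); rewrite /Num.bound normr_id; apply: le_lt_trans; apply: ler_norm.
Qed.

(** * The residue field of the valuation ring *)

Section ResidueField.
Local Open Scope quotient_scope.
Definition Opred (_ : is_valuation v) : {pred C} := [pred x | vge 0 x].
Lemma Opred_closed : subring_closed (Opred hv).
Proof.
split; rewrite ?inE; first exact: vge01.
  by move=> x y; rewrite !inE; apply: vgeB.
by move=> x y; rewrite !inE; apply: vge0M.
Qed.
HB.instance Definition _ := GRing.isSubringClosed.Build C (Opred hv) Opred_closed.

Inductive Oint := MkO x of x \in Opred hv.
Definition Oval (o : Oint) := let: MkO x _ := o in x.
HB.instance Definition _ := [isSub for Oval].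
HB.instance Definition _ := [Choice of Oint by <:].
HB.instance Definition _ := [SubChoice_isSubComNzRing of Oint by <:].

Definition Mideal : {pred Oint} := [pred x | vgt 0 (Oval x)].
Lemma Oint_vge (x : Oint) : vge 0 (Oval x). Proof. by case: x. Qed.
Lemma Mideal_closed : idealr_closed Mideal.
Proof.
split; rewrite ?inE; first exact: vgt0.
  by rewrite /vgt /= v1 ltxx.
move=> a x y; rewrite !inE => hx hy; apply: vgtD => //.
by apply: vgtMl => //; apply: Oint_vge.
Qed.
HB.instance Definition _ := isIdealr.Build Oint Mideal Mideal_closed.

Definition kappa := {ideal_quot Mideal}.
HB.instance Definition _ := GRing.ComNzRing.on kappa.

Definition Oinv (x : Oint) : Oint := insubd (0 : Oint) (Oval x)^-1.
Definition kinv (x : kappa) : kappa := if x == 0 then 0 else \pi_kappa (Oinv (repr x)).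

Lemma kinv_mulV (x : kappa) : x != 0 -> kinv x * x = 1.
Proof.
rewrite /kinv; case: ifP => // hx _; set y := repr x.
have ex : x = \pi_kappa y by rewrite reprK.
move/negbT: hx; rewrite {1}ex -{1}(rmorph0 \pi_kappa) -[_ == _]Quotient.idealrBE subr0 inE /= => hy.
have y0 : Oval y != 0 by apply: contra hy => /eqP ->; apply: vgt0.
have vy : nu (Oval y) = 0.
  by move: hy (Oint_vge y); rewrite vgtE // vgeE // -leNgt => h1 h2; apply/le_anti; rewrite h1.
rewrite [X in _ * X]ex -[1](rmorph1 \pi_kappa) -rmorphM /=; congr (\pi _); apply: val_inj => /=.
by rewrite /Oinv insubdK ?mulVf // inE vge_inv0.
Qed.
Lemma kinv0 : kinv 0 = 0. Proof. by rewrite /kinv eqxx. Qed.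
HB.instance Definition _ := GRing.ComNzRing_isField.Build kappa kinv_mulV kinv0.

End ResidueField.

(** The residue field of the whole of C, given by its properties so that the quotient construction
    can be forgotten. One field k containing the residues of all finite extensions avoids embeddings
    between finite fields. *)
Definition residue_map (k : fieldType) (rc : C -> k) : Prop :=
  [/\ rc 1 = 1,
      forall x y, vge 0 x -> vge 0 y -> rc (x + y) = rc x + rc y /\ rc (x * y) = rc x * rc y,
      forall a, exists2 x, vge 0 x & rc x = a
    & forall x, vge 0 x -> (rc x == 0) = vgt 0 x].

Local Open Scope quotient_scope.
Lemma residue_map_exists : exists (k : fieldType) (rc : C -> k), residue_map rc.
Proof.
exists kappa, (fun x => \pi_kappa (insubd (0 : Oint) x)).
have ins x : vge 0 x -> Oval (insubd (0 : Oint) x) = x by move=> h; apply: (insubdK (0 : Oint)); rewrite inE.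
split.
- rewrite -(rmorph1 \pi_kappa); congr (\pi _); apply: val_inj; exact: ins vge01.
- move=> x y hx hy; rewrite -rmorphD -rmorphM; split; congr (\pi _); apply: val_inj => /=; rewrite !ins ?vgeD ?vge0M //.
- move=> a; exists (Oval (repr a)); first exact: Oint_vge.
  rewrite -[RHS]reprK; congr (\pi _); apply: val_inj; exact/ins/Oint_vge.
- move=> x hx; rewrite -(rmorph0 \pi_kappa) -[_ == _]Quotient.idealrBE subr0 inE /= ins //.
Qed.

End Valuation.

(** * p-adic numbers *)

Section Padic.
Variables (p : nat) (C : closedFieldType) (v : C -> \bar rat).
Hypotheses (hp : prime p) (hv : is_valuation v) (vp : v p%:R = 1%E).

Lemma p_neq0 : p%:R != 0 :> C.
Proof. by apply/eqP => e; have := vp; rewrite e (v0 hv). Qed.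
Lemma nu_p : nu v p%:R = 1. Proof. by rewrite /nu vp. Qed.
Lemma vge_p : vge v 1 p%:R. Proof. by rewrite vgeE // ?p_neq0 // nu_p. Qed.

(** By Bezout some multiple u n is congruent to 1 modulo p, hence a unit; as both factors are
    integral, each has valuation 0. *)
Lemma nat_coprime n : ~~ (p %| n)%N -> n%:R != 0 :> C /\ nu v n%:R = 0.
Proof.
move=> hn; have cn : coprime n p by rewrite coprime_sym prime_coprime.
have n0 : (0 < n)%N by case: n hn {cn} => //; rewrite dvdn0.
have [u w e _] := egcdnP p n0; rewrite (eqP cn) in e.
have h : vgt v (nu v 1) ((u * n)%:R - 1).
  rewrite e natrD addrK natrM nu1 //; apply: (@vge_lt _ _ 1) => //.
  by apply: (vgeMl hv); [apply: vge_nat|apply: vge_p].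
have [un0 e1] := nu_close hv (oner_neq0 C) h.
have [u0 n0'] : (u%:R != 0 :> C) /\ (n%:R != 0 :> C).
  by apply/andP; rewrite -negb_or -mulf_eq0 -natrM.
split=> //; move: e1; rewrite natrM nuM // nu1 //.
have := vge_nat hv u; have := vge_nat hv n; rewrite !vgeE // => *; lra.
Qed.

Lemma nat_neq0 n : (0 < n)%N -> n%:R != 0 :> C.
Proof.
move=> n0; have [m cm ->] := pfactor_coprime hp n0.
rewrite natrM natrX mulf_neq0 ?expf_neq0 ?p_neq0 //.
by apply: (proj1 (nat_coprime _)); rewrite -prime_coprime.
Qed.

Lemma nu_natr n : (0 < n)%N -> nu v n%:R = (logn p n)%:R.
Proof.
move=> n0; have [m cm e] := pfactor_coprime hp n0.
have hm : ~~ (p %| m)%N by rewrite -prime_coprime.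
have [m0 em] := nat_coprime hm.
by rewrite {1}e natrM natrX nuM ?expf_neq0 ?p_neq0 // em nuX // nu_p add0r.
Qed.

Lemma int_neq0 (z : int) : z != 0 -> z%:~R != 0 :> C.
Proof. by case: z => n; rewrite ?NegzE ?mulrNz ?oppr_eq0 => h; apply: nat_neq0 => //; rewrite lt0n. Qed.

Lemma ratr_div (a b : int) : b != 0 -> ratr (a%:~R / b%:~R) = a%:~R / b%:~R :> C.
Proof.
move=> b0; set x : rat := _ / _; rewrite /ratr.
have e : numq x * b = a * denq x.
  apply/eqP; rewrite -(eqr_int rat) !intrM; apply/eqP.
  have b0' : b%:~R != 0 :> rat by rewrite intr_eq0.
  have d0 : (denq x)%:~R != 0 :> rat by rewrite intr_eq0 denq_eq0.
  apply: (mulIf (invr_neq0 b0')); rewrite mulfK // mulrAC -/x.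
  by rewrite numqE.
have b0' := int_neq0 b0; have d0 := int_neq0 (denq_neq0 x).
by apply/eqP; rewrite eqr_div // -!intrM e.
Qed.

Lemma ratr_subfield : is_subfield (range (ratr : rat -> C)).
Proof.
have r x : ratr x = (numq x)%:~R / (denq x)%:~R :> C by [].
split.
- exists 1 => //; rewrite -[1 : rat]/(1%:~R) -[1%:~R]divr1 -[X in _ / X]/(1%:~R) ratr_div //.
  by rewrite divr1.
- move=> _ _ [x _ <-] [y _ <-]; have dx := int_neq0 (denq_neq0 x); have dy := int_neq0 (denq_neq0 y).
  exists ((numq x * denq y - numq y * denq x)%:~R / (denq x * denq y)%:~R) => //.
  rewrite ratr_div ?mulf_neq0 ?denq_neq0 // !r intrB !intrM; by field; rewrite dx dy.
- move=> _ _ [x _ <-] [y _ <-]; have dx := int_neq0 (denq_neq0 x); have dy := int_neq0 (denq_neq0 y).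
  have [->|y0] := eqVneq y 0.
    by exists 0 => //; rewrite [ratr 0]r (_ : numq 0 = 0) // !mul0r invr0 mulr0.
  have ny := int_neq0 (_ : numq y != 0); rewrite numq_eq0 in ny; have {}ny := ny y0.
  exists ((numq x * denq y)%:~R / (numq y * denq x)%:~R) => //.
  rewrite ratr_div ?mulf_neq0 ?denq_neq0 ?numq_eq0 // !r !intrM; by field; rewrite dx dy ny.
Qed.

Lemma vclosure_subfield (K : set C) : is_subfield K -> is_subfield (vclosure v K).
Proof.
case=> K1 KB KD; have K0 : K 0 by rewrite -(subrr 1); apply: KB.
split.
- by move=> r; exists 1; rewrite // subrr; apply: vgt0.
- move=> x y hx hy r; have [x' Kx' ex] := hx r; have [y' Ky' ey] := hy r.
  exists (x' - y'); first exact: KB.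
  by rewrite (_ : _ - _ = (x - x') - (y - y')); [apply: vgtB|ring].
- move=> x y hx hy r; have [y0|y0] := eqVneq y 0.
    by exists 0 => //; rewrite y0 invr0 mulr0 subr0; apply: vgt0.
  have [->|x0] := eqVneq x 0; first by exists 0 => //; rewrite mul0r subr0; apply: vgt0.
  have [x' Kx' ex] := hx (r + nu v y).
  (* The first bound gives y' the valuation of y, in particular y' != 0; the second absorbs the
     denominator y y' in the error term x (y' - y) / (y y'). *)
  have [y' Ky' ey] := hy (Num.max (nu v y) (r + nu v y *+ 2 - nu v x)).
  have ey1 : vgt v (nu v y) (y' - y) by rewrite vgt_subC //; apply: vgt_le ey; rewrite le_max lexx.
  have [y'0 nuy] := nu_close hv y0 ey1.
  exists (x' / y'); first exact: KD.
  have -> : x / y - x' / y' = (x - x') / y' + x * (y' - y) / (y * y') by field; rewrite y0 y'0.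
  apply: vgtD => //; first by rewrite vgt_divl // nuy.
  rewrite vgt_divl ?mulf_neq0 // nuM // nuy.
  apply: (@vgt_le _ _ (nu v x + (r + nu v y *+ 2 - nu v x))); first by rewrite mulr2n; lra.
  apply: vgtM; rewrite ?vgeE // vgt_subC //; apply: vgt_le ey; by rewrite le_max lexx orbT.
Qed.

Lemma vclosure_idem (A : set C) x : vclosure v (vclosure v A) x -> vclosure v A x.
Proof.
move=> h r; have [y hy e] := h r; have [z Az e'] := hy r.
by exists z => //; apply: (vgt_trans hv e e').
Qed.

Lemma Qp_subfield : is_subfield (Qp v).
Proof. exact: vclosure_subfield ratr_subfield. Qed.

Section Subfield.
Variable K : set C.
Hypothesis hK : is_subfield K.
Lemma sf1 : K 1. Proof. by case: hK. Qed.
Lemma sfB x y : K x -> K y -> K (x - y). Proof. by case: hK => _ h _; apply: h. Qed.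
Lemma sf0 : K 0. Proof. by rewrite -(subrr 1); apply: sfB; apply: sf1. Qed.
Lemma sfN x : K x -> K (- x). Proof. by move=> h; rewrite -sub0r; apply: sfB => //; apply: sf0. Qed.
Lemma sfD x y : K x -> K y -> K (x + y).
Proof. by move=> hx hy; rewrite -(opprK y); apply: sfB => //; apply: sfN. Qed.
Lemma sfdiv x y : K x -> K y -> K (x / y). Proof. by case: hK => _ _; apply. Qed.
Lemma sfV x : K x -> K x^-1. Proof. by move=> h; rewrite -div1r; apply: sfdiv => //; apply: sf1. Qed.
Lemma sfM x y : K x -> K y -> K (x * y).
Proof. by move=> hx hy; rewrite -(invrK y); apply: sfdiv => //; apply: sfV. Qed.
Lemma sfX x n : K x -> K (x ^+ n).
Proof. by move=> hx; elim: n => [|n IH]; rewrite ?expr0 ?exprS; [apply: sf1|apply: sfM]. Qed.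
Lemma sf_sum (I : Type) (s : seq I) (P : pred I) F : (forall i, P i -> K (F i)) -> K (\sum_(i <- s | P i) F i).
Proof. by move=> h; elim/big_rec: _ => [|i x Pi hx]; [apply: sf0|apply: sfD => //; apply: h]. Qed.
Lemma sf_nat n : K n%:R.
Proof. by elim: n => [|n IH]; rewrite ?mulrS; [apply: sf0|apply: sfD => //; apply: sf1]. Qed.
End Subfield.

Definition Qpdiv := sfdiv Qp_subfield.

Lemma Qp_approx x r : Qp v x -> exists a b : int, [/\ b != 0, coprime `|a| `|b| & vgt v r (x - a%:~R / b%:~R)].
Proof.
move=> h; have [_ [y _ <-] e] := h r; exists (numq y), (denq y).
by rewrite denq_neq0 coprime_num_den.
Qed.

Lemma int_nu (z : int) : z != 0 -> nu v z%:~R = (logn p `|z|)%:R.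
Proof.
move=> z0; case: z z0 => n; rewrite ?NegzE => h; first by rewrite nu_natr // lt0n.
by rewrite mulrNz nuN // nu_natr // abszN.
Qed.

Lemma Qp_nu x : Qp v x -> x != 0 -> exists z : int, nu v x = z%:~R.
Proof.
move=> hx x0; have [a [b [b0 _ e]]] := Qp_approx (nu v x) hx.
move: e; rewrite vgt_subC // => /(nu_close hv x0)[y0 <-].
have b0' := int_neq0 b0.
have a0 : a != 0 by apply: contraNneq y0 => ->; rewrite mul0r.
rewrite nuM ?invr_eq0 ?int_neq0 // nuV // !int_nu //.
by exists ((logn p `|a|)%:Z - (logn p `|b|)%:Z); rewrite intrB.
Qed.

(** Valuations on Q_p are integers, so lying in the maximal ideal already means being divisible by
    p. This gap upgrades congruences in the residue field to congruences modulo p. *)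
Lemma Qp_vgt x : Qp v x -> vgt v 0 x -> vge v 1 x.
Proof.
move=> hx; have [->|x0] := eqVneq x 0; first by move=> _; apply: vge0.
have [z e] := Qp_nu hx x0; rewrite vgtE // vgeE // e.
by rewrite ltr0z -[1]/(1%:~R) ler_int.
Qed.

Lemma vge_mod (n : nat) (a b : int) : (a = b %[mod n])%Z -> vge v (nu v n%:R) (a%:~R - b%:~R : C).
Proof.
move=> /eqP; rewrite eqz_mod_dvd => /dvdzP[q e]; rewrite -intrB e intrM.
have [->|n0] := eqVneq n 0%N; first by rewrite mulr0; apply: vge0.
rewrite -[X in vge v X _]add0r; apply: vgeM => //; first exact: vge_int.
by rewrite vgeE // nat_neq0 // lt0n.
Qed.

(** A close rational approximation is integral too, so in lowest terms its denominator is prime to p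
    and can be inverted modulo p^M. *)
Lemma Zp_approx x (M : nat) : Defs.Zp v x -> exists b : nat, vge v M%:R (x - b%:R).
Proof.
case=> hx; rewrite /= -/(vge v 0 x) => x0.
have [a [b [b0 cab e]]] := Qp_approx M%:R hx.
have b0' := int_neq0 b0.
have hab : vge v 0 (a%:~R / b%:~R).
  rewrite -[_ / _](subKr x); apply: vgeB => //; apply: vge_le (vgtW e); exact: ler0n.
have pb : coprime `|b|%N p.
  rewrite coprime_sym prime_coprime //; apply/negP => pb.
  move: hab; rewrite vge_divl // add0r int_nu //.
  have [a0|a0] := eqVneq a 0.
    move: cab pb; rewrite a0 /coprime absz0 gcd0n => /eqP ->; rewrite dvdn1 => /eqP e1.
    by move: hp; rewrite e1.
  have la : logn p `|a| = 0%N.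
    rewrite logn_coprime // prime_coprime //; apply/negP => pa; have := dvdn_gcd p `|a| `|b|.
    by rewrite pa pb (eqP cab) dvdn1 => /eqP e1; move: hp; rewrite e1.
  rewrite vgeE ?int_neq0 // int_nu // ler_nat la leqn0 => /eqP.
  by move/eqP; rewrite -leqn0 leqNgt logn_gt0 mem_primes hp pb absz_gt0 b0.
have cM : coprimez b (p ^ M)%N by rewrite coprimezE /= coprimeXr.
have [[u w] /= euw] := coprimezP _ _ cM.
have Mp : (p ^ M != 0)%N by rewrite -lt0n expn_gt0 prime_gt0.
have nuM : nu v (p ^ M)%:R = M%:R :> rat by rewrite natrX nuX // nu_p.
exists `|((a * u) %% (p ^ M)%N)%Z|%N.
have -> : (`|((a * u) %% (p ^ M)%N)%Z|%N)%:R = ((a * u) %% (p ^ M)%N)%Z%:~R :> C.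
  by rewrite -[in RHS](gez0_abs (modz_ge0 _ _)).
apply: (vge_trans hv (vgtW e)); apply: (@vge_trans _ _ hv ((a * u)%:~R)).
  have -> : a%:~R / b%:~R - (a * u)%:~R = (a * w)%:~R * (p ^ M)%:R / b%:~R :> C.
    have e1 : u%:~R * b%:~R + w%:~R * (p ^ M)%:R = 1 :> C.
      by have := congr1 (fun z : int => z%:~R : C) euw; rewrite intrD !intrM.
    have e2 : u%:~R * b%:~R = 1 - w%:~R * (p ^ M)%:R :> C by apply/eqP; rewrite eq_sym subr_eq e1.
    by apply: (mulIf b0'); rewrite mulrBl !divfK // !intrM -[_ * u%:~R * b%:~R]mulrA e2; ring.
  rewrite vge_divl // int_nu // logn_coprime ?addr0; last by rewrite coprime_sym.
  rewrite -[M%:R]add0r; apply: vgeM => //; first exact: vge_int.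
  by rewrite vgeE ?nuM // natrX expf_neq0 // p_neq0.
by rewrite -nuM; apply: vge_mod; rewrite modz_mod.
Qed.

Lemma Zp_fermat x : Defs.Zp v x -> vge v 1 (x ^+ p - x).
Proof.
move=> hx; have [b e] := Zp_approx 1 hx; case: (hx) => Qx /= x0.
have x0' : vge v 0 x by [].
have -> : x ^+ p - x = (x ^+ p - b%:R ^+ p) + ((b ^ p)%:R - b%:R) - (x - b%:R) by rewrite natrX; ring.
apply: vgeB => //; apply: vgeD => //.
  rewrite subrXX -[1]addr0; apply: vgeM => //; apply: vge_sum => // i _.
  by apply: vge0M => //; apply: vge0X => //; apply: vge_nat.
rewrite -nu_p; apply: (@vge_mod p (b ^ p)%N b).
by rewrite !modz_nat fermat_little.
Qed.

Section Residue.
Variables (k : fieldType) (rc : C -> k).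
Hypothesis hrc : residue_map v rc.

Lemma rc1 : rc 1 = 1. Proof. by case: hrc. Qed.
Lemma rcD x y : vge v 0 x -> vge v 0 y -> rc (x + y) = rc x + rc y.
Proof. by case: hrc => _ h _ _ hx hy; case: (h x y hx hy). Qed.
Lemma rcM x y : vge v 0 x -> vge v 0 y -> rc (x * y) = rc x * rc y.
Proof. by case: hrc => _ h _ _ hx hy; case: (h x y hx hy). Qed.
Lemma rc_surj a : exists2 x, vge v 0 x & rc x = a. Proof. by case: hrc. Qed.
Lemma rc_eq0 x : vge v 0 x -> (rc x == 0) = vgt v 0 x. Proof. by case: hrc => _ _ _; apply. Qed.
Lemma rc0 : rc 0 = 0. Proof. by apply/eqP; rewrite rc_eq0 ?vge0 // vgt0. Qed.
Lemma rcN x : vge v 0 x -> rc (- x) = - rc x.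
Proof. by move=> hx; apply/eqP; rewrite -addr_eq0 -rcD ?vgeN // addNr rc0. Qed.
Lemma rcB x y : vge v 0 x -> vge v 0 y -> rc (x - y) = rc x - rc y.
Proof. by move=> hx hy; rewrite rcD ?vgeN // rcN. Qed.
Lemma rc_eq x y : vge v 0 x -> vge v 0 y -> (rc x == rc y) = vgt v 0 (x - y).
Proof. by move=> hx hy; rewrite -subr_eq0 -rcB // rc_eq0 // vgeB. Qed.
Lemma rcX x n : vge v 0 x -> rc (x ^+ n) = rc x ^+ n.
Proof. by move=> hx; elim: n => [|n IH]; rewrite ?expr0 ?rc1 // !exprS rcM ?vge0X // IH. Qed.
Lemma rc_nat n : rc n%:R = n%:R.
Proof. by elim: n => [|n IH]; rewrite ?rc0 // !mulrS rcD ?vge01 ?vge_nat // rc1 IH. Qed.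
Lemma rc_sum (I : Type) (s : seq I) (P : pred I) F : (forall i, P i -> vge v 0 (F i)) ->
  rc (\sum_(i <- s | P i) F i) = \sum_(i <- s | P i) rc (F i).
Proof.
move=> h; elim: s => [|i s IH]; rewrite ?big_nil ?rc0 // !big_cons.
by case: ifP => // Pi; rewrite rcD ?IH ?h //; apply: vge_sum.
Qed.
Lemma rc_prod (I : Type) (s : seq I) (P : pred I) F : (forall i, P i -> vge v 0 (F i)) ->
  rc (\prod_(i <- s | P i) F i) = \prod_(i <- s | P i) rc (F i).
Proof.
move=> h; elim: s => [|i s IH]; rewrite ?big_nil ?rc1 // !big_cons.
by case: ifP => // Pi; rewrite rcM ?IH ?h //; apply: vge0_prod.
Qed.

Lemma k_pchar : p \in [pchar k].
Proof.
rewrite inE hp /= -rc_nat rc_eq0 ?vge_nat //.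
by apply: (@vge_lt _ _ 1) => //; apply: vge_p.
Qed.
Lemma k_natr_eq0 n : (n%:R == 0 :> k) = (p %| n)%N.
Proof. by rewrite (dvdn_pcharf k_pchar). Qed.
Lemma k_expD (x y : k) s : (x + y) ^+ (p ^ s) = x ^+ (p ^ s) + y ^+ (p ^ s).
Proof. by apply: exprDn_pchar; apply/pnatP => [|q hq]; rewrite ?expn_gt0 ?prime_gt0 // Euclid_dvdX // dvdn_prime2 // => /andP[/eqP -> _]; apply: k_pchar. Qed.

(** The residues of 0, ..., p - 1 already exhaust the roots of X^p - X. *)
Lemma prime_field (y : k) : y ^+ p = y -> exists b : nat, y = b%:R.
Proof.
move=> hy; have p1 := prime_gt1 hp.
have [/mapP[b _ ->]|hn] := boolP (y \in map (fun b : nat => b%:R) (iota 0 p)); first by exists b.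
have P0 : ('X^p - 'X : {poly k}) != 0 by rewrite -size_poly_eq0 size_polyDl ?size_polyXn // size_polyN size_polyX.
have : (size (y :: map (fun b : nat => b%:R) (iota 0 p)) < size ('X^p - 'X : {poly k})%R)%N.
  apply: max_poly_roots => //=.
    apply/andP; split; first by rewrite rootE !hornerE hy subrr.
    apply/allP => _ /mapP[b _ ->]; rewrite rootE !hornerE.
    by rewrite -[_ ^+ p](pFrobenius_autE k_pchar) pFrobenius_aut_nat subrr.
  rewrite hn /= map_inj_in_uniq ?iota_uniq // => a b; rewrite !mem_iota /= !add0n => ha hb.
  wlog le : a b ha hb / (a <= b)%N => [W e|/eqP].
    by case/orP: (leq_total a b) => h; [apply: W|symmetry; apply: W].
  rewrite eq_sym -subr_eq0 -natrB // k_natr_eq0 => /dvdn_leq h; apply/eqP; rewrite eqn_leq le /=.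
  rewrite leqNgt; apply/negP => lt; have := h; rewrite subn_gt0 lt => /(_ isT).
  by rewrite leqNgt (leq_ltn_trans (leq_subr _ _)).
by rewrite size_polyDl ?size_polyXn ?size_polyN ?size_polyX //= size_map size_iota ltnn.
Qed.

(** Teichmüller elements of level s are encoded as the solutions of z^(p^s) = z, with 0 included.
    Comparing valuations, p^s nu(z) = nu(z) forces 0 on the others. *)
Lemma teich_vge s z : (0 < s)%N -> z ^+ (p ^ s) = z -> vge v 0 z /\ (z != 0 -> nu v z = 0).
Proof.
move=> s0 e; have [->|z0] := eqVneq z 0; first by rewrite vge0.
suff h : nu v z = 0 by rewrite vgeE // h lexx.
have := nuX hv z (p ^ s); rewrite e => /eqP; rewrite -mulr_natr => /eqP h.
have : (1 : rat) < (p ^ s)%:R by rewrite ltr1n -[1%N](exp1n s) ltn_exp2r // prime_gt1.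
by move=> h1; nra.
Qed.

(** The quotient u of two nonzero solutions with equal residue has residue 1 and satisfies u^(p^s -
    1) = 1. If u were not 1, the geometric sum of its powers would vanish, although its residue is
    p^s - 1, that is -1. *)
Lemma teich_inj s z z' : (0 < s)%N -> z ^+ (p ^ s) = z -> z' ^+ (p ^ s) = z' ->
  rc z = rc z' -> z = z'.
Proof.
move=> s0 e e'; have [hz hz0] := teich_vge s0 e; have [hz' hz0'] := teich_vge s0 e'.
have [->|z'0] := eqVneq z' 0.
  rewrite rc0 => /eqP; rewrite rc_eq0 //; have [//|z0] := eqVneq z 0.
  by rewrite vgtE // hz0 // ltxx.
move=> er; pose u := z / z'; pose m := (p ^ s).-1.
have ps : (p ^ s = m.+1)%N by rewrite prednK // expn_gt0 prime_gt0.
have hzi : vge v 0 z'^-1 by rewrite vgeE ?invr_eq0 // nuV // hz0' // oppr0.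
have hu : vge v 0 u by apply: vge0M.
have um : u * (u ^+ m - 1) = 0.
  by rewrite mulrBr mulr1 -exprS -ps /u expr_div_n e e' subrr.
have rcu : rc u = 1.
  by rewrite rcM // er -rcM // mulfV // rc1.
have um1 : u ^+ m = 1.
  move/eqP: um; rewrite mulf_eq0 => /orP[/eqP u0|]; last by rewrite subr_eq0 => /eqP.
  by move: rcu; rewrite u0 rc0 => /eqP; rewrite eq_sym oner_eq0.
have [u1|u1] := eqVneq u 1; first by rewrite -[z](divfK z'0) -/u u1 mul1r.
have : (u - 1) * \sum_(i < m) u ^+ i = 0 by rewrite -subrX1 um1 subrr.
move/eqP; rewrite mulf_eq0 subr_eq0 (negbTE u1) /= => /eqP/(congr1 rc).
rewrite rc0 rc_sum => [|i _]; last exact: vge0X.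
rewrite (eq_bigr (fun=> 1)) => [|i _]; last by rewrite rcX // rcu expr1n.
rewrite sumr_const card_ord => /eqP; rewrite k_natr_eq0 => pm.
have : (p %| m.+1)%N by rewrite -ps dvdn_exp.
by rewrite -addn1 dvdn_addr // dvdn1 => /eqP p1; move: hp; rewrite p1.
Qed.

Lemma teich_roots s : (0 < s)%N -> exists r : seq C,
  [/\ size r = (p ^ s)%N, uniq r, forall z, (z \in r) = (z ^+ (p ^ s) == z)
    & 'X^(p ^ s) - 'X = \prod_(z <- r) ('X - z%:P)].
Proof.
move=> s0; set P : {poly C} := _ - _.
have q1 : (1 < p ^ s)%N by rewrite -[1%N](exp1n s) ltn_exp2r // prime_gt1.
have sP : size P = (p ^ s).+1 by rewrite size_polyDl ?size_polyXn // size_polyN size_polyX.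
have mP : P \is monic by rewrite monicE lead_coefDl ?lead_coefXn // size_polyXn size_polyN size_polyX.
have [r er] := closed_field_poly_normal P; rewrite (eqP mP) scale1r in er.
have mem z : (z \in r) = (z ^+ (p ^ s) == z).
  by rewrite -root_prod_XsubC -er rootE !hornerE subr_eq0.
have sr : size r = (p ^ s)%N by move: sP; rewrite er size_prod_XsubC => -[].
(* The roots are distinct by separability: at a root the derivative p^s z^(p^s - 1) - 1 has residue
   -1. *)
exists r; split=> //; rewrite -separable_prod_XsubC -er.
rewrite unlock; apply/Pdiv.ClosedField.coprimepP => z; rewrite rootE !hornerE => /eqP/subr0_eq e.
have [hz _] := teich_vge s0 e.
rewrite derivB derivXn derivX !hornerE hornerMn !hornerE; apply/negP => /eqP/(congr1 rc).
rewrite rc0 rcB ?vge01 ?vge_Mn ?vge0X // -mulr_natr rcM ?vge0X ?vge_nat //.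
have -> : rc (p ^ s)%:R = 0 by rewrite rc_nat; apply/eqP; rewrite k_natr_eq0 dvdn_exp.
by rewrite mulr0 rc1 sub0r => /eqP; rewrite oppr_eq0 oner_eq0.
Qed.

(** In place of Hensel's lemma: the factorisation of X^(p^s) - X, evaluated at any lift x of y, has
    residue 0, so some factor x - z vanishes in k. *)
Lemma teich_surj s (y : k) : (0 < s)%N -> y ^+ (p ^ s) = y ->
  exists2 z, z ^+ (p ^ s) = z & rc z = y.
Proof.
move=> s0 hy; have [x hx ex] := rc_surj y.
have [r [_ _ mem er]] := teich_roots s0.
have hr z : z \in r -> vge v 0 z by rewrite mem => /eqP/(teich_vge s0)[].
have : rc (\prod_(z <- r) ('X - z%:P)).[x] = 0.
  by rewrite -er !hornerE rcB ?vge0X // rcX // ex hy subrr.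
rewrite horner_prod big_seq rc_prod => [|z hz]; last by rewrite !hornerE; apply: vgeB => //; apply: hr.
rewrite -big_seq => /eqP; rewrite prodf_seq_eq0 => /hasP[z hz /=].
rewrite !hornerE rcB //; last exact: hr.
rewrite subr_eq0 ex => /eqP e.
by exists z => //; apply/eqP; rewrite -mem.
Qed.

Lemma rc_prod_XsubC (s : seq C) : (forall x, x \in s -> vge v 0 x) ->
  (forall i, vge v 0 (\prod_(x <- s) ('X - x%:P))`_i) /\ map_poly rc (\prod_(x <- s) ('X - x%:P)) = \prod_(x <- s) ('X - (rc x)%:P).
Proof.
elim: s => [|x s IH] hs.
  rewrite !big_nil; split=> [i|]; first by rewrite coef1; apply: vge_nat.
  by apply/polyP => i; rewrite coef_map_id0 ?rc0 // !coef1 rc_nat.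
have [|h1 h2] := IH; first by move=> y hy; apply: hs; rewrite inE hy orbT.
have hx : vge v 0 x by apply: hs; rewrite mem_head.
have hX i : vge v 0 ('X * \prod_(y <- s) ('X - y%:P))`_i by rewrite coefXM; case: eqP => _; rewrite ?vge0.
rewrite !big_cons; split=> [i|].
  by rewrite mulrBl coefB coefCM; apply: vgeB => //; apply: vge0M.
apply/polyP => i; rewrite coef_map_id0 ?rc0 // !mulrBl !coefB !coefCM rcB ?vge0M // rcM // -h2.
rewrite !coefXM !coef_map_id0 ?rc0 //; by case: eqP => _; rewrite ?rc0.
Qed.

Lemma monic_int_root (P : {poly C}) x : P \is monic -> (forall i, vge v 0 P`_i) ->
  root P x -> vge v 0 x.
Proof.
move=> mP hP; rewrite rootE horner_coef => /eqP e; apply/negPn/negP => hx.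
have x0 : x != 0 by apply: contraNneq hx => ->; apply: vge0.
have nx : nu v x < 0 by move: hx; rewrite vgeE // -ltNge.
have [n sP] : exists n, size P = n.+1 by exists (size P).-1; rewrite prednK // size_poly_gt0 monic_neq0.
move: e; rewrite sP big_ord_recr /=; have -> : P`_n = 1 by have := eqP mP; rewrite /lead_coef sP.
rewrite mul1r => /eqP; rewrite addrC addr_eq0 => /eqP e.
have : vgt v (nu v (x ^+ n)) (x ^+ n).
  rewrite {2}e vgtN //; apply: vgt_sum => // i _; rewrite -[nu v _]add0r.
  apply: vgtM => //; rewrite vgtE ?expf_neq0 // !nuX // -[_ *+ n]mulr_natr -[_ *+ i]mulr_natr.
  by rewrite ltr_nM2l // ltr_nat.
by rewrite vgtE ?expf_neq0 // ltxx.
Qed.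

(** A monic polynomial is lifted to a monic integral one, which splits in C with integral roots, and
    the factorisation is reduced. This provides the inverse roots needed for the Euler product. *)
Lemma residue_closed (P : {poly k}) : P \is monic -> exists s, P = \prod_(a <- s) ('X - a%:P).
Proof.
move=> mP; have [a|f hf] := @choice k C (fun a x => vge v 0 x /\ rc x = a).
  by have [x ? ?] := rc_surj a; exists x.
have [n sP] : exists n, size P = n.+1 by exists (size P).-1; rewrite prednK // size_poly_gt0 monic_neq0.
pose Q : {poly C} := 'X^n + \poly_(i < n) f P`_i.
have sQ' : (size (\poly_(i < n) f P`_i)%R < size ('X^n : {poly C})%R)%N.
  by rewrite size_polyXn ltnS size_poly.
have mQ : Q \is monic by rewrite monicE lead_coefDl // lead_coefXn.
have hQ i : vge v 0 Q`_i.
  rewrite coefD coefXn coef_poly; apply: vgeD => //; first exact: vge_nat.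
  by case: ifP => _; rewrite ?vge0 //; case: (hf P`_i).
have [r er] := closed_field_poly_normal Q; rewrite (eqP mQ) scale1r in er.
have hr x : x \in r -> vge v 0 x.
  by rewrite -root_prod_XsubC -er; apply: monic_int_root.
exists (map rc r); rewrite big_map -(proj2 (rc_prod_XsubC hr)) -er.
apply/polyP => i; rewrite coef_map_id0 ?rc0 // coefD coefXn coef_poly.
have [lt|] := ltnP i n.
  by rewrite (ltn_eqF lt) add0r; case: (hf P`_i).
rewrite leq_eqVlt => /orP[/eqP <-|lt]; rewrite addr0 rc_nat.
  by rewrite eqxx; have := eqP mP; rewrite /lead_coef sP.
by rewrite (gtn_eqF lt) nth_default // sP.
Qed.
End Residue.
End Padic.

(** * Unramified extensions *)

Section SubfieldType.
Variables (C : closedFieldType) (K : set C).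
Definition sfpred (_ : is_subfield K) : {pred C} := [pred x | `[< K x >]].
Variable hK : is_subfield K.
Lemma sfpredP x : reflect (K x) (x \in sfpred hK).
Proof. exact: asboolP. Qed.
Lemma sfpred_closed : divring_closed (sfpred hK).
Proof.
split; first by apply/sfpredP; apply: sf1 hK.
  by move=> x y /sfpredP hx /sfpredP hy; apply/sfpredP; apply: sfB hK _ _ hx hy.
by move=> x y /sfpredP hx /sfpredP hy; apply/sfpredP; apply: sfdiv hK _ _ hx hy.
Qed.
HB.instance Definition _ := GRing.isDivringClosed.Build C (sfpred hK) sfpred_closed.
Inductive sftype := MkSf x of x \in sfpred hK.
Definition sfval (o : sftype) := let: MkSf x _ := o in x.
HB.instance Definition _ := [isSub for sfval].
HB.instance Definition _ := [Choice of sftype by <:].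
HB.instance Definition _ := [SubChoice_isSubIntegralDomain of sftype by <:].
HB.instance Definition _ := [SubIntegralDomain_isSubField of sftype by <:].

(** Turns a subset of C into a field with an embedding, so that Euclidean division, kernels and
    inverses of matrices can be used over Q_p. *)
Lemma subfield_type : exists (F : fieldType) (i : {rmorphism F -> C}), forall x, K x <-> exists a, i a = x.
Proof.
exists sftype, (val : {rmorphism sftype -> C}) => x; split=> [hx|[a <-]].
  have hx' : x \in sfpred hK by apply/sfpredP.
  by exists (MkSf hx').
by have /sfpredP := valP a.
Qed.
End SubfieldType.

Section LocalFields.
Variables (p : nat) (C : closedFieldType) (v : C -> \bar rat).
Hypotheses (hp : prime p) (hv : is_valuation v) (vp : v p%:R = 1%E).

Lemma Zp_of_approx x : (forall M : nat, exists b : nat, vge v M%:R (x - b%:R)) -> Defs.Zp v x.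
Proof.
move=> h; split; last first.
  have [b hb] := h 0%N; rewrite /= -/(vge v 0 x) -(subrK b%:R x).
  by apply: vgeD => //; apply: vge_nat.
move=> r; pose M := Num.bound `|r|.
have [b hb] := h M; exists b%:R; last first.
  apply: vge_lt hb; apply: le_lt_trans (ler_norm r) _; exact: archi_boundP (normr_ge0 r).
by exists b%:R => //; rewrite -[b%:R]/(b%:Z%:~R) -[b%:~R]divr1 (ratr_div hp hv vp b%:Z (b := 1)) ?divr1.
Qed.

(** * A criterion for a subring to lie in Z_p *)

Section FrobeniusFixed.
Variable T : set C.
Hypotheses (T1 : T 1) (TB : forall x y, T x -> T y -> T (x - y))
  (TM : forall x y, T x -> T y -> T (x * y)) (Tv : forall x, T x -> vge v 0 x)
  (TF : forall x, T x -> exists2 y, T y & x ^+ p - x = p%:R * y).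

(** T with its elements of valuation 0 inverted: extracting a p-adic digit produces unit
    denominators, which T itself need not absorb. *)
Let TL x := exists y u, [/\ T y, T u, u != 0, nu v u = 0 & x = y / u].

Let T0 : T 0. Proof. by rewrite -(subrr 1); apply: TB. Qed.
Let TN x : T x -> T (- x). Proof. by move=> h; rewrite -sub0r; apply: TB. Qed.
Let TD x y : T x -> T y -> T (x + y).
Proof. by move=> hx hy; rewrite -(opprK y); apply: TB => //; apply: TN. Qed.
Let Tnat n : T n%:R. Proof. by elim: n => [|n IH]; rewrite ?mulrS //; apply: TD. Qed.
Let TX x n : T x -> T (x ^+ n).
Proof. by move=> h; elim: n => [|n IH]; rewrite ?expr0 ?exprS //; apply: TM. Qed.

Let TL_vge x : TL x -> vge v 0 x.
Proof. by move=> [y [u [hy hu u0 nu0 ->]]]; rewrite vge_divl // nu0 addr0; apply: Tv. Qed.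

Let TLB x y : TL x -> TL y -> TL (x - y).
Proof.
move=> [a [u [ha hu u0 nu0 ->]]] [b [w [hb hw w0 nw0 ->]]].
exists (a * w - b * u), (u * w); split; rewrite ?mulf_neq0 ?nuM ?nu0 ?nw0 ?addr0 //.
- by apply: TB; apply: TM.
- exact: TM.
by field; rewrite u0 w0.
Qed.

Let T_digit y : T y -> exists (b : nat) x, TL x /\ y = b%:R + p%:R * x.
Proof.
move=> hy; have [k [rc hrc]] := residue_map_exists hv.
have [y' hy' e] := TF hy.
have vp0 : vgt v 0 p%:R by apply: (@vge_lt _ _ 1) => //; apply: vge_p.
have [b eb] : exists b : nat, rc y = b%:R.
  apply: (prime_field hp hv vp hrc); apply/eqP; rewrite -(rcX hv hrc) ?(rc_eq hv hrc) ?vge0X ?Tv //.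
  by rewrite e mulrC; apply: vgtMl => //; apply: Tv.
have hz : vgt v 0 (y - b%:R) by rewrite -(rc_eq hv hrc) ?Tv ?vge_nat // eb (rc_nat hv hrc).
set z := y - b%:R in hz.
have Tz : T z by apply: TB.
have [w hw ew] := TF Tz.
(* Once the digit b is removed, z lies in the maximal ideal and its Frobenius defect p w is, up to
   sign, z times a unit; so z is p times an element of [TL]. *)
have ez : z * (1 - z ^+ p.-1) = - (p%:R * w).
  by rewrite mulrBr mulr1 -exprS prednK ?prime_gt0 // -ew opprB.
have hu : vgt v (nu v 1) (1 - z ^+ p.-1 - 1).
  rewrite nu1 // addrAC subrr add0r vgtN // -(prednK (_ : 0 < p.-1)%N) ?exprS; last by rewrite -ltnS prednK ?prime_gt1 ?prime_gt0.
  by rewrite mulrC; apply: vgtMl => //; apply: vge0X => //; apply: vgtW.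
have [u0 nu0] := nu_close hv (oner_neq0 C) hu.
exists b, (- w / (1 - z ^+ p.-1)); split.
  by exists (- w), (1 - z ^+ p.-1); split; rewrite ?nu0 ?nu1 //; [apply: TN|apply: TB => //; apply: TX].
have ey : y = b%:R + z by rewrite /z addrC subrK.
by rewrite {1}ey; congr (_ + _); rewrite mulrA mulrN -ez mulfK.
Qed.

Let TL_digit x : TL x -> exists (b : nat) x', TL x' /\ x = b%:R + p%:R * x'.
Proof.
move=> [s [u [hs hu u0 nu0 ->]]].
have [w hw ew] := TF hu.
have Ts : T (s * u ^+ p.-2) by apply: TM => //; apply: TX.
have [b [x1 [hx ex]]] := T_digit Ts.
exists b, (x1 - s * w / (u * u)); split.
  apply: TLB => //; exists (s * w), (u * u).
  by split; rewrite ?mulf_neq0 ?nuM ?nu0 ?addr0 //; apply: TM.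
(* Since u^p - u = p w, the inverse of u is u^(p - 2) up to p times an element of [TL], and the
   digit can be read off in T. *)
have -> : s / u = s * u ^+ p.-2 - p%:R * (s * w / (u * u)).
  have ep : u ^+ p = u * u * u ^+ p.-2 by case: (p) (prime_gt1 hp) => [|[|m]] // _; rewrite !exprS mulrA.
  have -> : p%:R * (s * w / (u * u)) = s * (p%:R * w) / (u * u) by field.
  rewrite -ew ep; by field.
by rewrite ex; ring.
Qed.

(** When Frobenius is the identity modulo p inside T, all residues lie in the prime field and each
    element has a p-adic expansion with digits in the natural numbers. *)
Lemma frobenius_fixed_Zp x : T x -> Defs.Zp v x.
Proof.
move=> hx; have {hx} : TL x by exists x, 1; split; rewrite ?oner_neq0 ?nu1 ?divr1.
move=> hx; apply: Zp_of_approx => M.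
suff [b [x' [hx' ->]]] : exists (b : nat) x', TL x' /\ x = b%:R + p%:R ^+ M * x'.
  exists b; rewrite addrAC subrr add0r -[M%:R]addr0; apply: vgeM => //; last exact: TL_vge.
  by have := vgeX hv M (vge_p hv vp).
elim: M => [|M [b [x' [hx' ->]]]].
  by exists 0%N, x; rewrite expr0 mul1r add0r.
have [c [y [hy ->]]] := TL_digit hx'.
exists (b + p ^ M * c)%N, y; split=> //; rewrite natrD natrM natrX exprSr; ring.
Qed.
End FrobeniusFixed.

Lemma expD_p (R : comNzRingType) (a b : R) : exists c, (a + b) ^+ p = a ^+ p + b ^+ p + p%:R * c.
Proof.
have p0 := prime_gt0 hp.
exists (\sum_(1 <= i < p) ('C(p, i) %/ p)%:R * (a ^+ (p - i) * b ^+ i)).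
rewrite exprDn -(big_mkord xpredT (fun i => a ^+ (p - i) * b ^+ i *+ 'C(p, i))).
rewrite big_ltn // big_nat_recr //= subn0 subnn bin0 binn !expr0 mulr1 mul1r !mulr1n.
rewrite [X in _ = _ + X]mulr_sumr -addrA; congr (_ + _); rewrite addrC; congr (_ + _).
apply: eq_big_nat => i hi; rewrite mulrA -natrM mulnC divnK ?mulr_natl //.
by apply: prime_dvd_bin.
Qed.

Lemma int_fermat (a : int) : exists b, a ^+ p = a + p%:R * b.
Proof.
have hnat (n : nat) : exists b : int, n%:Z ^+ p = n%:Z + p%:R * b.
  elim: n => [|n [b IH]]; first by exists 0; rewrite expr0n mulr0 addr0; case: p (prime_gt0 hp).
  have [c] := expD_p (1 : int) n%:Z; rewrite expr1n IH -intS => ->.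
  by exists (b + c); rewrite intS; ring.
case: a => n; first exact: hnat.
have [b hb] := hnat n.+1; rewrite NegzE exprNn hb.
have [->|o] := even_prime hp; first by exists (n.+1%:Z + b); ring.
by exists (- b); rewrite -signr_odd o expr1; ring.
Qed.

Lemma poly_frob (g : {poly int}) : exists k, g ^+ p = g \Po 'X^p + p%:R * k.
Proof.
elim/poly_ind: g => [|g c [k IH]].
  by exists 0; rewrite comp_poly0 mulr0 addr0 expr0n; case: p (prime_gt0 hp).
have [e ->] := expD_p (g * 'X) c%:P.
have [b eb] := int_fermat c.
exists (k * 'X^p + b%:P + e).
rewrite exprMn IH -polyC_exp eb comp_poly_MXaddC.
rewrite polyCD polyCM -[p%:R%:P]/((p%:R : int)%:P) rmorph_nat; ring.
Qed.

Definition ieval (x : C) (g : {poly int}) : C := (map_poly intr g).[x].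
Lemma ieval_is_additive x : zmod_morphism (ieval x).
Proof. by move=> g h; rewrite /ieval rmorphB !hornerE. Qed.
Lemma ieval_is_multiplicative x : monoid_morphism (ieval x).
Proof. by split=> [|g h]; rewrite /ieval ?rmorph1 ?rmorphM !hornerE. Qed.
HB.instance Definition _ x := GRing.isZmodMorphism.Build {poly int} C (ieval x) (ieval_is_additive x).
HB.instance Definition _ x := GRing.isMonoidMorphism.Build {poly int} C (ieval x) (ieval_is_multiplicative x).
Lemma ievalX x : ieval x 'X = x.
Proof. by rewrite /ieval map_polyX hornerX. Qed.
Lemma ieval_comp x g n : ieval x (g \Po 'X^n) = ieval (x ^+ n) g.
Proof. by rewrite /ieval map_comp_poly map_polyXn horner_comp hornerXn. Qed.

Lemma unity_vge x m : (0 < m)%N -> x ^+ m = 1 -> [/\ x != 0, nu v x = 0 & vge v 0 x].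
Proof.
move=> m0 e; have x0 : x != 0 by apply/eqP => x0; move/eqP: e; rewrite x0 expr0n eqn0Ngt m0 eq_sym oner_eq0.
have := nuX hv x m; rewrite e nu1 // => /esym/eqP; rewrite mulrn_eq0 eqn0Ngt m0 /= => /eqP h.
by rewrite vgeE // h.
Qed.

Lemma ieval_vge x g : vge v 0 x -> vge v 0 (ieval x g).
Proof.
move=> hx; rewrite /ieval horner_coef; apply: vge_sum => // i _.
by rewrite coef_map; apply: vge0M => //; [apply: vge_int|apply: vge0X].
Qed.

(** Galois descent by hand. Over the integers g^p = g(X^p) + p k, so a stable g satisfies g(x)^p =
    g(x) + p k(x), and k is stable again; the values at w of stable polynomials form a ring as in
    [frobenius_fixed_Zp]. Stability is required at all m-th roots of unity because that of k at x
    uses that of g at x^p. *)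
Lemma stable_Zp w m g : (0 < m)%N -> w ^+ m = 1 ->
  (forall x, x ^+ m = 1 -> ieval (x ^+ p) g = ieval x g) -> Defs.Zp v (ieval w g).
Proof.
move=> m0 wm hg; have [_ _ vw] := unity_vge m0 wm.
pose T : set C := fun x => exists2 g, (forall x, x ^+ m = 1 -> ieval (x ^+ p) g = ieval x g) & x = ieval w g.
apply: (@frobenius_fixed_Zp T); last by exists g.
- by exists 1 => [x _|]; rewrite !rmorph1.
- by move=> _ _ [a ha ->] [b hb ->]; exists (a - b) => [x hx|]; rewrite !rmorphB //= ha // hb.
- by move=> _ _ [a ha ->] [b hb ->]; exists (a * b) => [x hx|]; rewrite !rmorphM //= ha // hb.
- by move=> _ [a _ ->]; apply: ieval_vge.
move=> _ [a ha ->]; have [k ek] := poly_frob a.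
have ev x : x ^+ m = 1 -> ieval x a ^+ p = ieval x a + p%:R * ieval x k.
  by move=> hx; rewrite -rmorphXn ek rmorphD rmorphM rmorph_nat /= ieval_comp ha.
exists (ieval w k); last by rewrite ev // addrAC subrr add0r.
exists k => // x hx; have hx' : (x ^+ p) ^+ m = 1 by rewrite -exprM mulnC exprM hx expr1n.
apply: (mulfI (p_neq0 hv vp)); apply: (@addrI _ (ieval x a)).
by rewrite -ev // -{1}ha // -ev // ha.
Qed.

Lemma teich_unity s (z : C) : (0 < s)%N -> z ^+ (p ^ s) = z -> z != 0 -> (0 < p ^ s - 1)%N /\ z ^+ (p ^ s - 1) = 1.
Proof.
move=> s0 e z0; have q1 : (1 < p ^ s)%N by rewrite -[1%N](exp1n s) ltn_exp2r // prime_gt1.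
rewrite subn_gt0; split=> //; apply: (mulfI z0); rewrite mulr1 -exprS subn1 prednK //; exact: ltnW.
Qed.
Lemma unity_teich s (z : C) : (0 < s)%N -> z ^+ (p ^ s - 1) = 1 -> z ^+ (p ^ s) = z.
Proof.
move=> s0 e; have q1 : (0 < p ^ s)%N by rewrite expn_gt0 prime_gt0.
by rewrite -(prednK q1) exprS -subn1 e mulr1.
Qed.

Lemma teich_trace_Zp s (z : C) : (0 < s)%N -> z ^+ (p ^ s) = z -> Defs.Zp v (\sum_(i < s) z ^+ (p ^ i)).
Proof.
move=> s0 e; have [z0|z0] := eqVneq z 0.
  rewrite z0 big1 => [|i _]; last by rewrite expr0n expn_eq0 eqn0Ngt prime_gt0.
  by split; [apply: (sf0 (Qp_subfield hp hv vp))|rewrite /= (v0 hv)].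
have [m0 em] := teich_unity s0 e z0.
have -> : \sum_(i < s) z ^+ (p ^ i) = ieval z (\sum_(i < s) 'X^(p ^ i)).
  by rewrite rmorph_sum; apply: eq_bigr => i _; rewrite rmorphXn /= ievalX.
apply: (stable_Zp m0 em) => x hx; rewrite !rmorph_sum /=.
case: s s0 e m0 em hx => // s _ _ _ _ hx.
rewrite big_ord_recr big_ord_recl /= addrC !rmorphXn /= !ievalX; congr (_ + _).
  by rewrite -exprM -expnS expn0 expr1; apply: unity_teich.
by apply: eq_bigr => i _; rewrite !rmorphXn /= !ievalX -exprM -expnS.
Qed.

Section Unramified.
Variables (k : fieldType) (rc : C -> k).
Hypothesis hrc : residue_map v rc.
Variables (n : nat) (w : C).
Hypotheses (n0 : (0 < n)%N) (hw : (p ^ n - 1).-primitive_root w).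

Definition frob_poly (w : C) : {poly C} := \prod_(i < n) ('X - (w ^+ (p ^ i))%:P).

(** The coefficients are integer polynomials in w, and replacing w by w^p permutes the factors
    cyclically. *)
Lemma frob_poly_Zp i : Defs.Zp v (frob_poly w)`_i.
Proof.
pose G : {poly {poly int}} := \prod_(j < n) ('X - ('X^(p ^ j))%:P).
have eG x : map_poly (ieval x) G = frob_poly x.
  rewrite rmorph_prod; apply: eq_bigr => j _; rewrite rmorphB /= map_polyX map_polyC /=.
  by rewrite rmorphXn /= ievalX.
rewrite -eG coef_map; apply: (stable_Zp (prim_order_gt0 hw) (prim_expr_order hw)) => x hx.
rewrite -!coef_map !eG; suff -> : frob_poly (x ^+ p) = frob_poly x by [].
rewrite /frob_poly.
case: (n) n0 hx => // n' _ hx; rewrite big_ord_recr big_ord_recl /= mulrC; congr (_ * _).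
  by rewrite -exprM -expnS expn0 expr1 unity_teich.
by apply: eq_bigr => j _; rewrite -exprM -expnS.
Qed.

Lemma w_teich : w ^+ (p ^ n) = w.
Proof. exact: unity_teich (prim_expr_order hw). Qed.

Lemma w_conj_uniq : uniq [seq w ^+ (p ^ i) | i <- iota 0 n].
Proof.
have p1 := prime_gt1 hp.
rewrite map_inj_in_uniq ?iota_uniq // => a b; rewrite !mem_iota /= !add0n => ha hb.
move/eqP; rewrite (eq_prim_root_expr hw).
(* Exponents below the order can be compared directly. The case n = 1 is set apart because p^0 < p -
   1 fails for p = 2; there is then only one conjugate. *)
have lt c : (c < n)%N -> (n = 1)%N \/ (p ^ c < p ^ n - 1)%N.
  move=> hc; have [->|n1] := eqVneq n 1%N; [by left|right].
  have : (p ^ c * 2 <= p ^ n)%N.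
    apply: (@leq_trans (p ^ c.+1)); last by rewrite leq_exp2l.
    by rewrite expnSr leq_mul2l p1 orbT.
  have h1 : (p ^ n > 2)%N.
    have : (p ^ 2 <= p ^ n)%N by rewrite leq_exp2l // ltn_neqAle eq_sym n1.
    by apply: leq_trans; apply: (@leq_trans (2 ^ 2)) => //; rewrite leq_exp2r.
  case: (c) (expn_gt0 p c) => [|c']; first by rewrite expn0; lia.
  have : (p ^ c'.+1 >= 2)%N by rewrite expnS; apply: (leq_trans p1); rewrite leq_pmulr // expn_gt0 prime_gt0.
  lia.
case: (lt a ha) => [n1|la]; first by move: ha hb; rewrite n1 !ltnS !leqn0 => /eqP -> /eqP ->.
case: (lt b hb) => [n1|lb]; first by move: ha hb; rewrite n1 !ltnS !leqn0 => /eqP -> /eqP ->.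
by rewrite !modn_small // eqn_exp2l // => /eqP.
Qed.

Lemma rc_conj_uniq : uniq [seq rc w ^+ (p ^ i) | i <- iota 0 n].
Proof.
have [_ _ vw] := unity_vge (prim_order_gt0 hw) (prim_expr_order hw).
have := w_conj_uniq; rewrite -(@map_inj_in_uniq _ _ rc) => [|x y /mapP[i _ ->] /mapP[j _ ->]].
  by rewrite -map_comp (@eq_map _ _ _ (fun i => rc w ^+ (p ^ i))) // => i /=; rewrite (rcX hv hrc).
by apply: (teich_inj hp hv vp hrc n0); rewrite -!exprM mulnC exprM w_teich.
Qed.

Lemma Zp_rc_frob x : Defs.Zp v x -> rc x ^+ p = rc x.
Proof.
move=> hx; have vx : vge v 0 x by case: hx.
apply/eqP; rewrite -(rcX hv hrc) // (rc_eq hv hrc) ?vge0X //.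
by apply: (@vge_lt _ _ 1) => //; apply: Zp_fermat hx.
Qed.

(** The reduction of g has coefficients in the prime field, so with rc w it has all n distinct
    conjugates as roots, too many for its degree. *)
Lemma Zp_indep (g : {poly C}) : (size g <= n)%N -> (forall i, Defs.Zp v g`_i) ->
  vgt v 0 g.[w] -> forall i, vgt v 0 g`_i.
Proof.
move=> sg hg hgw i; have [_ _ vw] := unity_vge (prim_order_gt0 hw) (prim_expr_order hw).
have vg j : vge v 0 g`_j by case: (hg j).
pose G := map_poly rc g.
have eG j : G`_j = rc g`_j by rewrite coef_map_id0 // (rc0 hv hrc).
have sG : (size G <= n)%N by apply: leq_trans (size_poly _ _) sg.
have ev j : G.[rc w ^+ (p ^ j)] = G.[rc w] ^+ (p ^ j).
  rewrite !horner_coef; elim: j => [|j IH].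
    by rewrite expn0 !expr1.
  rewrite expnSr exprM [RHS]exprM -IH -[RHS](pFrobenius_autE (k_pchar hp hv vp hrc)) rmorph_sum /=.
  apply: eq_bigr => l _; rewrite rmorphM /= !pFrobenius_autE eG Zp_rc_frob //.
  congr (_ * _). by rewrite -!exprM -mulnA [(p * l)%N]mulnC.
have Gw : G.[rc w] = 0.
  apply/eqP; rewrite -(rc_eq0 hrc) in hgw; last first.
    by rewrite horner_coef; apply: vge_sum => // j _; apply: vge0M => //; apply: vge0X.
  move: hgw; rewrite horner_coef (rc_sum hv hrc) => [|j _]; last by apply: vge0M => //; apply: vge0X.
  rewrite (horner_coef_wide _ (size_poly _ _ : (size G <= size g)%N)) => /eqP e.
  apply/eqP; rewrite -[RHS]e; apply: eq_bigr => j _.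
  by rewrite eG (rcM hrc) ?vge0X // (rcX hv hrc).
have G0 : G = 0.
  apply: contraTeq sG => G0; rewrite -ltnNge.
  have := max_poly_roots G0 _ rc_conj_uniq; rewrite size_map size_iota; apply.
  by apply/allP => _ /mapP[j _ ->]; rewrite rootE ev Gw expr0n expn_eq0 eqn0Ngt prime_gt0.
by rewrite -(rc_eq0 hrc) // -eG G0 coef0.
Qed.

(** Dividing by a coefficient of least valuation reduces to [Zp_indep]. The powers of w are thus
    orthogonal for the valuation, which excludes ramification. *)
Lemma Qp_indep (g : {poly C}) : (size g <= n)%N -> (forall i, Qp v g`_i) -> g != 0 ->
  exists2 i, g`_i != 0 & [/\ g.[w] != 0, nu v g.[w] = nu v g`_i & forall j, vge v (nu v g`_i) g`_j].
Proof.
move=> sg hg g0; have [_ _ vw] := unity_vge (prim_order_gt0 hw) (prim_expr_order hw).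
have hl : g`_(size g).-1 != 0 by rewrite -lead_coefE lead_coef_eq0.
have sz0 : (0 < size g)%N by rewrite size_poly_gt0.
pose i0 : 'I_(size g) := Ordinal (etrans (congr1 (leq^~ _) (prednK sz0)) (leqnn _)).
case: (@Order.TotalTheory.arg_minP _ rat _ i0 (fun i : 'I_(size g) => g`_i != 0) (fun i => nu v g`_i) hl) => i hi hmin.
have min j : vge v (nu v g`_i) g`_j.
  have [->|gj] := eqVneq g`_j 0; first exact: vge0.
  rewrite vgeE //; have [lt|ge] := ltnP j (size g); first exact: (hmin (Ordinal lt)).
  by move: gj; rewrite nth_default // eqxx.
pose G := (g`_i)^-1 *: g.
have hG j : Defs.Zp v G`_j.
  rewrite coefZ mulrC; split; first exact: (Qpdiv hp hv vp).
  by rewrite /= -/(vge v 0 _) vge_divl // add0r.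
have nG : ~~ vgt v 0 G.[w].
  apply/negP => h; have := Zp_indep (leq_trans (size_scale_leq _ _) sg) hG h i.
  by rewrite coefZ mulVf // /vgt v1 // ltxx.
have vG : vge v 0 G.[w].
  rewrite horner_coef; apply: vge_sum => // j _; apply: vge0M => //; last exact: vge0X.
  by case: (hG j).
have G0 : G.[w] != 0 by apply: contraNneq nG => ->; apply: vgt0.
have nuG : nu v G.[w] = 0.
  by apply/le_anti; move: nG vG; rewrite vgtE // vgeE // -leNgt => -> ->.
exists (i : nat) => //; have e : g.[w] = g`_i * G.[w] by rewrite hornerZ mulVKf.
by rewrite e mulf_neq0 // nuM // nuG addr0.
Qed.

End Unramified.
End LocalFields.

Section Unramified.
Variables (p : nat) (C : closedFieldType) (v : C -> \bar rat).
Hypotheses (hp : prime p) (hC : is_Cp v p).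

Let hv : is_valuation v. Proof. by case: hC. Qed.
Let vp : v p%:R = 1%E. Proof. by case: hC. Qed.
Let hcomp : forall u, cauchy_seq v u -> exists l, converges_to v u l. Proof. by case: hC. Qed.
Let Qf := Qp_subfield hp hv vp.

Variables (k : fieldType) (rc : C -> k).
Hypothesis hrc : residue_map v rc.

Variables (F : fieldType) (i : {rmorphism F -> C}).
Hypothesis hF : forall x, Qp v x <-> exists a, i a = x.

Let iQ a : Qp v (i a). Proof. by apply/hF; exists a. Qed.

Lemma lift_poly (g : {poly C}) : (forall j, Qp v g`_j) -> exists G, map_poly i G = g.
Proof.
move=> hg; have [j|f hf] := @choice nat F (fun j a => i a = g`_j); first exact/hF.
exists (\poly_(j < size g) f j); apply/polyP => j; rewrite coef_map coef_poly.
by case: ltnP => h; [exact: hf|rewrite nth_default //; exact: rmorph0].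
Qed.

Lemma lift_mx a b (M : 'M[C]_(a, b)) : (forall s t, Qp v (M s t)) -> exists G, map_mx i G = M.
Proof.
move=> hM; have [st|f hf] := @choice ('I_a * 'I_b)%type F (fun st x => i x = M st.1 st.2); first exact/hF.
by exists (\matrix_(s, t) f (s, t)); apply/matrixP => s t; rewrite !mxE hf.
Qed.

Section Powers.
Variables (n : nat) (n0 : (0 < n)%N).

Section PowerBasis.
Variable w : C.
Hypothesis hw : (p ^ n - 1).-primitive_root w.

Lemma conj_prim j : (p ^ n - 1).-primitive_root (w ^+ (p ^ j)).
Proof.
rewrite (prim_root_exp_coprime _ hw) coprimeXl // prime_coprime //; apply/negP => h.
have q0 : (0 < p ^ n)%N by rewrite expn_gt0 prime_gt0.
have : (p %| p ^ n)%N by rewrite dvdn_exp.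
by rewrite -(subnK q0) dvdn_addr // dvdn1 => /eqP p1; move: hp; rewrite p1.
Qed.

Lemma indep0 (g : {poly F}) : (size g <= n)%N -> (map_poly i g).[w] = 0 -> g = 0.
Proof.
move=> sg e; apply/eqP; apply: contra_eqT e => g0.
have [|||j _ [h _ _]] // := @Qp_indep p C v hp hv vp k rc hrc n w n0 hw (map_poly i g).
- by rewrite size_map_poly.
- by move=> j; rewrite coef_map; apply: iQ.
- by rewrite map_poly_eq0.
Qed.

Lemma frob_min : exists m : {poly F}, [/\ map_poly i m = frob_poly p n w, m \is monic & size m = n.+1].
Proof.
have [|m em] := @lift_poly (frob_poly p n w).
  by move=> j; case: (frob_poly_Zp hp hv vp n0 hw j).
have mm : map_poly i m \is monic by rewrite em; apply: monic_prod_XsubC.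
exists m; split=> //; first by rewrite -(map_monic i).
rewrite -(size_map_poly i) em /frob_poly -(big_mkord xpredT (fun j => 'X - (w ^+ (p ^ j))%:P)).
rewrite -(big_map (fun j => w ^+ (p ^ j)) xpredT (fun x => 'X - x%:P)).
by rewrite size_prod_XsubC size_map size_iota subn0.
Qed.

Lemma frob_poly_root j : (j < n)%N -> root (frob_poly p n w) (w ^+ (p ^ j)).
Proof.
move=> hj; rewrite rootE horner_prod (bigD1 (Ordinal hj)) //= !hornerE subrr mul0r //.
Qed.
End PowerBasis.

Variable w : C.
Hypothesis hw : (p ^ n - 1).-primitive_root w.

(** This replaces the Galois action: the remainder of g modulo [frob_poly] has degree below n and
    vanishes at a primitive root of unity, so it is 0, and g vanishes at every conjugate. *)
Lemma root_conj (g : {poly F}) j j' : (j < n)%N -> (j' < n)%N ->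
  (map_poly i g).[w ^+ (p ^ j)] = 0 -> (map_poly i g).[w ^+ (p ^ j')] = 0.
Proof.
move=> hj hj' e; have [m [em mm sm]] := frob_min hw.
have m0 := monic_neq0 mm.
have hm l : (l < n)%N -> (map_poly i m).[w ^+ (p ^ l)] = 0.
  by move=> hl; apply/rootP; rewrite em frob_poly_root.
have : g %% m = 0.
  apply: (indep0 (conj_prim hw j)); first by rewrite -ltnS -sm ltn_modp.
  have := e; rewrite {1}(divp_eq g m) rmorphD rmorphM /= !hornerE hm // mulr0 add0r; exact.
by move=> g0; rewrite (divp_eq g m) g0 addr0 rmorphM /= !hornerE hm // mulr0.
Qed.

Definition Lpow : set C := fun x => exists g : {poly F}, x = (map_poly i g).[w].

Lemma LpowP x : Lpow x -> exists2 g : {poly F}, (size g <= n)%N & x = (map_poly i g).[w].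
Proof.
move=> [g ->]; have [m [em mm sm]] := frob_min hw.
exists (g %% m); first by rewrite -ltnS -sm ltn_modp monic_neq0.
rewrite {1}(divp_eq g m) rmorphD rmorphM /= !hornerE.
have -> : (map_poly i m).[w] = 0 by apply/rootP; rewrite em -[w]expr1 -(expn0 p) frob_poly_root.
by rewrite mulr0 add0r.
Qed.

Lemma Lpow_subfield : is_subfield Lpow.
Proof.
split.
- by exists 1; rewrite rmorph1 hornerC.
- by move=> _ _ [g ->] [h ->]; exists (g - h); rewrite rmorphB !hornerE.
move=> _ _ [g ->] [h ->]; set y := (map_poly i h).[w]; have [y0|y0] := eqVneq y 0.
  by exists 0; rewrite y0 invr0 mulr0 rmorph0 horner0.
have [m [em mm sm]] := frob_min hw.
(* A common factor of h and m would have a root, necessarily a conjugate of w, and [root_conj] would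
   make the denominator vanish at w. *)
have /Bezout_eq1_coprimepP[[u1 u2] /= eu] : coprimep h m.
  rewrite /coprimep; apply/negPn/negP => sD.
  have : size (map_poly i (gcdp h m)) != 1%N by rewrite size_map_poly.
  move/closed_rootP => [c hc].
  have cm : root (map_poly i m) c by rewrite -(divpK (dvdp_gcdr h m)) rmorphM rootM hc orbT.
  have ch : root (map_poly i h) c by rewrite -{1}(divpK (dvdp_gcdl h m)) rmorphM rootM hc orbT.
  move: cm; rewrite em /frob_poly rootE horner_prod => /eqP/eqP; rewrite prodf_seq_eq0 => /hasP[j _ /=].
  rewrite !hornerE subr_eq0 => /eqP ec.
  have := @root_conj h j 0 (ltn_ord j) n0; rewrite expn0 expr1 -ec => /(_ (rootP ch)) e0.
  by move: y0; rewrite /y e0 eqxx.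
exists (g * u1); rewrite rmorphM /= hornerM; congr (_ * _).
apply: (mulIf y0); rewrite mulVf // /y -hornerM -rmorphM /= -(addrK (u2 * m) (u1 * h)) eu.
rewrite rmorphB rmorph1 rmorphM /= !hornerE.
have -> : (map_poly i m).[w] = 0 by apply/rootP; rewrite em -[w]expr1 -(expn0 p) frob_poly_root.
by rewrite mulr0 subr0.
Qed.

Lemma power_coord (c c' : 'rV[C]_n) : (forall j, Qp v (c 0 j)) -> (forall j, Qp v (c' 0 j)) ->
  \sum_j c 0 j * w ^+ j = \sum_j c' 0 j * w ^+ j -> c = c'.
Proof.
move=> hc hc' e.
have [|f hf] := @lift_mx _ _ (c - c').
  by move=> s t; rewrite !mxE (ord1 s); apply: (sfB Qf).
pose g : {poly F} := \poly_(j < n) (if insub j is Some j' then f 0 j' else 0).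
have gE (j : 'I_n) : g`_j = f 0 j by rewrite coef_poly ltn_ord valK.
have g0 : g = 0.
  apply: (indep0 hw); first exact: size_poly.
  rewrite (@horner_coef_wide _ n) ?size_map_poly ?size_poly //.
  have -> : \sum_(j < n) (map_poly i g)`_j * w ^+ j = \sum_(j < n) (c 0 j * w ^+ j - c' 0 j * w ^+ j).
    apply: eq_bigr => j _; rewrite coef_map gE -mulrBl; congr (_ * _).
    by have := congr1 (fun M : 'rV[C]_n => M 0 j) hf; rewrite !mxE.
  by rewrite sumrB e subrr.
have f0 : f = 0 by apply/rowP => j; rewrite -gE g0 coef0 mxE.
by apply/eqP; rewrite -subr_eq0 -hf f0 map_mx0.
Qed.

Lemma Lpow_unramified : is_unramified_ext v n Lpow.
Proof.
split.
- exact: Lpow_subfield.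
- by move=> x /hF[a <-]; exists a%:P; rewrite map_polyC hornerC.
- exists (\col_j w ^+ j); split=> [j|x /LpowP[g sg ->]].
    by rewrite mxE; exists 'X^j; rewrite map_polyXn hornerXn.
  exists (\row_j i g`_j); split.
    split=> [j|]; first by rewrite mxE.
    rewrite (@horner_coef_wide _ n) ?size_map_poly //; apply: eq_bigr => j _.
    by rewrite !mxE coef_map.
  move=> c [hc]; rewrite (@horner_coef_wide _ n) ?size_map_poly // => e.
  apply: power_coord => // [j|]; first by rewrite mxE.
  transitivity (\sum_(j < n) (map_poly i g)`_j * w ^+ j); last first.
    by rewrite e; apply: eq_bigr => j _; rewrite mxE.
  by apply: eq_bigr => j _; rewrite mxE coef_map.
- move=> x /LpowP[g sg ->]; have [->|g0] := eqVneq g 0.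
    by exists 0; [apply: (sf0 Qf)|rewrite rmorph0 horner0].
  have [|||j hj [h1 h2 _]] := @Qp_indep p C v hp hv vp k rc hrc n w n0 hw (map_poly i g).
  + by rewrite size_map_poly.
  + by move=> l; rewrite coef_map; apply: iQ.
  + by rewrite map_poly_eq0.
  by exists (map_poly i g)`_j; [rewrite coef_map; apply: iQ|rewrite !(vE hv) // h2].
Qed.

(** * Teichmüller elements and traces in an arbitrary unramified extension *)

Section Uniqueness.
Variable L : set C.
Hypothesis hL : is_unramified_ext v n L.

Let Lf : is_subfield L. Proof. by case: hL. Qed.
Let QL : subset (Qp v) L. Proof. by case: hL. Qed.
Let Lvgt x : L x -> vgt v 0 x -> vge v 1 x.
Proof.
case: hL => _ _ _ h /h[y Qy e] hx; rewrite /vge e; apply: (Qp_vgt hp hv vp Qy).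
by rewrite /vgt -e.
Qed.
Let cLf := vclosure_subfield hv Lf.

(** Independence of the reductions over the prime field, phrased with coefficients in Z_p so that no
    residue field of L is needed. *)
Definition resid r (y : 'I_r -> C) := (forall j, L (y j) /\ vge v 0 (y j)) /\
  forall c : 'I_r -> C, (forall j, Defs.Zp v (c j)) -> vgt v 0 (\sum_j c j * y j) ->
    forall j, vgt v 0 (c j).

(** A linear relation over Q_p, divided by its coefficient of least valuation, becomes one over Z_p
    with a coefficient 1, against residual independence. *)
Lemma resid_le r (y : 'I_r -> C) : resid y -> (r <= n)%N.
Proof.
move=> [hy hind]; case: hL => _ _ [e [he hb]] _.
have [j|c hc] := @choice 'I_r 'rV[C]_n (fun j c => (forall l, Qp v (c 0 l)) /\ y j = \sum_l c 0 l * e l 0).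
  by have [c [[h1 h2] _]] := hb _ (proj1 (hy j)); exists c.
have [|M hM] := @lift_mx _ _ (\matrix_(j, l) c j 0 l); first by move=> s t; rewrite mxE; case: (hc s).
rewrite leqNgt; apply/negP => ltr.
have : kermx M != 0.
  rewrite -mxrank_eq0 mxrank_ker -lt0n subn_gt0; exact: leq_ltn_trans (rank_leq_col _) ltr.
move/rowV0Pn => [u /sub_kermxP uM u0].
have sum0 : \sum_j i (u 0 j) * y j = 0.
  transitivity (\sum_l (\sum_j i (u 0 j) * c j 0 l) * e l 0).
    under eq_bigr => j _ do rewrite (proj2 (hc j)) mulr_sumr.
    rewrite exchange_big /=; apply: eq_bigr => l _; rewrite mulr_suml; apply: eq_bigr => j _; exact: mulrA.
  apply: big1 => l _; have := congr1 (fun M : 'M[F]_(1, n) => i (M 0 l)) uM; rewrite !mxE rmorph0 rmorph_sum /= => e0.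
  rewrite (_ : \sum_j _ = 0) ?mul0r //; rewrite -[RHS]e0; apply: eq_bigr => j _; rewrite rmorphM; congr (_ * _).
  by have := congr1 (fun M : 'M[C]_(r, n) => M j l) hM; rewrite !mxE.
have [j0 hj0] : exists j0, u 0 j0 != 0.
  by apply/existsP; apply: contraNT u0 => /existsPn h; apply/eqP/rowP => j; rewrite mxE; apply/eqP/negPn.
case: (@Order.TotalTheory.arg_minP _ rat _ j0 (fun j : 'I_r => u 0 j != 0) (fun j => nu v (i (u 0 j))) hj0) => j1 hj1 hmin.
have i1 : i (u 0 j1) != 0 by rewrite fmorph_eq0.
suff : vgt v 0 (i (u 0 j1) / i (u 0 j1)) by rewrite mulfV // /vgt v1 // ltxx.
apply: (hind (fun j => i (u 0 j) / i (u 0 j1))) => [j|]; last first.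
  under eq_bigr => j _ do rewrite mulrAC.
  by rewrite -mulr_suml sum0 mul0r; apply: vgt0.
split; first exact: (Qpdiv hp hv vp).
rewrite /= -/(vge v 0 _) vge_divl // add0r.
have [->|uj] := eqVneq (u 0 j) 0; first by rewrite rmorph0; apply: vge0.
by rewrite vgeE ?fmorph_eq0 // hmin.
Qed.

(** That L is closed is not among its defining properties. Expanding integral elements of the
    closure, instead of those of L only, proves it. *)
Let good x := vclosure v L x /\ vge v 0 x.

Lemma resid_max : exists r (y : 'I_r -> C), resid y /\ forall y' : 'I_r.+1 -> C, ~ resid y'.
Proof.
have h0 : exists r, `[< exists y : 'I_r -> C, resid y >].
  by exists 0%N; apply/asboolP; exists (fun=> 0); split=> [[]|c _ _ []].
have hb r : `[< exists y : 'I_r -> C, resid y >] -> (r <= n)%N.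
  by move=> /asboolP[y /resid_le].
case: (ex_maxnP h0 hb) => r /asboolP[y hy] hmax; exists r, y; split=> // y' hy'.
by have := hmax r.+1; rewrite ltnn => h; have : false by apply: h; apply/asboolP; exists y'.
Qed.

Section Expansion.
Variables (r : nat) (y : 'I_r -> C).
Hypotheses (hy : resid y) (hmax : forall y' : 'I_r.+1 -> C, ~ resid y').

Let vy j : vge v 0 (y j). Proof. by case: hy => h _; case: (h j). Qed.
Let Ly j : L (y j). Proof. by case: hy => h _; case: (h j). Qed.
Let Zv c : Defs.Zp v c -> vge v 0 c. Proof. by case. Qed.

(** By maximality, adjoining x destroys independence, and the coefficient of x in the resulting
    relation must be a unit. The value group of L being that of Q_p, an error in the maximal ideal
    is divisible by p. *)
Lemma resid_span x : L x -> vge v 0 x -> exists c : 'I_r -> C,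
  (forall j, Defs.Zp v (c j)) /\ vge v 1 (x - \sum_j c j * y j).
Proof.
move=> Lx vx; suff [c [hc h]] : exists c : 'I_r -> C, (forall j, Defs.Zp v (c j)) /\ vgt v 0 (x - \sum_j c j * y j).
  exists c; split=> //; apply: Lvgt => //; apply: (sfB Lf) => //; apply: (sf_sum Lf) => j _.
  by apply: (sfM Lf) => //; apply: QL; case: (hc j).
apply: contrapT => hno; apply: (hmax (y' := fun j => oapp y x (unlift ord0 j))); split.
  by move=> j; case: unliftP => [j' _|_] /=.
move=> c hc; rewrite big_ord_recl unlift_none /=.
under eq_bigr => j _ do rewrite liftK /=.
move=> hs.
have h0 : vgt v 0 (c ord0).
  apply/negPn/negP => hn; apply: hno.
  have c0 : c ord0 != 0 by apply: contraNneq hn => ->; apply: vgt0.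
  have nc : nu v (c ord0) = 0.
    by apply/le_anti; move: hn (Zv (hc ord0)); rewrite vgtE // vgeE // -leNgt => -> ->.
  exists (fun j => - (c (lift ord0 j) / c ord0)); split=> [j|].
    split; first by apply: (sfN Qf); apply: (Qpdiv hp hv vp); [case: (hc (lift ord0 j))|case: (hc ord0)].
    by rewrite /= -/(vge v 0 _) vgeN // vge_divl // nc add0r; apply: Zv.
  rewrite (_ : _ - _ = (c ord0 * x + \sum_j c (lift ord0 j) * y j) / c ord0).
    by rewrite vgt_divl // nc add0r.
  rewrite mulrDl [c ord0 * x]mulrC mulfK //; congr (_ + _).
  rewrite -sumrN mulr_suml; apply: eq_bigr => j _; by rewrite mulNr opprK mulrAC.
move=> j; case: (unliftP ord0 j) => [j' ->|->] //.
case: hy => _ hind; apply: (hind (fun j => c (lift ord0 j))) => [j''|]; first exact: hc.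
rewrite -(addKr (c ord0 * x) (\sum_j0 _)); apply: vgtD => //.
by rewrite vgtN // mulrC; apply: vgtMl.
Qed.

Lemma resid_digit x : good x -> exists cx : ('I_r -> C) * C,
  [/\ forall j, Defs.Zp v (cx.1 j), good cx.2 & x = \sum_j cx.1 j * y j + p%:R * cx.2].
Proof.
move=> [cx vx]; have [x0 Lx0 ex0] := cx 1.
have vx0 : vge v 0 x0.
  rewrite -(subKr x x0); apply: vgeB => //; exact: vge_le (vgtW ex0).
have [c [hc e]] := resid_span Lx0 vx0.
have p0 := p_neq0 hv vp.
have h1 : vge v 1 (x - \sum_j c j * y j) by apply: (vge_trans hv (vgtW ex0)).
exists (c, (x - \sum_j c j * y j) / p%:R); split=> //=.
  split; last by rewrite vge_divl // (nu_p vp) add0r.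
  have sub z : L z -> vclosure v L z by move=> Lz r'; exists z => //; rewrite subrr; apply: vgt0.
  apply: (sfdiv cLf); last by apply: sub; apply: QL; apply: (sf_nat Qf).
  apply: (sfB cLf) => //; apply: sub; apply: (sf_sum Lf) => j _.
  by apply: (sfM Lf) => //; apply: QL; case: (hc j).
by rewrite mulrC divfK // addrC subrK.
Qed.

(** The digits are iterated; the partial sums of the coefficients are Cauchy, and the completeness
    of C gives limits in Z_p. *)
Lemma resid_expand x : good x -> exists c : 'I_r -> C,
  (forall j, Defs.Zp v (c j)) /\ x = \sum_j c j * y j.
Proof.
move=> gx; have p0 := p_neq0 hv vp.
have [z|f hf] := @choice C (('I_r -> C) * C)%type (fun z cx => good z ->
    [/\ forall j, Defs.Zp v (cx.1 j), good cx.2 & z = \sum_j cx.1 j * y j + p%:R * cx.2]).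
  have [gz|ngz] := pselect (good z); last by exists (fun=> 0, 0) => /ngz.
  by have [cx h] := resid_digit gz; exists cx.
pose X m := iter m (fun z => (f z).2) x.
have gX m : good (X m) by elim: m => [//|m IH] /=; case: (hf _ IH).
pose c m j := \sum_(l < m) p%:R ^+ l * (f (X l)).1 j.
have Zc m j : Defs.Zp v (c m j).
  split.
    apply: (sf_sum Qf) => l _; apply: (sfM Qf); first by apply: (sfX Qf); apply: (sf_nat Qf).
    by case: (hf _ (gX l)) => /(_ j)[].
  apply: vge_sum => // l _; apply: vge0M => //; first by apply: vge0X => //; apply: vge_nat.
  by case: (hf _ (gX l)) => /(_ j)[].
have ex m : x = \sum_j c m j * y j + p%:R ^+ m * X m.
  elim: m => [|m IH].
    rewrite expr0 mul1r big1 ?add0r // => j _; by rewrite /c big_ord0 mul0r.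
  rewrite {1}IH; case: (hf _ (gX m)) => _ _ e; rewrite {1}e mulrDr addrA exprSr -mulrA; congr (_ + _).
  rewrite mulr_sumr -big_split /=; apply: eq_bigr => j _.
  by rewrite /c big_ord_recr /= mulrDl mulrA.
have vpm m : vge v m%:R (p%:R ^+ m) by have := vgeX hv m (vge_p hv vp).
have dc a m j : vge v m%:R (c (m + a)%N j - c m j).
  rewrite /c big_split_ord /= addrAC subrr add0r; apply: vge_sum => // l _.
  rewrite exprD -mulrA -[m%:R]addr0; apply: vgeM => //; apply: vge0M => //; first by apply: vge0X => //; apply: vge_nat.
  by case: (hf _ (gX (m + l)%N)) => /(_ j)[].
have [j|l hl] := @choice 'I_r C (fun j l => converges_to v (fun m => c m j) l).
  apply: hcomp => s; pose M := Num.bound `|s|.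
  have sM : s < M%:R by apply: le_lt_trans (ler_norm s) (archi_boundP (normr_ge0 s)).
  exists M => a b ha hb; apply: (vge_lt sM); rewrite -(subnKC ha) -(subnKC hb).
  by apply: (vge_trans hv (dc _ _ _)); rewrite vge_subC //; apply: dc.
have dl M j : vge v M%:R (c M j - l j).
  have [N hN] := hl j M%:R; apply: (vge_trans hv (y := c (M + N)%N j)).
    by rewrite vge_subC //; apply: dc.
  apply: vgtW; apply: hN; exact: leq_addl.
exists l; split=> [j|].
  split.
    apply: (vclosure_idem hv) => s; have [N hN] := hl j s.
    exists (c N j); first by case: (Zc N j).
    by have := hN N (leqnn _); rewrite -/(vgt v s _) vgt_subC.
  have := dl 0%N j; rewrite vge_subC // => h.
  rewrite /= -/(vge v 0 _) -(subrK (c 0%N j) (l j)); apply: vgeD => //; exact: Zv.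
apply/eqP; rewrite -subr_eq0; apply/eqP/(vge_all0 hv) => M.
rewrite {1}(ex M) addrAC -sumrB; apply: vgeD => //.
  apply: vge_sum => // j _; rewrite -mulrBl -[M%:R]addr0; apply: vgeM => //.
rewrite -[M%:R]addr0; apply: vgeM => //; by case: (gX M).
Qed.

Lemma closure_int x : good x -> L x.
Proof.
move=> /resid_expand[c [hc ->]]; apply: (sf_sum Lf) => j _; apply: (sfM Lf) => //.
by apply: QL; case: (hc j).
Qed.

(** After multiplication by a power of p the basis elements expand along the r elements y. This
    factors the identity of size n through dimension r. *)
Lemma resid_ge : (n <= r)%N.
Proof.
case: hL => _ _ [e [he hb]] _; have p0 := p_neq0 hv vp.
have [j|d hd] := @choice 'I_n ('I_r -> C) (fun j d => (forall l, Qp v (d l)) /\ e j 0 = \sum_l d l * y l).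
  pose M := Num.bound `|nu v (e j 0)|.
  have hM : - nu v (e j 0) <= M%:R.
    apply: le_trans (ler_norm _) _; rewrite normrN; exact: ltW (archi_boundP (normr_ge0 _)).
  have pM0 : p%:R ^+ M != 0 :> C by rewrite expf_neq0.
  have g : good (p%:R ^+ M * e j 0).
    split.
      move=> s; exists (p%:R ^+ M * e j 0); last by rewrite subrr; apply: vgt0.
      by apply: (sfM Lf) => //; apply: QL; apply: (sfX Qf); apply: (sf_nat Qf).
    have [->|e0] := eqVneq (e j 0) 0; first by rewrite mulr0; apply: vge0.
    rewrite vgeE ?mulf_neq0 // nuM // nuX // (nu_p vp); lra.
  have [c [hc ec]] := resid_expand g.
  exists (fun l => c l / p%:R ^+ M); split=> [l|].
    apply: (Qpdiv hp hv vp); first by case: (hc l).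
    by apply: (sfX Qf); apply: (sf_nat Qf).
  apply: (mulfI pM0); rewrite ec mulr_sumr; apply: eq_bigr => l _.
  by rewrite mulrA [_ * (c l / _)]mulrC divfK.
have [j|c hc] := @choice 'I_r 'rV[C]_n (fun j c => (forall l, Qp v (c 0 l)) /\ y j = \sum_l c 0 l * e l 0).
  by have [c [[h1 h2] _]] := hb _ (Ly j); exists c.
pose D : 'M[C]_(n, r) := \matrix_(j, l) d j l.
pose G : 'M[C]_(r, n) := \matrix_(j, l) c j 0 l.
apply: (@mulmx1_min _ _ _ D G); apply/row_matrixP => j.
have [c0 [_ uniq]] := hb _ (he j).
transitivity c0; [symmetry|]; apply: uniq; split.
- move=> l; rewrite !mxE; apply: (sf_sum Qf) => t _; rewrite !mxE; apply: (sfM Qf); first by case: (hd j) => h _; apply: h.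
  by case: (hc t) => h _; apply: h.
- rewrite {1}(proj2 (hd j)); under eq_bigr => l _ do rewrite (proj2 (hc l)) mulr_sumr.
  rewrite exchange_big /=; apply: eq_bigr => t _; rewrite !mxE mulr_suml; apply: eq_bigr => l _.
  by rewrite !mxE mulrA.
- by move=> l; rewrite !mxE; apply: (sf_nat Qf).
- rewrite (bigD1 j) //= big1 ?addr0 => [|l hl]; first by rewrite !mxE eqxx mul1r.
  by rewrite !mxE eq_sym (negbTE hl) mul0r.
Qed.

(** Digits below p parametrise the residues of the integers of L bijectively, so there are exactly
    p^r of them. *)
Let f (c : {ffun 'I_r -> 'I_p}) : k := \sum_j (c j : nat)%:R * rc (y j).

Let f_rc (c : {ffun 'I_r -> 'I_p}) : rc (\sum_j (c j : nat)%:R * y j) = f c.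
Proof.
rewrite (rc_sum hv hrc) => [|j _]; last by apply: vge0M => //; apply: vge_nat.
by apply: eq_bigr => j _; rewrite (rcM hrc) ?vge_nat // (rc_nat hv hrc).
Qed.

Let f_lift c : exists x, [/\ L x, vge v 0 x & rc x = f c].
Proof.
exists (\sum_j (c j : nat)%:R * y j); split.
- apply: (sf_sum Lf) => j _; apply: (sfM Lf) => //; exact: (sf_nat Lf).
- by apply: vge_sum => // j _; apply: vge0M => //; apply: vge_nat.
exact: f_rc.
Qed.

Let f_surj x : L x -> vge v 0 x -> exists c, rc x = f c.
Proof.
move=> Lx vx; have [c [hc e]] := resid_span Lx vx.
have [j|b hb] := @choice 'I_r 'I_p (fun j b => rc (c j) = (b : nat)%:R).
  have [b hb] := prime_field hp hv vp hrc (Zp_rc_frob hp hv vp hrc (hc j)).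
  exists (Ordinal (ltn_pmod b (prime_gt0 hp))); rewrite hb /=.
  by rewrite {1}(divn_eq b p) natrD natrM (eqP (_ : p%:R == 0 :> k)) ?(k_natr_eq0 hp hv vp hrc) ?mulr0 ?add0r.
exists [ffun j => b j]; apply/eqP.
have -> : f [ffun j => b j] = rc (\sum_j c j * y j).
  rewrite (rc_sum hv hrc) => [|j _]; last by apply: vge0M => //; apply: Zv.
  apply: eq_bigr => j _; rewrite (rcM hrc) //; last exact: Zv.
  by rewrite hb ffunE.
rewrite (rc_eq hv hrc) //; last by apply: vge_sum => // j _; apply: vge0M => //; apply: Zv.
exact: (vge_lt ltr01 e).
Qed.

Let f_inj : injective f.
Proof.
move=> c c' e; apply/ffunP => j; apply: val_inj => /=.
have Zn (a : nat) : Defs.Zp v a%:R by split; [apply: (sf_nat Qf)|apply: vge_nat].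
have ZB a b : Defs.Zp v a -> Defs.Zp v b -> Defs.Zp v (a - b).
  by move=> [? ?] [? ?]; split; [apply: (sfB Qf)|apply: vgeB].
case: hy => _ /(_ (fun j => (c j : nat)%:R - (c' j : nat)%:R)) hind.
have h : vgt v 0 ((c j : nat)%:R - (c' j : nat)%:R).
  apply: hind => [j'|]; first exact: ZB.
  under eq_bigr => j' _ do rewrite mulrBl.
  rewrite sumrB -(rc_eq hv hrc); last 2 first.
  - by apply: vge_sum => // j' _; apply: vge0M => //; apply: vge_nat.
  - by apply: vge_sum => // j' _; apply: vge0M => //; apply: vge_nat.
  by rewrite !f_rc e.
rewrite -(rc_eq hv hrc) ?vge_nat // !(rc_nat hv hrc) in h.
have aux (a b : nat) : (a < p)%N -> (b < p)%N -> (a <= b)%N -> a%:R == b%:R :> k -> a = b.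
  move=> la lb le; rewrite eq_sym -subr_eq0 -natrB // (k_natr_eq0 hp hv vp hrc) => hd.
  apply/eqP; rewrite eqn_leq le -subn_eq0 /= ; apply: contraLR hd => h0.
  by rewrite gtnNdvd ?lt0n // (leq_ltn_trans (leq_subr _ _)).
have [le|/ltnW le] := leqP (c j) (c' j); first exact: aux.
by symmetry; apply: aux => //; rewrite eq_sym.
Qed.

(** The residues of L are p^n in number and coincide with those of the solutions of z^(p^n) = z. If
    x in L has the residue of z, the iterated p^n-th powers of x converge to z, and integral
    elements of the closure belong to L. *)
Lemma teich_in_L (z : C) : z ^+ (p ^ n) = z -> L z.
Proof.
move=> ez; have rn : r = n by apply/eqP; rewrite eqn_leq (resid_le hy) resid_ge.
pose s := [seq f c | c <- enum {ffun 'I_r -> 'I_p}].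
have us : uniq s by rewrite map_inj_uniq ?enum_uniq //; apply: f_inj.
have ss : size s = (p ^ n)%N by rewrite size_map -cardE card_ffun !card_ord rn.
have memP a : reflect (exists x, [/\ L x, vge v 0 x & rc x = a]) (a \in s).
  apply: (iffP mapP) => [[c _ ->]|[x [Lx vx <-]]]; first exact: f_lift.
  by have [c ->] := f_surj Lx vx; exists c; rewrite ?mem_enum.
have sfix a : a \in s -> a ^+ (p ^ n) = a.
  move=> ha; have [->|a0] := eqVneq a 0; first by rewrite expr0n expn_eq0 eqn0Ngt prime_gt0.
  pose s' := [seq b <- s | b != 0].
  have us' : uniq s' by apply: filter_uniq.
  have zs : 0 \in s by apply/memP; exists 0; split; [exact: (sf0 Lf)|exact: vge0|exact: (rc0 hv hrc)].
  have ss' : size s' = (p ^ n).-1.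
    by rewrite size_filter; have := count_predC (pred1 0) s; rewrite count_uniq_mem // zs ss add1n => <-.
  (* Multiplication by a permutes the nonzero residues; comparing products gives a^(p^n - 1) = 1. *)
  have pe : perm_eq [seq a * b | b <- s'] s'.
    have um : uniq [seq a * b | b <- s'] by rewrite map_inj_uniq //; apply: mulfI.
    have sub : {subset [seq a * b | b <- s'] <= s'}.
      move=> _ /mapP[b hb ->]; move: hb; rewrite !mem_filter => /andP[b0 hb].
      rewrite mulf_neq0 //=; have [x [Lx vx <-]] := memP _ ha; have [x' [Lx' vx' <-]] := memP _ hb.
      by apply/memP; exists (x * x'); split; [exact: (sfM Lf)|exact: vge0M|exact: (rcM hrc)].
    apply: uniq_perm => //; case: (uniq_min_size um sub); by rewrite ?size_map.
  have P0 : \prod_(b <- s') b != 0.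
    by rewrite prodf_seq_neq0; apply/allP => b; rewrite mem_filter => /andP[].
  have : \prod_(b <- [seq a * b | b <- s']) b = \prod_(b <- s') b := perm_big _ pe.
  rewrite big_map big_split /= big_const_seq count_predT ss' iter_mulr_1 => e.
  have e1 : a ^+ (p ^ n).-1 = 1 by apply: (mulIf P0); rewrite e mul1r.
  by rewrite -{1}(prednK (_ : 0 < p ^ n)%N) ?expn_gt0 ?prime_gt0 // exprS e1 mulr1.
have [rt [srt urt memrt _]] := teich_roots hp hv vp hrc n0.
have hs : {subset s <= [seq rc x | x <- rt]}.
  move=> a /sfix/(teich_surj hp hv vp hrc n0)[x hx <-]; apply: map_f.
  by rewrite memrt hx.
have [|_ es] := uniq_min_size us hs; first by rewrite size_map srt ss.
have : rc z \in s by rewrite es map_f // memrt ez.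
move=> /memP[x [Lx vx exz]].
have [vz _] := teich_vge hp hv n0 ez.
apply: closure_int; split=> // t.
have [xz|xz] := eqVneq x z; first by exists x => //; rewrite xz subrr; apply: vgt0.
have hgt : vgt v 0 (x - z) by rewrite -(rc_eq hv hrc) ?exz.
have d0 : x - z != 0 by rewrite subr_eq0.
pose d := Num.min 1 (nu v (x - z)).
have dpos : 0 < d by rewrite lt_min ltr01; rewrite vgtE // in hgt.
have vX m : vge v 0 (x ^+ ((p ^ n) ^ m)) by apply: vge0X.
have sub e a : vge v 0 a -> vge v d (a - z) -> vge v d (a ^+ e - z ^+ e).
  move=> va h; rewrite subrXX mulrC; apply: (vgeMl hv) => //; apply: vge_sum => // l _.
  by apply: vge0M => //; apply: vge0X.
(* Each p^n-th power gains at least d: the cofactor of X - z in X^q - z^q is q z^(q-1) up to terms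
   of valuation d, and q is divisible by p. *)
have key m : vge v (d *+ m.+1) (x ^+ ((p ^ n) ^ m) - z).
  elim: m => [|m IH]; first by rewrite expn0 expr1 mulr1n vgeE // ge_min lexx orbT.
  have hd : vge v d (x ^+ ((p ^ n) ^ m) - z).
    by apply: vge_le IH; rewrite mulrS lerDl mulrn_wge0 // ltW.
  rewrite expnSr exprM -{1}ez subrXX [d *+ _]mulrSr; apply: vgeM => //.
  set q := (p ^ n)%N; set X := x ^+ (q ^ m).
  have -> : \sum_(l < q) X ^+ (q.-1 - l) * z ^+ l =
      \sum_(l < q) (X ^+ (q.-1 - l) - z ^+ (q.-1 - l)) * z ^+ l + z ^+ q.-1 *+ q.
    have -> : z ^+ q.-1 *+ q = \sum_(l < q) z ^+ (q.-1 - l) * z ^+ l.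
      rewrite (eq_bigr (fun=> z ^+ q.-1)) ?sumr_const ?card_ord // => l _.
      by rewrite -exprD subnK // -ltnS prednK // expn_gt0 prime_gt0.
    by rewrite -big_split /=; apply: eq_bigr => l _; rewrite -mulrDl subrK.
  apply: vgeD => //.
    apply: vge_sum => // l _; rewrite mulrC; apply: (vgeMl hv); first exact: vge0X.
    by apply: sub => //; apply: vX.
  rewrite -mulr_natr; apply: (vgeMl hv); first exact: vge0X.
  apply: (@vge_le _ _ 1); first by rewrite ge_min lexx.
  rewrite /q -(prednK n0) expnS natrM mulrC; apply: (vgeMl hv); [exact: vge_nat|exact: (vge_p hv vp)].
pose M := Num.bound `|t / d|.
have hM : t < d *+ M.+1.
  have : t / d < M%:R by apply: le_lt_trans (ler_norm _) (archi_boundP (normr_ge0 _)).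
  rewrite ltr_pdivrMr // mulr_natl => h; apply: lt_trans h _.
  by rewrite [ltRHS]mulrS ltrDr.
exists (x ^+ ((p ^ n) ^ M)); first exact: (sfX Lf).
rewrite -/(vgt v t _) vgt_subC //; exact: vge_lt hM (key M).
Qed.

End Expansion.

Lemma teich_mem (z : C) : z ^+ (p ^ n) = z -> L z.
Proof. have [r [y [hy hmax]]] := resid_max; exact: teich_in_L hy hmax _. Qed.

Definition powcol (x : C) : 'cV[C]_n := \col_j x ^+ j.

Lemma powcol_basis : is_basis (Qp v) L (powcol w).
Proof.
have Lw : L w by apply: teich_mem; apply: unity_teich (prim_expr_order hw).
split=> [j|x Lx]; first by rewrite mxE; apply: (sfX Lf).
case: hL => _ _ [e [he hb]] _.
have [j|P hP] := @choice 'I_n 'rV[C]_n (fun j c => (forall l, Qp v (c 0 l)) /\ w ^+ j = \sum_l c 0 l * e l 0).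
  by have [c [[h1 h2] _]] := hb _ (sfX Lf j Lw); exists c.
have [|G hG] := @lift_mx _ _ (\matrix_(j, l) P j 0 l); first by move=> s t; rewrite mxE; case: (hP s).
have ew : powcol w = map_mx i G *m e.
  by apply/colP => j; rewrite hG !mxE (proj2 (hP j)); apply: eq_bigr => l _; rewrite mxE.
have uG : G \in unitmx.
  rewrite -row_free_unit -kermx_eq0; apply/rowV0P => u /sub_kermxP uG.
  have : map_mx i u = 0.
    apply: power_coord => [j|j|]; rewrite ?mxE //; first exact: (sf0 Qf).
    transitivity ((map_mx i u *m powcol w) 0 0).
      by rewrite mxE; apply: eq_bigr => j _; rewrite !mxE.
    by rewrite ew mulmxA -map_mxM uG map_mx0 mul0mx big1 ?mxE // => j _; rewrite mxE mul0r.
  by move/eqP; rewrite map_mx_eq0 => /eqP.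
have [c [[hc ex] _]] := hb x Lx; have [|c' hc'] := @lift_mx _ _ c; first by move=> s t; rewrite (ord1 s).
have eE : e = map_mx i (invmx G) *m powcol w by rewrite ew mulmxA -map_mxM mulVmx // map_mx1 mul1mx.
exists (map_mx i (c' *m invmx G)); split.
  split=> [j|]; first by rewrite mxE.
  transitivity ((c *m e) 0 0); first by rewrite ex mxE.
  by rewrite eE mulmxA -hc' -map_mxM mxE.
move=> c1 [hc1 ex1]; apply: power_coord => // [j|]; first by rewrite mxE.
transitivity x; last by rewrite ex1; apply: eq_bigr => j _; rewrite !mxE.
transitivity ((c *m e) 0 0); last by rewrite ex mxE.
by rewrite eE mulmxA -hc' -map_mxM mxE; apply: eq_bigr => j _; rewrite [powcol _ _ _]mxE.
Qed.

Lemma basis_coord a (e : 'cV[C]_a) b (f : 'cV[C]_b) : is_basis (Qp v) L e -> (forall j, L (f j 0)) ->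
  exists2 P : 'M[C]_(b, a), forall s t, Qp v (P s t) & f = P *m e.
Proof.
move=> [_ hb] hf.
have [j|P hP] := @choice 'I_b 'rV[C]_a (fun j c => (forall l, Qp v (c 0 l)) /\ f j 0 = \sum_l c 0 l * e l 0).
  by have [c [[h1 h2] _]] := hb _ (hf j); exists c.
exists (\matrix_(j, l) P j 0 l); first by move=> s t; rewrite mxE; case: (hP s).
by apply/colP => j; rewrite mxE (proj2 (hP j)); apply: eq_bigr => l _; rewrite mxE.
Qed.

Lemma basis_unique a (e : 'cV[C]_a) b (P Q : 'M[C]_(b, a)) : is_basis (Qp v) L e ->
  (forall s t, Qp v (P s t)) -> (forall s t, Qp v (Q s t)) -> P *m e = Q *m e -> P = Q.
Proof.
move=> [he hb] hP hQ ePQ; apply/row_matrixP => j.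
have Lx : L ((P *m e) j 0).
  by rewrite mxE; apply: (sf_sum Lf) => l _; apply: (sfM Lf) => //; apply: QL.
have [c [_ uniq]] := hb _ Lx.
transitivity c; [symmetry|]; apply: uniq; split=> [l|].
- by rewrite mxE.
- by rewrite mxE; apply: eq_bigr => l _; rewrite mxE.
- by rewrite mxE.
- by rewrite ePQ mxE; apply: eq_bigr => l _; rewrite mxE.
Qed.

Lemma QpmulM a b c (P : 'M[C]_(a, b)) (Q : 'M[C]_(b, c)) : (forall s t, Qp v (P s t)) ->
  (forall s t, Qp v (Q s t)) -> forall s t, Qp v ((P *m Q) s t).
Proof. by move=> hP hQ s t; rewrite mxE; apply: (sf_sum Qf) => l _; apply: (sfM Qf). Qed.
Lemma Qpmul1 a : forall s t, Qp v ((1%:M : 'M[C]_a) s t).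
Proof. by move=> s t; rewrite mxE; apply: (sf_nat Qf). Qed.

(** In the basis of powers of w, multiplication by x has the vectors of powers of the conjugates of
    w as eigenvectors, so a Vandermonde matrix diagonalises it. *)
Lemma teich_trace (s : seq C) : (forall z, z \in s -> z ^+ (p ^ n) = z) ->
  ext_trace (Qp v) L (\sum_(z <- s) z) = \sum_(l < n) \sum_(z <- s) z ^+ (p ^ l).
Proof.
move=> hs; set x := \sum_(z <- s) z.
have Lx : L x by rewrite /x big_seq; apply: (sf_sum Lf) => z /hs; apply: teich_mem.
have hW := powcol_basis.
have m0 := prim_order_gt0 hw.
have [g [gx gxl]] : exists g : {poly F}, (map_poly i g).[w] = x /\
    forall l, (l < n)%N -> (map_poly i g).[w ^+ (p ^ l)] = \sum_(z <- s) z ^+ (p ^ l).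
  suff [g hg] : exists g : {poly F}, forall l, (map_poly i g).[w ^+ (p ^ l)] = \sum_(z <- s) z ^+ (p ^ l).
    exists g; split=> [|l _]; last exact: hg.
    by have := hg 0%N; rewrite expn0 expr1 => ->; apply: eq_bigr => z _; rewrite expr1.
  rewrite {x Lx}; elim: s hs => [|z s IH] hs.
    by exists 0 => l; rewrite rmorph0 horner0 big_nil.
  have [|g hg] := IH; first by move=> z' hz'; apply: hs; rewrite inE hz' orbT.
  have ez : z ^+ (p ^ n) = z by apply: hs; rewrite mem_head.
  have [z0|z0] := eqVneq z 0.
    exists g => l; rewrite big_cons hg z0 expr0n expn_eq0 eqn0Ngt prime_gt0 //= add0r //.
  have [_ zm] := teich_unity hp n0 ez z0.
  have [a ea] := prim_rootP hw zm.
  exists ('X^a + g) => l; rewrite big_cons rmorphD /= map_polyXn !hornerE hg; congr (_ + _).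
  by rewrite ea -!exprM mulnC.
(* Every value that [ext_trace] may select equals the sum, whatever the basis; that one exists is
   checked at the end. *)
have key t : [set t | exists n' (e : 'cV[C]_n') (M : 'M[C]_n'),
    [/\ is_basis (Qp v) L e, forall a b, Qp v (M a b), x *: e = M *m e & t = \tr M]]%classic t ->
    t = \sum_(l < n) \sum_(z <- s) z ^+ (p ^ l).
  move=> [n' [e [M [he hM exM ->]]]].
  have [A QA eA] := basis_coord hW (proj1 he).
  have [B QB eB] := basis_coord he (proj1 hW).
  have AB : A *m B = 1%:M.
    apply: (basis_unique he); [exact: QpmulM|exact: Qpmul1|].
    by rewrite -mulmxA -eB -eA mul1mx.
  pose N := B *m M *m A.
  have QN : forall a b, Qp v (N a b) by apply: QpmulM => //; apply: QpmulM.
  have eN : N *m powcol w = x *: powcol w.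
    by rewrite /N -mulmxA -eA -mulmxA -exM -scalemxAr -eB.
  have -> : \tr M = \tr N by rewrite /N -mulmxA mxtrace_mulC -mulmxA AB mulmx1.
  clearbody N; have [G hG] := lift_mx QN.
  (* The eigenvector equation at w says that a polynomial over Q_p vanishes at w, so it passes to
     all conjugates. *)
  have eNl l : (l < n)%N -> N *m powcol (w ^+ (p ^ l)) = (\sum_(z <- s) z ^+ (p ^ l)) *: powcol (w ^+ (p ^ l)).
    move=> hl; apply/colP => j; rewrite !mxE.
    pose H := \sum_(b < n) G j b *: 'X^b - g * 'X^j.
    have HE y : (map_poly i H).[y] = \sum_(b < n) N j b * y ^+ b - (map_poly i g).[y] * y ^+ j.
      rewrite rmorphB rmorphM /= map_polyXn !hornerE rmorph_sum horner_sum; congr (_ - _).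
      by apply: eq_bigr => b _; rewrite /= map_polyZ map_polyXn !hornerE -hG mxE.
    have H0 : (map_poly i H).[w ^+ (p ^ 0)] = 0.
      rewrite expn0 expr1 HE gx; have := congr1 (fun M : 'cV[C]_n => M j 0) eN; rewrite !mxE => <-.
      by apply/eqP; rewrite subr_eq0; apply/eqP; apply: eq_bigr => b _; rewrite mxE.
    have := root_conj n0 hl H0; rewrite HE gxl // => /eqP; rewrite subr_eq0 => /eqP <-.
    by apply: eq_bigr => b _; rewrite mxE.
  pose V : 'M[C]_n := Vandermonde n (\row_l w ^+ (p ^ l)).
  pose D : 'rV[C]_n := \row_l \sum_(z <- s) z ^+ (p ^ l).
  have NV : N *m V = V *m diag_mx D.
    apply/matrixP => a b; have := congr1 (fun M : 'cV[C]_n => M a 0) (eNl b (ltn_ord b)).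
    rewrite mul_mx_diag !mxE [RHS]mulrC => <-; apply: eq_bigr => c _; by rewrite !mxE.
  have uV : V \in unitmx.
    rewrite unitmxE unitfE det_Vandermonde; apply/prodf_neq0 => a _; apply/prodf_neq0 => b lt.
    rewrite !mxE subr_eq0; apply: contraTneq lt => e1.
    have := w_conj_uniq hp n0 hw; move/uniqP => /(_ 0) inj.
    have hab : b = a :> nat.
      apply: inj; rewrite ?inE ?size_map ?size_iota //.
      by rewrite !(nth_map 0%N) ?size_iota // !nth_iota // !add0n.
    by rewrite hab ltnn.
  have -> : N = V *m diag_mx D *m invmx V by rewrite -NV mulmxK.
  rewrite mxtrace_mulC mulmxA mulVmx // mul1mx mxtrace_diag.
  by apply: eq_bigr => l _; rewrite mxE.
rewrite /ext_trace; apply: key; apply: xgetPex.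
have [|M QM eM] := @basis_coord _ _ _ (x *: powcol w) hW.
  by move=> j; rewrite mxE; apply: (sfM Lf) => //; case: hW.
by exists (\tr M), n, (powcol w), M.
Qed.

End Uniqueness.
End Powers.
End Unramified.

Section UnramifiedTheory.
Variables (p : nat) (C : closedFieldType) (v : C -> \bar rat).
Hypotheses (hp : prime p) (hC : is_Cp v p).

Let hv : is_valuation v. Proof. by case: hC. Qed.
Let vp : v p%:R = 1%E. Proof. by case: hC. Qed.

Lemma prim_root_exists n : (0 < n)%N -> exists w : C, (p ^ n - 1).-primitive_root w.
Proof.
move=> n0; have [k [rc hrc]] := residue_map_exists hv.
have [r [sr ur memr _]] := teich_roots hp hv vp hrc n0.
have q1 : (1 < p ^ n)%N by rewrite -[1%N](exp1n n) ltn_exp2r // prime_gt1.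
pose s := [seq b <- r | b != 0].
have r0 : 0 \in r by rewrite memr expr0n expn_eq0 eqn0Ngt prime_gt0.
have ss : size s = (p ^ n - 1)%N.
  by rewrite size_filter subn1 -sr; have := count_predC (pred1 0) r; rewrite count_uniq_mem // r0 add1n => <-.
have : has (p ^ n - 1).-primitive_root s.
  apply: has_prim_root; rewrite ?subn_gt0 ?ss ?filter_uniq //.
  apply/allP => z; rewrite mem_filter memr => /andP[z0 /eqP ez]; apply/unity_rootP.
  by case: (teich_unity hp n0 ez z0).
by move/hasP => [w _ hw]; exists w.
Qed.

Lemma Qunr_unramified n : (0 < n)%N -> is_unramified_ext v n (Qunr v n).
Proof.
move=> n0; have [k [rc hrc]] := residue_map_exists hv.
have [F [i hF]] := subfield_type (Qp_subfield hp hv vp).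
have [w hw] := prim_root_exists n0.
rewrite /Qunr; apply: (@xgetPex _ set0 [set L | is_unramified_ext v n L]%classic).
by exists (Lpow i w); apply: (Lpow_unramified hp hC hrc hF n0 hw).
Qed.

Lemma Qunr_teich n (z : C) : (0 < n)%N -> z ^+ (p ^ n) = z -> Qunr v n z.
Proof.
move=> n0; have [k [rc hrc]] := residue_map_exists hv.
have [F [i hF]] := subfield_type (Qp_subfield hp hv vp).
move=> hz; apply: (@teich_mem p C v hp hC k rc hrc F i hF n n0 (Qunr v n)) => //.
exact: Qunr_unramified.
Qed.

Lemma Qunr_trace n (s : seq C) : (0 < n)%N -> (forall z, z \in s -> z ^+ (p ^ n) = z) ->
  ext_trace (Qp v) (Qunr v n) (\sum_(z <- s) z) = \sum_(l < n) \sum_(z <- s) z ^+ (p ^ l).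
Proof.
move=> n0; have [k [rc hrc]] := residue_map_exists hv.
have [F [i hF]] := subfield_type (Qp_subfield hp hv vp).
have [w hw] := prim_root_exists n0.
exact: (teich_trace hp hC hrc hF n0 hw (Qunr_unramified n0)).
Qed.

End UnramifiedTheory.

(** * The Artin-Hasse exponential *)

(** Legendre's formula gives the valuation of m! as m / p plus that of (m / p)!, and twice m / p is
    at most m. It makes p^n / n! divisible by p for n > 0. *)
Lemma logn_fact_lt p m : prime p -> (0 < m)%N -> (logn p m`! < m)%N.
Proof.
move=> hp; have p1 := prime_gt1 hp; have p0 := prime_gt0 hp.
elim/ltn_ind: m => m IH m0.
have dm : (m %/ p < m)%N by apply: ltn_Pdiv.
have -> : logn p m`! = (m %/ p + logn p (m %/ p)`!)%N.
  rewrite !logn_fact // big_ltn // expn1; congr (_ + _)%N.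
  have -> : (\sum_(2 <= k < m.+1) m %/ p ^ k = \sum_(1 <= k < m) (m %/ p) %/ p ^ k)%N.
    by rewrite big_add1 /=; apply: eq_bigr => k _; rewrite expnS divnMA.
  rewrite (big_cat_nat (n := (m %/ p).+1)) //= [X in (_ + X)%N]big_nat_cond [X in (_ + X)%N]big1 ?addn0 //.
  move=> k /andP[/andP[h _] _]; rewrite divn_small //; apply: leq_trans h _.
  exact: ltnW (ltn_expl _ _).
have [->|d0] := posnP (m %/ p); first by rewrite fact0 logn1.
apply: (@leq_trans (m %/ p + m %/ p)); first by rewrite ltn_add2l IH.
by rewrite addnn -muln2 (leq_trans _ (leq_trunc_div m p)) // leq_mul2l p1 orbT.
Qed.

Section ArtinHasse.
Variables (p : nat) (C : closedFieldType) (v : C -> \bar rat).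
Hypotheses (hp : prime p) (hv : is_valuation v) (vp : v p%:R = 1%E).
Let Qf := Qp_subfield hp hv vp.
Let ch0 := nat_neq0 hp hv vp.

Lemma Zp_vge x : Defs.Zp v x -> vge v 0 x. Proof. by case. Qed.

Lemma poly_pchar (k : fieldType) (G : {poly k}) : p \in [pchar k] ->
  G ^+ p = map_poly (fun x => x ^+ p) G \Po 'X^p.
Proof.
move=> hk; have hK : p \in [pchar {poly k}].
  by rewrite inE hp /= -polyC_natr polyC_eq0; case/andP: hk.
have z0 : 0 ^+ p = 0 :> k by rewrite expr0n; case: (p) (prime_gt0 hp).
elim/poly_ind: G => [|G c IH].
  by rewrite map_polyE polyseq0 /= comp_poly0 expr0n; case: (p) (prime_gt0 hp).
rewrite -[LHS](pFrobenius_autE hK) rmorphD /= rmorphM /= !pFrobenius_autE IH.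
have -> : map_poly (fun x => x ^+ p) (G * 'X + c%:P) = map_poly (fun x => x ^+ p) G * 'X + (c ^+ p)%:P.
  apply/polyP => i; rewrite coef_map_id0 // !coefD !coefMX !coefC coef_map_id0 //.
  by case: i => [|i] /=; rewrite ?add0r ?addr0.
by rewrite comp_poly_MXaddC polyC_exp.
Qed.

Section WithResidue.
Variables (k : fieldType) (rc : C -> k).
Hypothesis hrc : residue_map v rc.

Lemma int_polyM (P Q : {poly C}) : (forall i, vge v 0 P`_i) -> (forall i, vge v 0 Q`_i) ->
  (forall i, vge v 0 (P * Q)`_i) /\ map_poly rc (P * Q) = map_poly rc P * map_poly rc Q.
Proof.
move=> hP hQ; have r0 := rc0 hv hrc; split=> [i|].
  by rewrite coefM; apply: vge_sum => // j _; apply: vge0M.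
apply/polyP => i; rewrite coef_map_id0 // !coefM (rc_sum hv hrc) => [|j _]; last exact: vge0M.
by apply: eq_bigr => j _; rewrite (rcM hrc) // !coef_map_id0.
Qed.

Lemma int_polyX (P : {poly C}) n : (forall i, vge v 0 P`_i) ->
  (forall i, vge v 0 (P ^+ n)`_i) /\ map_poly rc (P ^+ n) = map_poly rc P ^+ n.
Proof.
move=> hP; elim: n => [|n [h1 h2]].
  split=> [i|]; first by rewrite coef1; apply: vge_nat.
  by apply/polyP => i; rewrite coef_map_id0 ?(rc0 hv hrc) // !coef1 (rc_nat hv hrc).
by rewrite !exprS -h2; apply: int_polyM.
Qed.

(** In the residue field this is Frobenius on polynomials over the prime field; the coefficients
    being in Q_p, the gap in valuations gives divisibility by p. *)
Lemma Zp_poly_frob (A : {poly C}) : (forall i, Defs.Zp v A`_i) ->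
  forall i, vge v 1 ((A ^+ p)`_i - (A \Po 'X^p)`_i).
Proof.
move=> hA i; have p0 := prime_gt0 hp; have r0 := rc0 hv hrc.
have vA j : vge v 0 A`_j by apply: Zp_vge.
have vAc : vge v 0 (A \Po 'X^p)`_i by rewrite coef_comp_poly_Xn //; case: ifP => _; rewrite ?vge0.
have QX n j : Qp v (A ^+ n)`_j.
  elim: n j => [|n IH] j; first by rewrite coef1; apply: (sf_nat Qf).
  by rewrite exprS coefM; apply: (sf_sum Qf) => l _; apply: (sfM Qf) => //; case: (hA l).
apply: (Qp_vgt hp hv vp).
  apply: (sfB Qf) => //; rewrite coef_comp_poly_Xn //; case: ifP => _; last exact: (sf0 Qf).
  by case: (hA (i %/ p)%N).
have [h1 h2] := int_polyX p vA.
rewrite -(rc_eq hv hrc) //.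
have -> : rc (A ^+ p)`_i = (map_poly rc A ^+ p)`_i by rewrite -h2 coef_map_id0.
rewrite (poly_pchar _ (k_pchar hp hv vp hrc)).
rewrite !coef_comp_poly_Xn //; case: ifP => _; last by rewrite r0.
rewrite coef_map_id0; last by rewrite expr0n; case: (p) p0.
by rewrite coef_map_id0 // (Zp_rc_frob hp hv vp hrc).
Qed.
End WithResidue.

Variable N : nat.

Definition ah_log : {poly C} := \sum_(j < N.+1 | (p ^ j <= N)%N) (p ^ j)%:R^-1 *: 'X^(p ^ j).
Definition ah_dlog : {poly C} := \sum_(j < N.+1 | (p ^ j <= N)%N) 'X^(p ^ j).
(* Truncation of exp(X + X^p / p + X^(p^2) / p^2 + ...). *)
Definition artin_hasse : {poly C} := \poly_(n < N.+1) (expN N ah_log)`_n.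

Lemma ah_log0 : ah_log`_0 = 0.
Proof.
rewrite coef_sum big1 // => j _; rewrite coefZ coefXn (_ : (0 == p ^ j)%N = false) ?mulr0 //.
by apply/negbTE; rewrite eq_sym -lt0n expn_gt0 prime_gt0.
Qed.
Lemma ah_dlog0 : ah_dlog`_0 = 0.
Proof.
rewrite coef_sum big1 // => j _; rewrite coefXn (_ : (0 == p ^ j)%N = false) //.
by apply/negbTE; rewrite eq_sym -lt0n expn_gt0 prime_gt0.
Qed.
Lemma ah_dlogE : eulerD ah_log = ah_dlog.
Proof.
apply/polyP => n; rewrite coef_eulerD !coef_sum -sumrMnl; apply: eq_bigr => j _.
rewrite coefZ coefXn; case: eqP => [->|_]; last by rewrite mulr0 mul0rn.
by rewrite mulr1 -(mulr_natr _^-1) mulVf // ch0 // expn_gt0 prime_gt0.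
Qed.

Lemma ah_eqN : eqN N (expN N ah_log) artin_hasse.
Proof. by move=> n hn; rewrite coef_poly ltnS hn. Qed.

Lemma ah_ode : ode N ah_dlog artin_hasse.
Proof. by apply: (ode_eqP ah_eqN); rewrite -ah_dlogE; apply: expN_ode ch0 ah_log0. Qed.

Lemma coef_expN_X M (c : C) i : (i <= M)%N -> (expN M (c *: 'X))`_i = c ^+ i / i`!%:R.
Proof.
move=> hi; rewrite /expN coef_sum (bigD1 (Ordinal (hi : (i < M.+1)%N))) //= big1 => [|j hj].
  by rewrite addr0 coefZ exprZn coefZ coefXn eqxx mulr1 mulrC.
rewrite coefZ exprZn coefZ coefXn eq_sym.
by move: hj; rewrite -(inj_eq val_inj) /= => /negbTE ->; rewrite !mulr0.
Qed.

Lemma ah_lt n : (n < p)%N -> (n <= N)%N -> artin_hasse`_n = (n`!%:R)^-1.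
Proof.
move=> np nN; rewrite coef_poly ltnS nN.
have e : eqN n ah_log 'X.
  move=> i hi; rewrite coef_sum coefX big_mkcond big_ord_recl expn0 big1 => [|j _]; last first.
    case: ifP => // _; rewrite coefZ coefXn (_ : (i == _) = false) ?mulr0 //.
    apply/negbTE; rewrite neq_ltn (leq_ltn_trans hi) // (leq_trans np) //.
    by rewrite lift0 expnS leq_pmulr // expn_gt0 prime_gt0.
  rewrite /= addr0; have [N0|N0] := posnP N; last by rewrite coefZ coefXn invr1 mul1r.
  by move: (leq_trans hi nN); rewrite N0 leqn0 => /eqP ->.
rewrite -(expN_widen nN ah_log0) // (expN_eqN e) //.
by rewrite -['X]scale1r coef_expN_X // expr1n div1r.
Qed.

Lemma ah_dlog_coef i : (i <= N)%N -> ah_dlog`_i = \sum_(j < N.+1) (i == p ^ j)%N%:R.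
Proof.
move=> hi; rewrite coef_sum big_mkcond; apply: eq_bigr => j _; rewrite coefXn.
by case: ifP => // /negbT; rewrite -ltnNge => h; rewrite ltn_eqF // (leq_ltn_trans hi).
Qed.

(** The logarithmic form of AH(X)^p = AH(X^p) exp(p X): the exponents p^j other than 1 are those of
    the series in X^p. *)
Lemma ah_dlog_comp : eqN N ((ah_dlog \Po 'X^p) *+ p + p%:R *: 'X) (ah_dlog *+ p).
Proof.
have p0 := prime_gt0 hp; have p1 := prime_gt1 hp.
have -> : ah_dlog *+ p = p%:R *: ah_dlog by rewrite scaler_nat.
rewrite -scaler_nat -scalerDr => i hi; rewrite !coefZ; congr (_ * _).
rewrite coefD coefX ah_dlog_coef // big_ord_recl expn0 addrC; congr (_ + _).
have -> : (ah_dlog \Po 'X^p)`_i = \sum_(j < N.+1) (i == p ^ j.+1)%N%:R.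
  rewrite coef_comp_poly_Xn //; case: ifP => [/dvdnP[m em]|nd].
    rewrite em mulnK // ah_dlog_coef; last by apply: leq_trans hi; rewrite em leq_pmulr.
    by apply: eq_bigr => j _; rewrite expnSr eqn_pmul2r.
  rewrite big1 // => j _; case: eqP => // e; move: nd; rewrite e dvdn_exp //.
rewrite big_ord_recr /= (_ : (i == _) = false) ?addr0.
  by apply: eq_bigr => j _; rewrite /bump leq0n add1n.
apply/negbTE; rewrite neq_ltn (leq_ltn_trans hi) //.
by apply: (ltn_trans (ltnSn N)); apply: ltn_expl.
Qed.

Lemma ah0 : artin_hasse`_0 = 1.
Proof. by rewrite ah_lt ?prime_gt0 // fact0 invr1. Qed.

Lemma dlog_coef_Qp i : Qp v ah_dlog`_i /\ vge v 0 ah_dlog`_i.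
Proof.
rewrite coef_sum; split.
  by apply: (sf_sum Qf) => j _; rewrite coefXn; apply: (sf_nat Qf).
by apply: vge_sum => // j _; rewrite coefXn; apply: vge_nat.
Qed.

Lemma ah_Qp n : Qp v artin_hasse`_n.
Proof.
elim/ltn_ind: n => -[|n] IH; first by rewrite ah0; apply: (sf1 Qf).
have [hn|hn] := leqP n.+1 N; last by rewrite coef_poly ltnS leqNgt hn; apply: (sf0 Qf).
have := ode_rec ah_ode hn; rewrite big_ord_recl ah_dlog0 mul0r add0r => e.
have -> : artin_hasse`_n.+1 = (artin_hasse`_n.+1 *+ n.+1) / n.+1%:R by rewrite -(mulr_natr artin_hasse`_n.+1) mulfK // ch0.
rewrite e; apply: (sfdiv Qf); last exact: (sf_nat Qf).
apply: (sf_sum Qf) => i _; apply: (sfM Qf); first by case: (dlog_coef_Qp (lift ord0 i)).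
by apply: IH; rewrite lift0 subSS ltnS leq_subr.
Qed.

Lemma vge_exp_p n : (0 < n)%N -> vge v 1 ((p%:R ^+ n / n`!%:R) : C).
Proof.
move=> n0; have f0 : (n`!)%:R != 0 :> C by rewrite ch0 // fact_gt0.
have pn0 : p%:R ^+ n != 0 :> C by rewrite expf_neq0 // (p_neq0 hv vp).
rewrite vge_divl // vgeE // nuX // (nu_p vp) (nu_natr hp hv vp) ?fact_gt0 //.
by rewrite -[1 *+ n]/(n%:R) addrC natr1 ler_nat; apply: logn_fact_lt hp n0.
Qed.

(** Dwork's integrality argument. In AH(X)^p = AH(X^p) exp(p X), compared in degree n + 1, the
    unknown coefficient e enters only as p e; the rest is divisible by p because A^p and A(X^p) are
    congruent and exp(p X) is 1 modulo p. *)
Lemma ah_Zp n : Defs.Zp v artin_hasse`_n.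
Proof.
have [k [rc hrc]] := residue_map_exists hv.
elim/ltn_ind: n => -[|n] IH; first by rewrite ah0; split; [apply: (sf1 Qf)|apply: vge01].
split; first exact: ah_Qp.
rewrite /= -/(vge v 0 _); have [hn|hn] := leqP n.+1 N; last by rewrite coef_poly ltnS leqNgt hn; apply: vge0.
have p0 := prime_gt0 hp.
pose A := \poly_(i < n.+1) artin_hasse`_i.
have ZA i : Defs.Zp v A`_i.
  rewrite coef_poly; case: ifP => hi; first exact: IH.
  by split; [apply: (sf0 Qf)|apply: vge0].
pose e := artin_hasse`_n.+1.
have eB : eqN n.+1 artin_hasse (A + e *: 'X^(n.+1)).
  move=> i hi; rewrite coefD coefZ coefXn [(\poly_(_ < n.+1) _)`_i]coef_poly.
  have [lt|] := ltnP i n.+1; first by rewrite (ltn_eqF lt) mulr0 addr0.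
  move=> ge; have -> : i = n.+1 by apply/eqP; rewrite eqn_leq hi.
  by rewrite eqxx mulr1 add0r.
pose X2 : {poly C} := expN N (p%:R *: 'X).
have X2E i : (i <= N)%N -> X2`_i = p%:R ^+ i / i`!%:R by apply: coef_expN_X.
have hU : eqN N (artin_hasse ^+ p) ((artin_hasse \Po 'X^p) * X2).
  apply: (@ode_unique _ N (ah_dlog *+ p)) => //.
  - by rewrite coefMn ah_dlog0 mul0rn.
  - have -> : (artin_hasse ^+ p)`_0 = 1 by rewrite -horner_coef0 horner_exp horner_coef0 ah0 expr1n.
    by rewrite coefM big_ord1 subnn X2E // fact0 expr0 divr1 mulr1 coef_comp_poly_Xn // dvdn0 div0n ah0.
  - exact: odeX ah_ode.
  apply: (ode_eqH ah_dlog_comp).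
  apply: odeM; first exact: ode_compXn ah_ode.
  have := @expN_ode _ N (p%:R *: 'X) ch0; rewrite /eulerD derivZ derivX coefZ coefX mulr0 => /(_ erefl).
  by rewrite -scalerAr mulr1.
have := hU n.+1 hn.
have -> : (artin_hasse ^+ p)`_n.+1 = (A ^+ p)`_n.+1 + p%:R * e.
  have -> : (artin_hasse ^+ p)`_n.+1 = ((A + e *: 'X^(n.+1)) ^+ p)`_n.+1.
    have eBk m : eqN n.+1 (artin_hasse ^+ m) ((A + e *: 'X^(n.+1)) ^+ m).
      elim: m => [|m IHm]; first by move=> i hi; rewrite !expr0.
      by rewrite (exprS artin_hasse) (exprS (A + _)); apply: eqNM.
    exact: eBk.
  rewrite -[(A + _) ^+ p](subrK (A ^+ p)) subrXX [_ + _ - A]addrAC subrr add0r coefD addrC; congr (_ + _).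
  rewrite -scalerAl coefZ coefXnM ltnn subnn mulrC; congr (_ * _).
  rewrite -horner_coef0 horner_sum (eq_bigr (fun=> 1)) ?sumr_const ?card_ord // => i _.
  rewrite hornerM !horner_exp !horner_coef0 coefD coefZ coefXn mulr0 addr0 coef_poly /= ah0.
  by rewrite !expr1n mulr1.
have -> : ((artin_hasse \Po 'X^p) * X2)`_n.+1 = (A \Po 'X^p)`_n.+1 +
    \sum_(i < n.+1) (A \Po 'X^p)`_i * X2`_(n.+1 - i).
  rewrite coefM big_ord_recr /= subnn X2E // fact0 expr0 divr1 mulr1 addrC.
  have hc i : (i <= n.+1)%N -> (artin_hasse \Po 'X^p)`_i = (A \Po 'X^p)`_i.
    move=> hi; rewrite !coef_comp_poly_Xn //; case: ifP => // _; rewrite [in RHS]coef_poly ifT //.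
    rewrite ltn_divLR // mulSn; apply: (leq_ltn_trans hi).
    have := prime_gt1 hp; nia.
  rewrite hc //; congr (_ + _); apply: eq_bigr => i _; rewrite hc // ltnW //.
move=> eq1.
have h1 : vge v 1 (p%:R * e).
  have -> : p%:R * e = \sum_(i < n.+1) (A \Po 'X^p)`_i * X2`_(n.+1 - i) - ((A ^+ p)`_n.+1 - (A \Po 'X^p)`_n.+1).
    by apply: (addrI (A ^+ p)`_n.+1); rewrite eq1; ring.
  apply: vgeB => //; last exact: (Zp_poly_frob hrc).
  apply: vge_sum => // i _; apply: (vgeMl hv).
    by rewrite coef_comp_poly_Xn //; case: ifP => _; rewrite ?vge0 //; apply: Zp_vge.
  rewrite X2E ?(leq_trans (leq_subr _ _)) //; apply: vge_exp_p; rewrite subn_gt0 //.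
have := vge_divl hv 0 (p%:R * e) (p_neq0 hv vp).
by rewrite (nu_p vp) add0r h1 [p%:R * e]mulrC mulfK // (p_neq0 hv vp).
Qed.

End ArtinHasse.

Lemma logn_fact_mono p m n : (m <= n)%N -> (logn p m`! <= logn p n`!)%N.
Proof.
move=> h; apply: dvdn_leq_log; rewrite ?fact_gt0 //.
by rewrite -(ffact_fact (leq_subr m n)) subKn // dvdn_mull.
Qed.

(** * Splitting of the additive character *)

Section Splitting.
Variables (p : nat) (C : closedFieldType) (v : C -> \bar rat).
Hypotheses (hp : prime p) (hv : is_valuation v) (vp : v p%:R = 1%E).
Let Qf := Qp_subfield hp hv vp.
Let ch0 := nat_neq0 hp hv vp.

Lemma Zp_natr (b : nat) : Defs.Zp v b%:R.
Proof. by split; [apply: (sf_nat Qf)|apply: vge_nat]. Qed.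
Lemma ZpB x y : Defs.Zp v x -> Defs.Zp v y -> Defs.Zp v (x - y).
Proof. by move=> [? ?] [? ?]; split; [apply: (sfB Qf)|apply: vgeB]. Qed.

Section Character.
Variable Psi : C -> C.
Hypotheses (hPsi : is_character v Psi) (hPsip : has_order v Psi p).

Lemma char_nat b : Psi b%:R = Psi 1 ^+ b.
Proof.
case: hPsi => nz add; elim: b => [|b IH]; last first.
  rewrite mulrS add ?IH ?exprS //; [exact: (Zp_natr 1)|exact: Zp_natr].
have := add 0 0 (Zp_natr 0) (Zp_natr 0); rewrite addr0 expr0 => e.
by apply: (mulfI (nz 0 (Zp_natr 0))); rewrite mulr1 -e.
Qed.

(** A character of order p is trivial on p Z_p; with the density of the integers it is therefore
    determined by [Psi 1], and continuity is automatic. *)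
Lemma char_close x y : Defs.Zp v x -> Defs.Zp v y -> vge v 1 (x - y) -> Psi x = Psi y.
Proof.
move=> hx hy h; case: hPsi => nz add; case: hPsip => _ hP _.
have p0 := p_neq0 hv vp.
pose z := (x - y) / p%:R.
have hz : Defs.Zp v z.
  split; first by apply: (sfdiv Qf); [case: (ZpB hx hy)|apply: (sf_nat Qf)].
  by rewrite /= -/(vge v 0 z) vge_divl // (nu_p vp) add0r.
have Zm (m : nat) : Defs.Zp v (m%:R * z).
  by split; [apply: (sfM Qf); [apply: (sf_nat Qf)|case: hz]|apply: (vge0M hv); [apply: vge_nat|case: hz]].
have e (m : nat) : Psi (m%:R * z) = Psi z ^+ m.
  elim: m => [|m IH]; first by rewrite mul0r (char_nat 0).
  by rewrite -natr1 mulrDl mul1r add // IH exprSr.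
have ex : x = p%:R * z + y by rewrite mulrC divfK // subrK.
by rewrite {1}ex add // e hP // mul1r.
Qed.

Lemma char_prim : Psi 1 ^+ p = 1 /\ Psi 1 != 1.
Proof.
case: hPsip => _ hP hk; split; first exact: hP (Zp_natr 1).
have [|x hx] := hk 1%N; first by rewrite /= prime_gt1.
rewrite expr1; apply: contraNneq => e.
have [b hb] := Zp_approx hp hv vp 1 hx.
by rewrite (char_close hx (Zp_natr b) hb) char_nat e expr1n.
Qed.
End Character.

(** With l = z - 1, the expansion of (1 + l)^p = 1 divided by l reads l^(p-1) = - p (1 + l w), and
    the last factor is a unit. *)
Lemma zeta_nu (z : C) : z ^+ p = 1 -> z != 1 -> nu v (z - 1) = (p.-1)%:R^-1.
Proof.
move=> zp z1; have [k [rc hrc]] := residue_map_exists hv.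
have p0 := prime_gt0 hp; have p1 := prime_gt1 hp.
have [z0 _ vz] := unity_vge hv p0 zp.
pose l := z - 1; have l0 : l != 0 by rewrite subr_eq0.
have vl : vge v 0 l by apply: vgeB => //; apply: vge01.
have gl : vgt v 0 l.
  rewrite -(rc_eq hv hrc) ?vge01 // -subr_eq0.
  have := k_expD hp hv vp hrc (rc z - rc 1) (rc 1) 1; rewrite expn1 subrK -(rcX hv hrc) // zp (rc1 hrc) expr1n.
  by rewrite -[LHS]add0r => /addIr/esym/eqP; rewrite expf_eq0 => /andP[].
pose w := \sum_(2 <= i < p) ('C(p, i) %/ p)%:R * l ^+ (i - 2).
have vw : vge v 0 w.
  by apply: vge_sum => // i _; apply: vge0M => //; [apply: vge_nat|apply: vge0X].
have e : l ^+ p.-1 = - (p%:R * (1 + l * w)).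
  apply: (mulfI l0); rewrite -exprS prednK //.
  have := zp; rewrite -(subrK 1 z) -/l addrC exprDn -(big_mkord xpredT (fun i => 1 ^+ (p - i) * l ^+ i *+ 'C(p, i))).
  rewrite big_ltn // big_nat_recr //= expr0 mulr1 expr1n bin0 mulr1n subnn expr0 mul1r binn mulr1n.
  rewrite -[RHS]addr0 => /addrI; rewrite big_ltn // bin1 subn1 expr1n mul1r expr1 => /eqP.
  rewrite addrC addr_eq0 => /eqP ->; rewrite mulrN; congr (- _).
  rewrite mulrDr mulr1 mulrDr [l * p%:R]mulr_natr; congr (_ + _).
  rewrite /w !mulr_sumr; apply: eq_big_nat => i /andP[i2 ip].
  rewrite expr1n mul1r -{1}(subnK i2) exprD expr2 -[_ *+ 'C(p, i)]mulr_natr.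
  rewrite -{1}(@divnK p 'C(p, i)) ?prime_dvd_bin ?ip ?(ltnW i2) // natrM; ring.
have hu : vgt v (nu v 1) (1 + l * w - 1).
  by rewrite nu1 // addrAC subrr add0r mulrC; apply: vgtMl.
have [u0 nu0] := nu_close hv (oner_neq0 C) hu.
have := congr1 (nu v) e; rewrite nuX // nuN // nuM // ?(p_neq0 hv vp) // nu0 nu1 // addr0 (nu_p vp).
rewrite -[_ *+ p.-1]mulr_natr => e1.
have n0 : (p.-1)%:R != 0 :> rat by rewrite pnatr_eq0 -lt0n -ltnS prednK.
by apply: (mulIf n0); rewrite e1 mulVf.
Qed.

(** If no root were in the maximal ideal, all inverse roots would be integral and G would be its
    constant term times an integral polynomial, against the linear coefficient 1. *)
Lemma small_root (G : {poly C}) : (forall i, vge v 0 G`_i) -> vgt v 0 G`_0 -> G`_0 != 0 ->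
  G`_1 = 1 -> exists2 x, root G x & vgt v 0 x.
Proof.
move=> hG g0 g00 g1; have [r er] := closed_field_poly_normal G.
apply: contrapT => hno.
have hr x : x \in r -> x != 0 /\ vge v 0 x^-1.
  move=> hx; have rx : root G x by rewrite er rootZ ?lead_coef_eq0 ?root_prod_XsubC //; apply: contraNneq g00 => ->; rewrite coef0.
  have x0 : x != 0 by apply: contraTneq rx => ->; rewrite rootE horner_coef0.
  split=> //; rewrite vgeE ?invr_eq0 // nuV // oppr_ge0 leNgt; apply/negP => h.
  by apply: hno; exists x => //; rewrite vgtE.
pose P := \prod_(x <- r) (1 - x^-1 *: 'X).
have vP : (forall i, vge v 0 P`_i) /\ P`_0 = 1.
  rewrite /P; elim: (r) hr => [|x s IH] hs.
    by rewrite big_nil; split=> [i|]; rewrite coef1 //; apply: vge_nat.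
  have [|h1 h2] := IH; first by move=> y hy; apply: hs; rewrite inE hy orbT.
  have [x0 vx] := hs x (mem_head _ _).
  rewrite big_cons mulrBl mul1r -scalerAl; split=> [i|].
    rewrite coefB coefZ coefXM; apply: vgeB => //; apply: vge0M => //.
    by case: eqP => _; rewrite ?vge0.
  by rewrite coefB coefZ coefXM h2 mulr0 subr0.
have eG : G = G`_0 *: P.
  have eP : \prod_(x <- r) ('X - x%:P) = (\prod_(x <- r) - x) *: P.
    rewrite /P; elim: (r) hr => [|x s IH] hs; first by rewrite !big_nil scale1r.
    rewrite !big_cons IH; last by move=> y hy; apply: hs; rewrite inE hy orbT.
    have [x0 _] := hs x (mem_head _ _).
    rewrite -scalerAr [- x * _]mulrC -scalerA; congr (_ *: _).
    rewrite scalerAl; congr (_ * _).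
    by rewrite scalerBr scalerA mulNr mulfV // scaleN1r opprK alg_polyC polyCN addrC.
  have := er; rewrite eP scalerA; set c := (lead_coef G * _) => e1.
  have ec : G`_0 = c by rewrite {1}e1 coefZ (proj2 vP) mulr1.
  by rewrite ec.
have : vgt v 0 G`_1.
  rewrite eG coefZ mulrC; apply: vgtMl => //; exact: (proj1 vP).
by rewrite g1 /vgt v1 // ltxx.
Qed.

Section Uniformizer.
Variables (N : nat) (z : C).
Hypotheses (hN : (0 < N)%N) (zp : z ^+ p = 1) (z1 : z != 1).

(** Dwork's uniformiser, adapted to the truncated series and so dependent on N. The series minus z
    has constant term 1 - z and linear coefficient 1, and the small root inherits the valuation of z
    - 1. *)
Lemma ah_root : exists2 pi, (artin_hasse p C N).[pi] = z & nu v pi = (p.-1)%:R^-1.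
Proof.
have p1 := prime_gt1 hp; have p0 := prime_gt0 hp.
have vA i : vge v 0 (artin_hasse p C N)`_i := Zp_vge (ah_Zp hp hv vp N i).
have [z0 _ vz] := unity_vge hv p0 zp.
have l0 : z - 1 != 0 by rewrite subr_eq0.
have nz := zeta_nu zp z1.
have ip : 0 < (p.-1)%:R^-1 :> rat by rewrite invr_gt0 ltr0n -ltnS prednK.
pose G := artin_hasse p C N - z%:P.
have f1 : 1`! = 1%N by [].
have G0 : G`_0 = - (z - 1) by rewrite coefB coefC /= (@ah0 p C hp N) opprB.
have G1 : G`_1 = 1 by rewrite coefB coefC /= subr0 (@ah_lt p C hp N) // f1 invr1.
have [||||x rx gx] := @small_root G; rewrite ?G0 ?G1 ?oppr_eq0 //.
- by move=> i; rewrite coefB coefC; apply: vgeB => //; case: eqP => _; rewrite ?vge0.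
- by rewrite vgtN // vgtE // nz.
move: rx; rewrite rootE !hornerE subr_eq0 => /eqP ex.
exists x => //; rewrite -nz.
have x0 : x != 0.
  by apply: contraNneq z1 => x0; rewrite -ex x0 horner_coef0 (@ah0 p C hp N).
have [w vw ew] : exists2 w, vge v 0 w & (artin_hasse p C N).[x] = 1 + x + x ^+ 2 * w.
  have sz : (size (artin_hasse p C N) <= N.-1.+2)%N by rewrite prednK //; apply: size_poly.
  exists (\sum_(i < N.-1) (artin_hasse p C N)`_i.+2 * x ^+ i).
    by apply: vge_sum => // i _; apply: vge0M => //; apply: vge0X => //; apply: vgtW.
  rewrite (horner_coef_wide _ sz) big_ord_recl big_ord_recl /= (@ah0 p C hp N) expr0 mulr1.
  rewrite (@ah_lt p C hp N) // f1 invr1 mul1r expr1 addrA; congr (_ + _).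
  by rewrite mulr_sumr; apply: eq_bigr => i _; rewrite [RHS]mulrCA -exprD add2n.
have e : z - 1 = x * (1 + x * w) by rewrite -ex ew; ring.
have hu : vgt v (nu v 1) (1 + x * w - 1).
  by rewrite nu1 // addrAC subrr add0r mulrC; apply: vgtMl.
have [u0 nu0] := nu_close hv (oner_neq0 C) hu.
by rewrite e nuM // nu0 nu1 // addr0.
Qed.

End Uniformizer.

(** Each step of the recursion divides by n, so the closeness of y and b degrades by the valuation
    of n! only. *)
Lemma ode_close N (H P Q : {poly C}) (y : C) (b : nat) (M : rat) :
  (forall i, vge v 0 H`_i) -> H`_0 = 0 -> (forall i, vge v 0 Q`_i) -> P`_0 = Q`_0 ->
  vge v 0 y -> vge v M (y - b%:R) ->
  ode N (y *: H) P -> ode N (b%:R *: H) Q ->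
  forall n, (n <= N)%N -> vge v (M - (logn p n`!)%:R) (P`_n - Q`_n).
Proof.
move=> vH H0 vQ e0 vy hy oP oQ; elim/ltn_ind => -[|n] IH hn.
  by rewrite e0 subrr; apply: vge0.
have n0 : n.+1%:R != 0 :> C by apply: ch0.
have -> : P`_n.+1 - Q`_n.+1 = (P`_n.+1 - Q`_n.+1) * n.+1%:R / n.+1%:R by rewrite mulfK.
rewrite vge_divl // (nu_natr hp hv vp) // (_ : M - _ + _ = M - (logn p n`!)%:R); last first.
  by rewrite factS lognM ?fact_gt0 // natrD; ring.
rewrite mulrBl !mulr_natr (ode_rec oP hn) (ode_rec oQ hn) -sumrB; apply: vge_sum => // i _.
rewrite !coefZ; have [->|i0] := posnP i; first by rewrite H0 !mulr0 !mul0r subrr; apply: vge0.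
have -> : y * H`_i * P`_(n.+1 - i) - b%:R * H`_i * Q`_(n.+1 - i) =
  H`_i * (y * (P`_(n.+1 - i) - Q`_(n.+1 - i)) + (y - b%:R) * Q`_(n.+1 - i)) by ring.
apply: (vgeMl hv) => //; apply: vgeD => //.
  apply: (vgeMl hv) => //; have lt : (n.+1 - i < n.+1)%N by rewrite ltn_subrL i0.
  apply: vge_le (IH _ lt (leq_trans (leq_subr _ _) hn)).
  rewrite lerD2l lerN2 ler_nat logn_fact_mono //.
rewrite mulrC; apply: (vgeMl hv) => //; apply: vge_le hy.
by rewrite gerBl ler0n.
Qed.

Section SplittingFunction.
Variable Psi : C -> C.
Hypotheses (hPsi : is_character v Psi) (hPsip : has_order v Psi p).
Variables (R N : nat) (pi : C).
Hypotheses (hN : ((R * p.-1)%N <= N)%N) (hpi : (artin_hasse p C N).[pi] = Psi 1)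
  (npi : nu v pi = (p.-1)%:R^-1).

Let p1 := prime_gt1 hp.
Let p0 := prime_gt0 hp.
Let A := artin_hasse p C N.
Let vA i : vge v 0 A`_i := Zp_vge (ah_Zp hp hv vp N i).
Let pi_pos : 0 < nu v pi. Proof. by rewrite npi invr_gt0 ltr0n -ltnS prednK. Qed.
Let pi0 : pi != 0.
Proof. by apply/eqP => e; move: pi_pos; rewrite e /nu (v0 hv) ltxx. Qed.
Let vpi : vge v 0 pi. Proof. by rewrite vgeE // ltW. Qed.

(** The logarithmic derivative of the product is y times that of AH: only exponents p^j occur, and
    they merely shift the sum y of the z^(p^i) cyclically. With an integer b near y, the product is
    near AH(pi)^b = Psi(1)^b = Psi(y). *)
Lemma splitting_char s z : (0 < s)%N -> z ^+ (p ^ s) = z ->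
  vge v R%:R (\prod_(i < s) A.[pi * z ^+ (p ^ i)] - Psi (\sum_(i < s) z ^+ (p ^ i))).
Proof.
move=> s0 ez; have [vz _] := teich_vge hp hv s0 ez.
pose y := \sum_(i < s) z ^+ (p ^ i).
have Zy : Defs.Zp v y := teich_trace_Zp hp hv vp s0 ez.
pose M := (R + logn p N`!).+1.
have [b hb] := Zp_approx hp hv vp M Zy.
have -> : Psi y = Psi 1 ^+ b.
  rewrite -(char_nat hPsi); apply: (char_close hPsi hPsip) => //; first exact: Zp_natr.
  by apply: vge_le hb; rewrite ler1n.
pose H := ah_dlog p C N.
have vH i : vge v 0 H`_i by case: (dlog_coef_Qp hp hv vp N i).
have H0 : H`_0 = 0 by apply: (@ah_dlog0 p C hp N).
pose P := \prod_(i < s) (A \Po (z ^+ (p ^ i) *: 'X)).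
have intX (Q : {poly C}) e : (forall i, vge v 0 Q`_i) -> forall i, vge v 0 (Q ^+ e)`_i.
  by have [k [rc hrc]] := residue_map_exists hv; move=> hQ; case: (int_polyX hv hrc e hQ).
have vP i : vge v 0 P`_i.
  have [k [rc hrc]] := residue_map_exists hv.
  suff : forall r : seq 'I_s, forall j, vge v 0 (\prod_(i <- r) (A \Po (z ^+ (p ^ i) *: 'X)))`_j by apply.
  elim=> [|i' r IH] j; first by rewrite big_nil coef1; apply: vge_nat.
  rewrite big_cons; case: (@int_polyM _ _ hv _ _ hrc (A \Po (z ^+ (p ^ i') *: 'X)) _ _ IH) => // l.
  by rewrite comp_scaleX_coef; apply: vge0M => //; do 2 apply: vge0X => //.
have oP : ode N (y *: H) P.
  apply: (@ode_eqH _ N (\sum_(i < s) (H \Po (z ^+ (p ^ i) *: 'X)))); last first.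
    by apply: ode_prod => i; apply: ode_scale; apply: (ah_ode hp hv vp).
  move=> n hn; rewrite coef_sum coefZ mulr_suml; apply: etrans (_ : \sum_(i < s) z ^+ (p ^ i) ^+ n * H`_n = _).
    by apply: eq_bigr => i _; rewrite comp_scaleX_coef.
  rewrite -!mulr_suml.
  have [->|Hn] := eqVneq H`_n 0; first by rewrite !mulr0.
  congr (_ * _); have [j ->] : exists j : nat, n = (p ^ j)%N.
    apply: contrapT => hno; move: Hn; rewrite /H ah_dlog_coef // big1 ?eqxx // => j _.
    by case: eqP => // e; case: hno; exists j.
  under eq_bigr => i _ do rewrite -exprM -expnD.
  elim: j => [|j <-]; first by apply: eq_bigr => i _; rewrite addn0.
  case: (s) s0 ez => // s' _ ez'; rewrite big_ord_recr [RHS]big_ord_recl /= addrC; congr (_ + _).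
    by rewrite addnS -addSn expnD exprM ez'.
  by apply: eq_bigr => i _; rewrite /bump leq0n add1n addnS addSn.
have oQ : ode N (b%:R *: H) (A ^+ b).
  by rewrite scaler_nat; apply: odeX; apply: (ah_ode hp hv vp).
have P0 : P`_0 = (A ^+ b)`_0.
  rewrite -!horner_coef0 horner_prod horner_exp horner_coef0 (@ah0 p C hp N) expr1n big1 // => i _.
  by rewrite horner_coef0 comp_scaleX_coef expr0 mul1r (@ah0 p C hp N).
have hPQ := ode_close vH H0 (intX A b vA) P0 (Zp_vge Zy) hb oP oQ.
have -> : \prod_(i < s) A.[pi * z ^+ (p ^ i)] = P.[pi].
  rewrite horner_prod; apply: eq_bigr => i _; rewrite horner_comp !hornerE mulrC //.
have -> : Psi 1 ^+ b = (A ^+ b).[pi] by rewrite horner_exp hpi.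
rewrite -hornerN -hornerD horner_coef; apply: vge_sum => // n _.
(* Up to degree N the choice of M pays for the loss by n!. Beyond N the coefficients are only known
   to be integral, but pi^n has valuation n / (p - 1) >= R. *)
rewrite coefB; have [le|lt] := leqP n N.
  rewrite mulrC; apply: (vgeMl hv); first exact: vge0X.
  apply: vge_le (hPQ n le); rewrite /M -natr1 natrD.
  have : (logn p n`!)%:R <= (logn p N`!)%:R :> rat.
    by rewrite ler_nat logn_fact_mono.
  lra.
apply: (vgeMl hv); first by apply: vgeB => //; apply: intX.
rewrite vgeE ?expf_neq0 // nuX // npi -[_ *+ n]mulr_natr mulrC ler_pdivlMr; last by rewrite ltr0n -ltnS prednK.
by rewrite -natrM ler_nat (leq_trans hN) // ltnW.
Qed.

End SplittingFunction.
End Splitting.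

(** * The trace formula *)

Section TraceFormula.
Variables (C : fieldType) (b : nat).

Lemma sum_ord_widen (V : nmodType) m n (f : nat -> V) : (m <= n)%N ->
  (forall i, (m <= i < n)%N -> f i = 0) -> \sum_(i < m) f i = \sum_(i < n) f i.
Proof.
move=> h f0; rewrite -(big_mkord xpredT f) -[RHS](big_mkord xpredT f) [RHS](big_cat_nat (n := m)) //=.
by rewrite [X in _ = _ + X]big_nat_cond [X in _ = _ + X]big1 ?addr0 // => i /andP[/f0].
Qed.

(** Row r holds the image of X^r under multiplication by F followed by the operator that keeps the
    exponents divisible by q and divides them by q, cut at degree b. *)
Definition dwork_mx q (F : {poly C}) : 'M[C]_b.+1 :=
  \matrix_(r, s) (if (r <= q * s)%N then F`_(q * s - r) else 0).

Lemma coef_mul_compXn (F G : {poly C}) q n :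
  (F * (G \Po 'X^q))`_n = \sum_(u < size G) G`_u * (if (n < q * u)%N then 0 else F`_(n - q * u)).
Proof.
rewrite comp_polyE mulr_sumr coef_sum; apply: eq_bigr => u _.
by rewrite -exprM -scalerAr coefZ coefMXn.
Qed.

(** The operators compose by moving G across as G(X^q). The degree bound on F makes the polynomials
    of degree at most b stable, so the cut loses nothing. *)
Lemma dwork_mxM q q' (F G : {poly C}) : (0 < q)%N -> (size F <= (q - 1) * b + 1)%N ->
  dwork_mx q F *m dwork_mx q' G = dwork_mx (q * q') (F * (G \Po 'X^q)).
Proof.
move=> q0 sF; apply/matrixP => r t; rewrite !mxE.
pose A s := if (r <= q * s)%N then F`_(q * s - r) * G`_(q' * t - s) else 0.
have rb : (r <= b)%N by rewrite -ltnS.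
have Fbig s : (b < s)%N -> (r <= q * s)%N -> F`_(q * s - r) = 0.
  move=> bs _; rewrite nth_default //; apply: leq_trans sF _.
  have h1 : (q * b + q <= q * s)%N by rewrite -mulnSr leq_mul2l bs orbT.
  have h2 : (b <= q * b)%N by rewrite leq_pmull.
  rewrite mulnBl mul1n; lia.
transitivity (\sum_(s < (q' * t).+1) A s).
  pose K := maxn b.+1 (q' * t).+1.
  pose A' s := if (s <= q' * t)%N then A s else 0.
  transitivity (\sum_(s < b.+1) A' s).
    apply: eq_bigr => s _; rewrite !mxE /A' /A; case: ifP => _; case: ifP => _ //; rewrite ?mulr0 ?mul0r //.
  rewrite (@sum_ord_widen _ b.+1 K) ?leq_maxl // => [|i /andP[bi _]]; last first.
    by rewrite /A' /A; case: ifP => // _; case: ifP => // h; rewrite Fbig // mul0r.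
  symmetry; rewrite (eq_bigr (fun s : 'I__ => A' s)) => [|s _]; last by rewrite /A' -ltnS ltn_ord.
  rewrite (@sum_ord_widen _ _ K) ?leq_maxr // => i /andP[bi _].
  by rewrite /A' leqNgt bi.
rewrite coef_mul_compXn.
pose B u := G`_u * (if (q * q' * t - r < q * u)%N then 0 else F`_(q * q' * t - r - q * u)).
case: leqP => h; last first.
  apply: big1 => s _; rewrite /A leqNgt; case: leqP => // h'.
  have := ltn_ord s; rewrite ltnS => hs; have : (q * s <= q * (q' * t))%N by rewrite leq_mul2l hs orbT.
  by rewrite mulnA => /(leq_trans h'); rewrite leqNgt h.
transitivity (\sum_(u < (q' * t).+1) B u).
  rewrite (reindex_inj rev_ord_inj) /=; apply: eq_bigr => u _; rewrite /A /B subSS.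
  have hu : (u <= q' * t)%N by rewrite -ltnS.
  rewrite subKn // mulnBr mulnA leqNgt ltn_subLR; last by rewrite -mulnA leq_mul2l hu orbT.
  have -> : (q * q' * t - r < q * u)%N = (q * q' * t < q * u + r)%N by rewrite -(ltn_add2r r) subnK.
  case: (q * q' * t < q * u + r)%N => /=; first by rewrite mulr0.
  by rewrite mulrC subnAC.
pose K := maxn (size G) (q' * t).+1.
rewrite (@sum_ord_widen _ (q' * t).+1 K) ?leq_maxr // => [|i /andP[bi _]]; last first.
  rewrite /B ifT ?mulr0 //; apply: leq_ltn_trans (leq_subr _ _) _.
  by rewrite -mulnA ltn_pmul2l.
rewrite -(@sum_ord_widen _ (size G) K B) ?leq_maxl // => i /andP[bi _].
by rewrite /B nth_default ?mul0r.
Qed.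

Lemma dwork_mx_prod p m (F : nat -> {poly C}) : (0 < p)%N ->
  (forall i, (size (F i) <= (p - 1) * b + 1)%N) ->
  \prod_(i < m.+1) dwork_mx p (F i) = dwork_mx (p ^ m.+1) (\prod_(i < m.+1) (F i \Po 'X^(p ^ i))).
Proof.
move=> p0; elim: m F => [|m IH] F sF.
  by rewrite !big_ord1 expn1 expn0 expr1 comp_polyXr.
rewrite big_ord_recl [in RHS]big_ord_recl /= (IH (fun i => F i.+1)) // -mulmxE dwork_mxM // -expnS.
rewrite expn0 expr1 comp_polyXr rmorph_prod /=; congr (dwork_mx _ (_ * _)); apply: eq_bigr => i _.
by rewrite -comp_polyA comp_Xn_poly -exprM -expnS /bump leq0n add1n.
Qed.

Lemma sum_prim_root m (w : C) j : m.-primitive_root w ->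
  \sum_(i < m) (w ^+ i) ^+ j = if (m %| j)%N then m%:R else 0.
Proof.
move=> hw; under eq_bigr => i _ do rewrite exprAC.
case: ifP => hj.
  have -> : w ^+ j = 1 by apply/eqP; rewrite -(prim_order_dvd hw).
  by under eq_bigr => i _ do rewrite expr1n; rewrite sumr_const card_ord.
have h : w ^+ j - 1 != 0 by rewrite subr_eq0 -(prim_order_dvd hw) hj.
apply: (mulfI h); rewrite mulr0 -subrX1 exprAC (prim_expr_order hw) expr1n subrr //.
Qed.

Lemma sum_multiples (V : nmodType) m c (f : nat -> V) : (0 < m)%N ->
  \sum_(j < m * c + 1) (if (m %| j)%N then f j else 0) = \sum_(r < c.+1) f (m * r)%N.
Proof.
move=> m0; elim: c => [|c IH].
  by rewrite muln0 add0n !big_ord1 dvdn0 muln0.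
rewrite [RHS]big_ord_recr /= -IH -(big_mkord xpredT (fun j => if (m %| j)%N then f j else 0)).
have le : (m * c + 1 <= m * c.+1)%N by rewrite mulnSr leq_add2l.
rewrite (big_cat_nat (n := m * c + 1)) //=; last by rewrite (leq_trans le) ?leq_addr.
rewrite big_mkord; congr (_ + _).
have -> : (m * c.+1 + 1 = (m * c.+1).+1)%N by rewrite addn1.
rewrite big_nat_recr //= dvdn_mulr // big_nat_cond big1 ?add0r //.
move=> i /andP[/andP[h1 h2] _]; case: ifP => // /dvdnP[e ei]; exfalso.
move: h1 h2; rewrite ei addn1 [(e * m)%N]mulnC !ltn_pmul2l // ltnS => h1 /(leq_trans h1).
by rewrite ltnn.
Qed.

(** Summing over the roots of unity keeps the exponents divisible by q - 1, and the coefficients of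
    degree (q - 1) r are the diagonal entries. *)
Lemma dwork_mx_trace q (G : {poly C}) (w : C) : (1 < q)%N -> (q - 1).-primitive_root w ->
  (size G <= (q - 1) * b + 1)%N ->
  (q - 1)%:R * \tr (dwork_mx q G) = \sum_(i < q - 1) G.[w ^+ i].
Proof.
move=> q1 hw sG; have m0 := prim_order_gt0 hw.
under [RHS]eq_bigr => i _ do rewrite (horner_coef_wide _ sG).
rewrite exchange_big /=; under [RHS]eq_bigr => j _ do rewrite -mulr_sumr sum_prim_root //.
transitivity (\sum_(j < (q - 1) * b + 1) (if (q - 1 %| j)%N then G`_j * (q - 1)%:R else 0)); last first.
  by apply: eq_bigr => j _; case: ifP => _ //; rewrite mulr0.
rewrite (sum_multiples _ (fun j => G`_j * (q - 1)%:R)) // /mxtrace mulr_sumr; apply: eq_bigr => r _.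
rewrite mxE mulrC leq_pmull ?(ltnW q1) //; congr (_`_ _ * _).
by rewrite mulnBl mul1n.
Qed.

End TraceFormula.

(** * The dominant minor *)

Section InjectiveSums.

Lemma uniq_sumn_min n (s : seq nat) : uniq s -> size s = n ->
  (n * (n - 1) <= 2 * sumn s)%N /\ (2 * sumn s = n * (n - 1) -> {subset s <= iota 0 n})%N.
Proof.
elim: n s => [|n IH] s us ss.
  by move/size0nil: ss => ->; split.
have s0 : s != [::] by rewrite -size_eq0 ss.
pose m := \max_(x <- s) x.
have mx x : x \in s -> (x <= m)%N by move=> hx; apply: leq_bigmax_seq.
have ms : m \in s.
  case: s s0 {us ss mx} @m => // x s _ /=.
  elim: s x => [|y s IHs] x; first by rewrite big_seq1 mem_head.
  rewrite big_cons; have [h|h] := leqP x (\max_(x <- y :: s) x).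
    by rewrite inE IHs orbT.
  by rewrite mem_head.
have mn : (n <= m)%N.
  rewrite -ltnS -ss -(size_iota 0 m.+1); apply: uniq_leq_size => // x /mx; by rewrite mem_iota.
have pe := perm_to_rem ms.
have sr : size (rem m s) = n by rewrite size_rem // ss.
have [h1 h2] := IH _ (rem_uniq m us) sr.
have es : sumn s = (m + sumn (rem m s))%N by rewrite (perm_sumn pe).
split; first by rewrite es subn1 /=; move: h1; case: (n) mn => [|n'] /= mn; rewrite ?subn1 /=; nia.
rewrite es => e x.
have em : m = n by move: h1 e; case: (n) mn => [|n'] /= mn; rewrite ?subn1 /=; nia.
have e2 : (2 * sumn (rem m s) = n * (n - 1))%N by move: e; rewrite em; case: (n) => [|n']; rewrite ?subn1 /=; nia.
rewrite (perm_mem pe) inE => /orP[/eqP ->|hx]; first by rewrite mem_iota em /= add0n.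
by have := h2 e2 x hx; rewrite !mem_iota /= !add0n => /ltn_trans; apply.
Qed.

Variable n : nat.
Implicit Types f g : 'I_n -> nat.

Lemma inj_sum_min f : injective f -> (n * (n - 1) <= 2 * \sum_i f i)%N /\
  ((2 * \sum_i f i = n * (n - 1))%N -> forall i, (f i < n)%N).
Proof.
move=> hf; have us : uniq [seq f i | i <- enum 'I_n] by rewrite map_inj_uniq ?enum_uniq.
have ss : size [seq f i | i <- enum 'I_n] = n by rewrite size_map size_enum_ord.
have es : (\sum_i f i = sumn [seq f i | i <- enum 'I_n])%N by rewrite sumnE big_map big_enum.
have [h1 h2] := uniq_sumn_min us ss; rewrite es; split=> // e i.
by have := h2 e (f i) (map_f f (mem_enum _ i)); rewrite mem_iota.
Qed.

Lemma inj_small_sum f (phi : nat -> nat) : injective f -> (forall i, (f i < n)%N) ->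
  (\sum_i phi (f i) = \sum_(i < n) phi i)%N.
Proof.
move=> hf lt; pose s i := Ordinal (lt i).
have bs : bijective s by apply: injF_bij => i j e; apply: hf; exact: (congr1 val e).
by rewrite [RHS](reindex s) /=; last exact: onW_bij.
Qed.

Lemma inj_small_sum_eq f : injective f -> (forall i, (f i < n)%N) -> (2 * \sum_i f i = n * (n - 1))%N.
Proof.
move=> hf lt; rewrite (inj_small_sum id hf lt) -(big_mkord xpredT id) /=.
rewrite big_mkord; elim: (n) => [|m IH]; first by rewrite big_ord0.
by rewrite big_ord_recr /= mulnDr IH; case: m {IH} => [|m]; rewrite ?subn1 //=; nia.
Qed.

Variables (d a b : nat).
Hypotheses (d0 : (0 < d)%N) (nab : n = (a + b)%N) (ab : (2 * a + b <= d + 1)%N)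
  (hb : b = 0%N \/ (2 * a + b = d + 1)%N) (nd : (n <= d)%N).

Lemma floor_sum_le f g : (d * \sum_i ((f i + g i) %/ d) <= \sum_i f i + \sum_i g i)%N.
Proof.
rewrite big_distrr -big_split /=; apply: leq_sum => i _; rewrite mulnC; exact: leq_trunc_div.
Qed.

(** Twice the sum of 0, ..., n - 1: the indices below a give a (a - 1), and if b > 0 the b others
    pair up to d, because a + (n - 1) = d. *)
Lemma triangle_defect : (n * (n - 1) = d * b + a * (a - 1))%N.
Proof.
case: hb => [b0|e].
  by rewrite nab b0 addn0 muln0.
have -> : d = (2 * a + b - 1)%N by rewrite e addnK.
rewrite nab; case: (a) ab nd nab => [|a']; first by rewrite muln0 !add0n mul0n addn0 mulnC.
move=> *; have -> : (a'.+1 + b - 1 = a' + b)%N by lia.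
have -> : (2 * a'.+1 + b - 1 = 2 * a' + b + 1)%N by lia.
rewrite subn1 /=; ring.
Qed.

(** If f i < a, then f i + g i <= (a - 1) + (n - 1) < d and the quotient is 0; otherwise it is at
    most 1. Only b of the values f i are at least a. *)
Lemma floor_sum_small f g : injective f -> injective g ->
  (forall i, (f i < n)%N) -> (forall i, (g i < n)%N) ->
  (\sum_i ((f i + g i) %/ d) <= b)%N.
Proof.
move=> hf hg lf lg.
have h i : ((f i + g i) %/ d <= (a <= f i))%N.
  have fgd : (f i + g i < 2 * d)%N by have := lf i; have := lg i; lia.
  have : ((f i + g i) %/ d < 2)%N by rewrite ltn_divLR.
  move=> lt2; have [fa|fa] := leqP a (f i); first by rewrite -ltnS.
  by rewrite divn_small //; have := lg i; lia.
apply: (@leq_trans (\sum_i (a <= f i))); first exact: leq_sum.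
rewrite (inj_small_sum (fun x => (a <= x)%N : nat) hf lf) nab big_split_ord /= big1 ?add0n => [|i _].
  rewrite (eq_bigr (fun=> 1%N)) ?sum1_card ?card_ord // => i _; by rewrite leq_addr.
by rewrite leqNgt ltn_ord.
Qed.

End InjectiveSums.

(** * Nonvanishing of the two residue determinants *)

Section LeadingDeterminants.
Variable k : fieldType.

Lemma trig_kernel n (T : 'M[k]_n) (u : 'rV[k]_n) : (forall r j : 'I_n, (r < j)%N -> T r j = 0) ->
  (forall j, T j j != 0) -> u *m T = 0 -> u = 0.
Proof.
move=> T0 Tj uT; have uT' : T \in unitmx.
  rewrite unitmxE unitfE det_trig; first by apply/prodf_neq0 => j _.
  by apply/is_trig_mxP => r j; apply: T0.
by rewrite -[u](mulmxK uT') uT mul0mx.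
Qed.

Lemma antitrig_det n (M : 'M[k]_n) : (forall r s : 'I_n, (r + s + 1 < n)%N -> M r s = 0) ->
  (forall r s : 'I_n, (r + s + 1)%N = n -> M r s != 0) -> \det M != 0.
Proof.
move=> M0 M1; apply/det0P => -[u u0 uM]; move/negP: u0; apply; apply/eqP.
apply: (@trig_kernel _ (\matrix_(r, j) M r (rev_ord j))) => [r j lt|j|].
- by rewrite mxE M0 //= ; have := ltn_ord j; lia.
- by rewrite mxE M1 //= ; have := ltn_ord j; lia.
apply/rowP => j; have := congr1 (fun A : 'rV[k]_n => A 0 (rev_ord j)) uM; rewrite !mxE => e.
by rewrite -[RHS]e; apply: eq_bigr => r _; rewrite mxE.
Qed.

Variable p : nat.
Hypotheses (hp : prime p) (hk : forall n, (n%:R == 0 :> k) = (p %| n)%N).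

Lemma natr_small m : (0 < m < p)%N -> m%:R != 0 :> k.
Proof. by move=> /andP[m0 mp]; rewrite hk gtnNdvd. Qed.

Lemma fact_small m : (m < p)%N -> (m`!)%:R != 0 :> k.
Proof.
elim: m => [|m IH] h; first by rewrite fact0 oner_eq0.
by rewrite factS natrM mulf_neq0 ?IH ?(ltnW h) // natr_small.
Qed.

Lemma natr_ffact n m : (n ^_ m)%:R = \prod_(i < m) (n%:R - i%:R) :> k.
Proof.
elim: m => [|m IH]; first by rewrite big_ord0 ffactn0.
rewrite big_ord_recr /= -IH ffactnSr natrM.
have [h|h] := leqP m n; first by rewrite natrB.
by rewrite ffact_small // !mul0r.
Qed.

Variables (c a : nat) (al : k).
Hypotheses (c2 : (1 < c)%N) (ca : (c * (a - 1) < p)%N) (al0 : al != 0).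

Definition low_mx : 'M[k]_a := \matrix_(r, s)
  (if (r + s <= c * s)%N then al ^+ (r + s) / ((c * s - (r + s))`!%:R * (r + s)`!%:R) else 0).

(** At s this is the product of the falling factorials of (c - 1) s of length r and of s + a - 1 of
    length a - 1 - r. They clear the two factorials in [low_mx], and the first vanishes when r + s >
    c s, as the entry does. *)
Let P (r : nat) : {poly k} := \prod_(i < r) ((c.-1)%:R *: 'X - i%:R%:P) *
  \prod_(i < (a - 1 - r)%N) ('X + (a - 1)%:R%:P - i%:R%:P).

Lemma low_mxE (r s : 'I_a) : (P r).[s%:R] * al ^+ (r + s) =
  low_mx r s * ((c.-1 * s)`!%:R * (s + (a - 1))`!%:R).
Proof.
have ra := ltn_ord r; have sa := ltn_ord s.
have cs : (c * s = c.-1 * s + s)%N by case: (c) c2 => // c' _; rewrite mulSn addnC.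
have small : (s + (a - 1) < p)%N by apply: leq_ltn_trans ca; nia.
have small2 : (c.-1 * s < p)%N by apply: leq_ltn_trans ca; nia.
have PE : (P r).[s%:R] = ((c.-1 * s) ^_ r)%:R * ((s + (a - 1)) ^_ (a - 1 - r))%:R.
  rewrite /P hornerM !horner_prod !natr_ffact; congr (_ * _).
    by apply: eq_bigr => i _; rewrite !hornerE natrM.
  by apply: eq_bigr => i _; rewrite !hornerE natrD.
rewrite PE mxE.
have e2 : ((s + (a - 1)) ^_ (a - 1 - r) * (r + s)`! = (s + (a - 1))`!)%N.
  rewrite -(@ffact_fact (s + (a - 1)) (a - 1 - r)); last by lia.
  by have -> : (s + (a - 1) - (a - 1 - r) = r + s)%N by lia.
have f1 : ((r + s)`!)%:R != 0 :> k by apply: fact_small; apply: leq_ltn_trans small; lia.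
case: ifP => h; last first.
  by rewrite ffact_small ?mul0r //; move: h; rewrite cs leq_add2r => /negbT; rewrite -ltnNge.
have e1 : ((c.-1 * s) ^_ r * (c * s - (r + s))`! = (c.-1 * s)`!)%N.
  rewrite -(@ffact_fact (c.-1 * s) r); last by move: h; rewrite cs leq_add2r.
  by have -> : (c * s - (r + s) = c.-1 * s - r)%N by rewrite cs; lia.
have f2 : ((c * s - (r + s))`!)%:R != 0 :> k by apply: fact_small; apply: leq_ltn_trans small2; lia.
by rewrite -e1 -e2 !natrM; field; rewrite f1 f2.
Qed.

Lemma size_lin_prod (I : Type) (s : seq I) (F : I -> {poly k}) : (forall i, (size (F i) <= 2)%N) ->
  (size (\prod_(i <- s) F i)%R <= (size s).+1)%N.
Proof.
move=> hF; elim: s => [|x s IH]; first by rewrite big_nil size_poly1.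
rewrite big_cons; apply: leq_trans (size_polyMleq _ _) _; have := hF x; move: IH => /=; lia.
Qed.

Lemma size_P (r : 'I_a) : (size (P r) <= a)%N.
Proof.
have ra := ltn_ord r.
have hlin (x y : k) : (size (x *: 'X + y%:P)%R <= 2)%N.
  apply: leq_trans (size_polyD _ _) _; rewrite geq_max (leq_trans (size_scale_leq _ _)) ?size_polyX //=.
  exact: leq_trans (size_polyC_leq1 _) _.
have h1 : (size (\prod_(i < r) ((c.-1)%:R *: 'X - i%:R%:P) : {poly k})%R <= r.+1)%N.
  rewrite -[X in (_ <= X.+1)%N](size_enum_ord r) enumT; apply: size_lin_prod => i.
  by rewrite -polyCN hlin.
have h2 : (size (\prod_(i < (a - 1 - r)%N) ('X + (a - 1)%:R%:P - i%:R%:P) : {poly k})%R <= (a - 1 - r).+1)%N.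
  rewrite -[X in (_ <= X.+1)%N](size_enum_ord (a - 1 - r)) enumT; apply: size_lin_prod => i.
  by rewrite -addrA -polyCB -['X]scale1r hlin.
by apply: leq_trans (size_polyMleq _ _) _; lia.
Qed.

Lemma P_eval_lt (r j : 'I_a) : (r < j)%N -> (P r).[- j%:R] = 0.
Proof.
move=> lt; have ja := ltn_ord j; have hi : (a - 1 - j < a - 1 - r)%N by lia.
have e : (a - 1 = (a - 1 - j) + j)%N by lia.
rewrite /P hornerM [X in _ * X]horner_prod (bigD1 (Ordinal hi)) //=.
have -> : ('X + (a - 1)%:R%:P - (a - 1 - j)%:R%:P : {poly k}).[- j%:R] = 0.
  by rewrite !hornerE [X in _ + X%:R - _]e natrD; ring.
by rewrite mul0r mulr0.
Qed.

Lemma P_eval_diag (j : 'I_a) : (P j).[- j%:R] != 0.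
Proof.
have ja := ltn_ord j; have cp : ((c.-1).+1 = c)%N by rewrite prednK // ltnW.
rewrite /P hornerM mulf_neq0 // horner_prod; apply/prodf_neq0 => i _; rewrite !hornerE.
  have -> : (c.-1)%:R * - j%:R - i%:R = - (c.-1 * j + i)%:R :> k by rewrite natrD natrM; ring.
  rewrite oppr_eq0 natr_small //; have ij := ltn_ord i; apply/andP; split; first by nia.
  apply: leq_ltn_trans ca; rewrite -cp mulSn; nia.
have ij := ltn_ord i.
have e : (a - 1 = (a - 1 - j - i) + j + i)%N by lia.
have -> : - j%:R + (a - 1)%:R - i%:R = (a - 1 - j - i)%:R :> k by rewrite [X in _ + X%:R - _]e !natrD; ring.
rewrite natr_small //; apply/andP; split; first by lia.
apply: leq_ltn_trans ca; nia.
Qed.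

(* Up to nonzero row and column factors the entries are the values at s = 0, ..., a - 1 of
   the polynomials P r; these are independent because (P r).[- j] is triangular. *)
Lemma low_mx_det : \det low_mx != 0.
Proof.
apply/det0P => -[u u0 uM]; move/negP: u0; apply; apply/eqP.
have a1 : (0 < a)%N -> (a - 1 < p)%N by move=> a0; apply: leq_ltn_trans ca; nia.
pose v : 'rV[k]_a := \row_r (u 0 r * al ^+ r).
pose Q := \sum_r v 0 r *: P r.
pose rs : seq k := [seq (nat_of_ord s)%:R | s <- enum 'I_a].
have Q0 : Q = 0.
  apply: (@roots_geq_poly_eq0 _ Q rs); rewrite /rs.
  - apply/allP => _ /mapP[s _ ->]; rewrite rootE horner_sum.
    have := congr1 (fun A : 'rV[k]_a => A 0 s) uM; rewrite !mxE => e.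
    have f : al ^+ s != 0 by rewrite expf_neq0.
    apply/eqP/(mulfI f); rewrite mulr0.
    transitivity ((\sum_j u 0 j * low_mx j s) * ((c.-1 * s)`!%:R * (s + (a - 1))`!%:R)); last by rewrite e mul0r.
    rewrite mulr_sumr mulr_suml; apply: eq_bigr => r _.
    rewrite -mulrA -low_mxE hornerZ mxE exprD.
    ring.
  - rewrite map_inj_uniq ?enum_uniq // => r s /eqP.
    wlog le : r s / (r <= s)%N => [W e|].
      by case/orP: (leq_total r s) => h; [apply: W|symmetry; apply: W; rewrite // eq_sym].
    rewrite eq_sym -subr_eq0 -natrB // => e; apply: val_inj => /=; apply/eqP.
    rewrite eqn_leq le /= leqNgt; apply: contraL e => lt; apply: natr_small.
    rewrite subn_gt0 lt /=; have := ltn_ord s; have := a1 (leq_ltn_trans (leq0n _) (ltn_ord r)); lia.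
  - rewrite size_map size_enum_ord; apply: (leq_trans (size_sum _ _ _)); apply/bigmax_leqP => r _.
    exact: leq_trans (size_scale_leq _ _) (size_P r).
have v0 : v = 0.
  apply: (@trig_kernel _ (\matrix_(r, j) (P r).[- (j : nat)%:R])) => [r j lt|j|].
  - by rewrite mxE P_eval_lt.
  - by rewrite mxE P_eval_diag.
  apply/rowP => j; rewrite !mxE; transitivity (Q.[- (j : nat)%:R]); last by rewrite Q0 horner0.
  rewrite /Q horner_sum; apply: eq_bigr => r _; rewrite hornerZ; congr (_ * _); by rewrite mxE.
apply/rowP => r; have := congr1 (fun A : 'rV[k]_a => A 0 r) v0; rewrite !mxE => /eqP.
by rewrite mulf_eq0 expf_eq0 (negbTE al0) andbF orbF => /eqP.
Qed.

End LeadingDeterminants.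

(** * Weights of the matrix entries and the corner minor *)

Section DworkEntries.
Variables (p : nat) (C : closedFieldType) (v : C -> \bar rat).
Hypotheses (hp : prime p) (hv : is_valuation v) (vp : v p%:R = 1%E).
Variables (k : fieldType) (rc : C -> k).
Hypothesis hrc : residue_map v rc.

Lemma rc_det n (M : 'M[C]_n) : (forall i j, vge v 0 (M i j)) ->
  vge v 0 (\det M) /\ rc (\det M) = \det (map_mx rc M).
Proof.
move=> hM; have sg b : vge v 0 ((-1) ^+ b) by apply: (vge0X hv); rewrite (vgeN hv) (vge01 hv).
have tm (s : 'S_n) : vge v 0 ((-1) ^+ s * \prod_i M i (s i)) by apply: (vge0M hv) => //; apply: (vge0_prod hv).
split; first by apply: (vge_sum hv).
rewrite /determinant (rc_sum hv hrc) //; apply: eq_bigr => s _.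
rewrite (rcM hrc) //; last exact: (vge0_prod hv).
rewrite (rc_prod hv hrc) // (rcX hv hrc) ?(vgeN hv) ?(vge01 hv) // (rcN hv hrc) ?(vge01 hv) // (rc1 hrc).
by congr (_ * _); apply: eq_bigr => i _; rewrite mxE.
Qed.

Variables (N : nat) (e : nat -> C).
Hypotheses (eint : forall j, vge v 0 (e j)) (elow : forall j, (j < p)%N -> rc (e j) = (j`!%:R)^-1).

Definition split_ser (x : C) (m : nat) : {poly C} := \sum_(j < N.+1) (e j * x ^+ j) *: 'X^(m * j).

Variables (d c : nat).
Hypotheses (d0 : (0 < d)%N) (c2 : (1 < c)%N) (pc : (p + 1 = d * c)%N) (Np : (p <= N)%N).
Variables (pi al : C).
Hypotheses (npi : nu v pi = (p.-1)%:R^-1) (alint : vge v 0 al) (al0 : rc al != 0).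

Let vw : rat := (p.-1)%:R^-1.

Let vw0 : 0 < vw.
Proof. by rewrite invr_gt0 ltr0n; have := prime_gt1 hp; lia. Qed.

Let pi0 : pi != 0.
Proof. by apply/eqP => h; move: npi vw0; rewrite h /nu (v0 hv) /vw => <-; rewrite ltxx. Qed.

Let pipos : vgt v 0 pi. Proof. by rewrite (vgtE hv _ pi0) npi vw0. Qed.
Let piint : vge v 0 pi. Proof. by rewrite (vgeE hv _ pi0) npi ltW // vw0. Qed.

Definition dwork_ser : {poly C} := split_ser pi d * split_ser (pi * al) (d - 1).

Lemma coef_dwork_ser m : dwork_ser`_m = \sum_(i < N.+1) \sum_(j < N.+1)
  (if (m == d * i + (d - 1) * j)%N then e i * e j * al ^+ j * pi ^+ (i + j) else 0).
Proof.
rewrite /dwork_ser /split_ser mulr_suml coef_sum; apply: eq_bigr => i _.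
rewrite mulr_sumr coef_sum; apply: eq_bigr => j _.
rewrite -scalerAl -scalerAr -exprD !coefZ coefXn; case: eqP => _; last by rewrite !mulr0.
by rewrite /= exprMn exprD mulr1; ring.
Qed.

Definition dwork_entry r s : C := if (r <= p * s)%N then dwork_ser`_(p * s - r) else 0.
Definition entry_weight r s := (c * s - (r + s) %/ d)%N.

Lemma index_identity r s i j : (r <= p * s)%N -> (p * s - r = d * i + (d - 1) * j)%N ->
  (d * (i + j) + (r + s) = d * (c * s) + j)%N.
Proof.
move=> le h; have e1 : (p * s = r + (d * i + (d - 1) * j))%N by lia.
have e2 : (d * j = (d - 1) * j + j)%N by rewrite -[X in (_ + X)%N]mul1n -mulnDl; congr (_ * _)%N; lia.
have e3 : (d * (c * s) = p * s + s)%N by rewrite mulnA -pc mulnDl mul1n.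
by rewrite mulnDr e2 e3 e1; lia.
Qed.

(** Because p + 1 = d c, a pair contributing to the entry satisfies d (i + j) + (r + s) = d c s + j.
    Dividing r + s by d bounds the exponent i + j of pi from below, and equality determines j. *)
Lemma weight_le r s i j : (r <= p * s)%N -> (p * s - r = d * i + (d - 1) * j)%N ->
  (entry_weight r s <= i + j)%N /\
  (entry_weight r s = i + j -> j = (r + s) %% d)%N.
Proof.
move=> le /(index_identity le) h; rewrite /entry_weight.
have e2 := divn_eq (r + s) d; set x := ((r + s) %/ d)%N in e2 *; set y := ((r + s) %% d)%N in e2 *.
have yd : (y < d)%N by rewrite ltn_mod.
have xl : (x <= c * s)%N.
  rewrite -(leq_pmul2l d0); apply: leq_trans (_ : r + s <= _)%N; first by rewrite mulnC leq_trunc_div.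
  by rewrite mulnA -pc mulnDl mul1n leq_add2r.
have h2 : (d * (i + j) + d * x + y = d * (c * s) + j)%N by rewrite -h e2; lia.
split.
  have : (d * (c * s) <= d * (i + j + x) + y)%N by rewrite mulnDr; lia.
  move=> h3; have : (d * (c * s) < d * (i + j + x + 1))%N by rewrite !mulnDr muln1 in h3 *; lia.
  by rewrite ltn_pmul2l //; lia.
move=> e4; have e5 : (c * s = i + j + x)%N by lia.
by move: h2; rewrite e5 !mulnDr; lia.
Qed.

Definition entry_lead r s : C := \sum_(i < N.+1) \sum_(j < N.+1)
  (if (p * s - r == d * i + (d - 1) * j)%N then e i * e j * al ^+ j * pi ^+ (i + j - entry_weight r s) else 0).

Lemma entry_leadE r s : (r <= p * s)%N ->
  dwork_entry r s = pi ^+ entry_weight r s * entry_lead r s.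
Proof.
move=> le; rewrite /dwork_entry le coef_dwork_ser /entry_lead mulr_sumr; apply: eq_bigr => i _.
rewrite mulr_sumr; apply: eq_bigr => j _; case: eqP => h; last by rewrite mulr0.
have [l _] := weight_le le h; rewrite mulrCA -exprD; congr (_ * pi ^+ _); lia.
Qed.

Let term_vge i j w : vge v 0 (e i * e j * al ^+ j * pi ^+ w).
Proof. by rewrite !(vge0M hv) ?(vge0X hv) ?eint ?piint. Qed.

Lemma entry_lead_vge r s : vge v 0 (entry_lead r s).
Proof.
apply: (vge_sum hv) => i _; apply: (vge_sum hv) => j _; by case: ifP => _; rewrite ?(vge0 hv) ?term_vge.
Qed.

Lemma entry_vge r s : vge v (((c * s)%:R - ((r + s) %/ d)%:R) * vw) (dwork_entry r s).
Proof.
have [le|lt] := leqP r (p * s); last by rewrite /dwork_entry leqNgt lt /= (vge0 hv).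
rewrite entry_leadE //.
have xl : ((r + s) %/ d <= c * s)%N.
  rewrite -(leq_pmul2l d0); apply: leq_trans (_ : r + s <= _)%N; first by rewrite mulnC leq_trunc_div.
  by rewrite mulnA -pc mulnDl mul1n leq_add2r.
rewrite -natrB // -[X in vge v X _]addr0 mulr_natl; apply: (vgeM hv); last exact: entry_lead_vge.
by apply: (vgeX hv); rewrite vgeE // npi.
Qed.

(** Modulo the maximal ideal only the pair of minimal weight survives, and its indices are below p,
    where the Artin-Hasse coefficients are inverse factorials. *)
Lemma rc_entry_lead r s : (r <= p * s)%N -> (entry_weight r s < p)%N -> (d <= p)%N ->
  rc (entry_lead r s) = if ((r + s) %% d <= entry_weight r s)%N then
    rc al ^+ ((r + s) %% d) / ((entry_weight r s - (r + s) %% d)`!%:R * ((r + s) %% d)`!%:R) else 0.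
Proof.
move=> le wp dp; set w := entry_weight r s; set y := ((r + s) %% d)%N.
have yd : (y < d)%N by rewrite ltn_mod.
rewrite /entry_lead (rc_sum hv hrc); last first.
  move=> i _; apply: (vge_sum hv) => j _; by case: ifP => _; rewrite ?(vge0 hv) ?term_vge.
have tm (i j : 'I_N.+1) : rc (if (p * s - r == d * i + (d - 1) * j)%N then e i * e j * al ^+ j * pi ^+ (i + j - w) else 0) =
   if ((p * s - r == d * i + (d - 1) * j) && (i + j == w))%N then rc (e i) * rc (e j) * rc al ^+ j else 0.
  case: eqP => h /=; last by rewrite (rc0 hv hrc).
  have [l _] := weight_le le h; rewrite !(rcM hrc) ?(vge0M hv) ?(vge0X hv) //.
  rewrite !(rcX hv hrc) //; case: eqP => e'; first by rewrite e' subnn mulr1.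
  have -> : rc pi = 0 by apply/eqP; rewrite (rc_eq0 hrc).
  by rewrite expr0n subn_eq0 leqNgt ltn_neqAle l andbT eq_sym; move/eqP: e' => ->; rewrite mulr0.
rewrite (eq_bigr (fun i : 'I_N.+1 => \sum_(j < N.+1) if ((p * s - r == d * i + (d - 1) * j) && (i + j == w))%N then rc (e i) * rc (e j) * rc al ^+ j else 0)); last first.
  move=> i _; rewrite (rc_sum hv hrc) => [|j _]; first by apply: eq_bigr => j _; apply: tm.
  by case: ifP => _; rewrite ?(vge0 hv) ?term_vge.
have condE (i j : nat) : ((p * s - r == d * i + (d - 1) * j) && (i + j == w))%N = [&& (y <= w)%N, i == (w - y)%N & j == y].
  apply/andP/and3P => [[/eqP h /eqP e1]|[yw /eqP e1 /eqP e2]].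
    have [_ h2] := weight_le le h; have jy := h2 (esym e1); rewrite -/y in jy.
    by rewrite -jy -e1; split; rewrite ?leq_addl ?addnK.
  split; last by rewrite e1 e2 subnK.
  have e3 := divn_eq (r + s) d; rewrite -/y in e3.
  have e4 : (d * (c * s) = p * s + s)%N by rewrite mulnA -pc mulnDl mul1n.
  have xl : ((r + s) %/ d <= c * s)%N.
    rewrite -(leq_pmul2l d0); apply: leq_trans (_ : r + s <= _)%N; first by rewrite mulnC leq_trunc_div.
    by rewrite e4 leq_add2r.
  have e5 : (w + (r + s) %/ d = c * s)%N by rewrite /w /entry_weight subnK.
  have e6 : (d * i + d * y = d * w)%N by rewrite -mulnDr e1 subnK.
  have e7 : (d * w + d * ((r + s) %/ d) = p * s + s)%N by rewrite -mulnDr e5.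
  have e8 : (d * y = (d - 1) * y + y)%N by rewrite -[X in (_ + X)%N]mul1n -mulnDl; congr (_ * _)%N; lia.
  by rewrite e2; apply/eqP; lia.
case: (leqP y w) => yw; last first.
  by rewrite big1 // => i _; rewrite big1 // => j _; rewrite condE leqNgt yw.
have iN : (w - y < N.+1)%N by lia.
have jN : (y < N.+1)%N by lia.
rewrite (bigD1 (Ordinal iN)) //= (bigD1 (Ordinal jN)) //= condE yw !eqxx /=.
rewrite !big1 ?addr0.
- rewrite !elow; [|lia|lia]; rewrite invfM; ring.
- move=> i ni; rewrite big1 // => j _; rewrite condE (_ : (i : nat) == (w - y)%N = false) ?andbF //.
  by apply: negbTE; apply: contra ni => /eqP h; apply/eqP/val_inj.
- by move=> j nj; rewrite condE /= (_ : (j : nat) == y = false) ?andbF //; apply: negbTE; apply: contra nj => /eqP h; apply/eqP/val_inj.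
Qed.

Let dp : (d <= p)%N. Proof. by nia. Qed.

Lemma rc_unit x : vge v 0 x -> rc x != 0 -> x != 0 /\ nu v x = 0.
Proof.
move=> hx; rewrite (rc_eq0 hrc) // => h; have x0 : x != 0.
  by apply: contraNneq h => ->; apply: (vgt0 hv).
split=> //; move: hx h; rewrite (vgeE hv _ x0) (vgtE hv _ x0) -leNgt => h1 h2.
by apply/eqP; rewrite eq_le h1 h2.
Qed.

Variables (a b : nat).
Hypotheses (ab : (2 * a + b <= d + 1)%N) (hb : b = 0%N \/ (2 * a + b = d + 1)%N) (nd : (a + b <= d)%N).

(** The least weight in column s among the rows of the corner: r + s can reach d only if s >= a. *)
Definition col_weight s := if (s < a)%N then (c * s)%N else (c * s - 1)%N.
Definition reduced_entry r s : C := dwork_entry r s / pi ^+ col_weight s.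

Lemma reduced_entryP r s : (r < a + b)%N -> (s < a + b)%N -> vge v 0 (reduced_entry r s) /\
  rc (reduced_entry r s) =
  if (s < a)%N then (if (r + s <= c * s)%N then rc al ^+ (r + s) / ((c * s - (r + s))`!%:R * (r + s)`!%:R) else 0)
  else if (r + s < d)%N then 0 else
    (if (r + s - d <= c * s - 1)%N then rc al ^+ (r + s - d) / ((c * s - 1 - (r + s - d))`!%:R * (r + s - d)`!%:R) else 0).
Proof.
move=> rn sn; have wp : (c * s < p)%N by nia.
rewrite /reduced_entry /col_weight.
have [le|lt] := leqP r (p * s); last first.
  rewrite /dwork_entry leqNgt lt /= mul0r (vge0 hv) (rc0 hv hrc); split=> //.
  case: ifP => sa; first by rewrite ifF //; nia.
  have s0 : (0 < s)%N by lia.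
  by exfalso; have h1 : (p <= p * s)%N; [rewrite leq_pmulr|have := dp; lia].
have ew : (entry_weight r s < p)%N by rewrite /entry_weight; apply: leq_ltn_trans wp; apply: leq_subr.
rewrite entry_leadE //.
case: (ltnP s a) => sa.
  have rsd : (r + s < d)%N by lia.
  have e1 : entry_weight r s = (c * s)%N by rewrite /entry_weight divn_small // subn0.
  have := rc_entry_lead le ew dp; rewrite e1 modn_small // => <-.
  by rewrite mulrC mulKf ?expf_neq0 // entry_lead_vge.
have s0 : (0 < s)%N by lia.
case: (ltnP (r + s) d) => rsd.
  have -> : entry_weight r s = ((c * s - 1) + 1)%N by rewrite /entry_weight divn_small // subn0 subnK //; nia.
  rewrite exprD mulrC -!mulrA mulKf ?expf_neq0 // expr1.
  split; first by apply: (vge0M hv) => //; apply: entry_lead_vge.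
  rewrite (rcM hrc) ?entry_lead_vge //.
  by have -> : rc pi = 0; [apply/eqP; rewrite (rc_eq0 hrc)|rewrite mul0r].
have q1 : ((r + s) %/ d = 1)%N by apply/eqP; rewrite eqn_leq -ltnS ltn_divLR // leq_divRL //; lia.
have m1 : ((r + s) %% d = r + s - d)%N by rewrite -{1}(subnK rsd) modnDr modn_small //; lia.
have e1 : entry_weight r s = (c * s - 1)%N by rewrite /entry_weight q1.
have := rc_entry_lead le ew dp; rewrite e1 m1 => <-.
by rewrite mulrC mulKf ?expf_neq0 // entry_lead_vge.
Qed.

Lemma col_weight_sum : (\sum_(s < a + b) col_weight s)%:R = (c * \sum_(s < a + b) s)%:R - b%:R :> rat.
Proof.
rewrite !big_split_ord /= mulnDr !natrD -addrA; congr (_ + _).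
  by rewrite big_distrr /=; congr (_%:R); apply: eq_bigr => i _; rewrite /col_weight ltn_ord.
have eb : b%:R = \sum_(i < b) 1 :> rat by rewrite sumr_const card_ord.
rewrite big_distrr /= !natr_sum [X in _ = _ - X]eb -sumrB.
apply: eq_bigr => i _; rewrite /col_weight ltnNge leq_addr /= natrB //.
by have := ltn_ord i; nia.
Qed.

Lemma main_minor : let M := \matrix_(r < a + b, s < a + b) dwork_entry r s in
  \det M != 0 /\ nu v (\det M) = ((c * \sum_(s < a + b) s)%:R - b%:R) * vw.
Proof.
pose R := \matrix_(r < a + b, s < a + b) reduced_entry r s.
have [d1 d2] : vge v 0 (\det R) /\ rc (\det R) = \det (map_mx rc R).
  by apply: rc_det => i j; rewrite mxE; case: (reduced_entryP (ltn_ord i) (ltn_ord j)).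
have hk := k_natr_eq0 hp hv vp hrc.
have dR : rc (\det R) != 0.
  rewrite d2 -(submxK (map_mx rc R)).
  (* For r < a <= s the sum r + s stays below d, so the weight exceeds the column weight by one and
     the residue vanishes. *)
  have -> : ursubmx (map_mx rc R) = 0.
    apply/matrixP => r s; rewrite !mxE; have [_ ->] := reduced_entryP (ltn_ord (lshift b r)) (ltn_ord (rshift a s)).
    have := ltn_ord r; have := ltn_ord s => /= h1 h2.
    by rewrite ltnNge leq_addr /= ifT //; lia.
  rewrite det_lblock mulf_neq0 //.
    have -> : ulsubmx (map_mx rc R) = low_mx c a (rc al).
      apply/matrixP => r s; rewrite !mxE; have [_ ->] := reduced_entryP (ltn_ord (lshift b r)) (ltn_ord (lshift b s)).
      by rewrite /= ltn_ord.
    apply: (low_mx_det hp hk) => //; nia.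
  apply: antitrig_det => r s; have := ltn_ord r; have := ltn_ord s => h1 h2 h3; rewrite !mxE;
    have [_ ->] := reduced_entryP (ltn_ord (rshift a r)) (ltn_ord (rshift a s)); rewrite /= ltnNge leq_addr /=.
    by rewrite ifT //; lia.
  (* On the antidiagonal of the last block the remainder modulo d is 0, which leaves the inverse of
     a factorial prime to p. *)
  have -> : (a + r + (a + s) = d)%N by lia.
  rewrite ltnn subnn leq0n expr0 subn0 fact0 mulr1 mul1r invr_eq0.
  apply: (fact_small hk); nia.
have [D0 D1] := rc_unit d1 dR.
have e1 : \matrix_(r < a + b, s < a + b) dwork_entry r s = R *m diag_mx (\row_s pi ^+ col_weight s).
  by apply/matrixP => r s; rewrite mul_mx_diag !mxE /reduced_entry divfK // expf_neq0.
rewrite /= e1 det_mulmx det_diag; under eq_bigr do rewrite mxE.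
rewrite -expr_sum; have pn : pi ^+ (\sum_(s < a + b) col_weight s) != 0 by rewrite expf_neq0.
by rewrite mulf_neq0 // (nuM hv) // D1 add0r (nuX hv) npi -[X in X = _]mulr_natl col_weight_sum.
Qed.

End DworkEntries.

(** * Domination of the other paths *)

Section Corner.
Variables (R : comNzRingType) (B n : nat).
Hypothesis nB : (n <= B)%N.

Definition corner_incl : 'M[R]_(n, B) := \matrix_(i, r) (r == widen_ord nB i)%:R.

(** The term of comparison: the dominant path occurs in many orderings of {0, ..., n-1}, and
    truncated matrices collect them all, with total given by [prod_truncate]. *)
Definition truncate_mx (A : 'M[R]_B) : 'M[R]_B := \matrix_(r, s) (if (r < n)%N && (s < n)%N then A r s else 0).
Definition corner_mx (A : 'M[R]_B) : 'M[R]_n := \matrix_(r, s) A (widen_ord nB r) (widen_ord nB s).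

Lemma corner_inclK : corner_incl *m corner_incl^T = 1%:M.
Proof.
apply/matrixP => i j; rewrite !mxE (bigD1 (widen_ord nB i)) //= !mxE eqxx mul1r big1 ?addr0 => [|r /negbTE nr].
  by rewrite -val_eqE /= val_eqE.
by rewrite !mxE nr mul0r.
Qed.

Lemma corner_incl_proj : corner_incl^T *m corner_incl = diag_mx (\row_r (r < n)%N%:R).
Proof.
apply/matrixP => r s; rewrite !mxE; case: (ltnP r n) => rn; last first.
  rewrite big1 ?mul0rn // => i _; rewrite !mxE (_ : r == _ = false) ?mul0r //.
  by apply: negbTE; rewrite -val_eqE /= neq_ltn (leq_trans (ltn_ord i) rn) orbT.
rewrite (bigD1 (Ordinal rn)) //= big1 ?addr0 => [|i ni].
  rewrite !mxE; have e : widen_ord nB (Ordinal rn) = r by apply: val_inj.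
  by rewrite !e eqxx mul1r eq_sym.
rewrite !mxE (_ : r == _ = false) ?mul0r //; apply: negbTE; apply: contra ni => /eqP e.
by apply/eqP/val_inj; rewrite /= e.
Qed.

Lemma corner_mxE A : corner_mx A = corner_incl *m A *m corner_incl^T.
Proof.
apply/matrixP => i j; rewrite !mxE (bigD1 (widen_ord nB j)) //= !mxE eqxx mulr1 (bigD1 (widen_ord nB i)) //= !mxE eqxx mul1r.
rewrite !big1 ?addr0 // => [s /negbTE ns|s /negbTE ns]; last by rewrite mxE ns mul0r.
by rewrite [X in _ * X]mxE [X in _ * X]mxE ns mulr0.
Qed.

Lemma truncate_mxE A : truncate_mx A = corner_incl^T *m corner_mx A *m corner_incl.
Proof.
rewrite corner_mxE !mulmxA corner_incl_proj -mulmxA corner_incl_proj mul_diag_mx mul_mx_diag.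
apply/matrixP => r s; rewrite !mxE.
by case: (r < n)%N; case: (s < n)%N; rewrite /= ?mul1r ?mulr1 ?mul0r ?mulr0.
Qed.

Lemma minor_sum_incl (E : 'M[R]_n) : minor_sum (corner_incl^T *m E *m corner_incl) n = \det E *+ n`!.
Proof.
transitivity (\det E * (\det (corner_incl *m corner_incl^T) *+ n`!)); last first.
  by rewrite corner_inclK det1 mulrnAr mulr1.
rewrite cauchy_binet /minor_sum mulr_sumr; apply: eq_bigr => f _.
have -> : minor (corner_incl^T *m E *m corner_incl) f f =
    \det ((\matrix_(i, j) corner_incl^T (f i) j) *m E *m (\matrix_(i, j) corner_incl i (f j))).
  rewrite /minor; congr (\det _); apply/matrixP => i j; rewrite !mxE; apply: eq_bigr => l _.
  rewrite [X in _ = _ * X]mxE; congr (_ * _); rewrite [LHS]mxE [RHS]mxE; apply: eq_bigr => m _.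
  by rewrite [X in _ = X * _]mxE.
by rewrite !det_mulmx; ring.
Qed.

Lemma prod_truncate (A : nat -> 'M[R]_B) m :
  minor_sum (\prod_(i < m.+1) truncate_mx (A i)) n = (\prod_(i < m.+1) \det (corner_mx (A i))) *+ n`!.
Proof.
have [E [-> <-]] : exists E, \prod_(i < m.+1) truncate_mx (A i) = corner_incl^T *m E *m corner_incl /\
    \det E = \prod_(i < m.+1) \det (corner_mx (A i)); last exact: minor_sum_incl.
elim: m => [|m [E [IH1 IH2]]].
  by exists (corner_mx (A 0%N)); rewrite !big_ord1 truncate_mxE.
exists (E *m corner_mx (A m.+1)); split; last by rewrite det_mulmx IH2 [RHS]big_ord_recr.
rewrite big_ord_recr /= IH1 truncate_mxE -[_ * _]/(_ *m _) -!mulmxA; congr (_ *m (_ *m _)).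
by rewrite !mulmxA corner_inclK mul1mx.
Qed.

End Corner.

(** * Valuation of the minor sum along closed paths *)

Section NewtonBound.
Variables (C : closedFieldType) (v : C -> \bar rat).
Hypothesis hv : is_valuation v.
Variables (B m c d a b : nat) (A : nat -> 'M[C]_B) (w lam : rat).
Let n := (a + b)%N.
Hypotheses (d0 : (0 < d)%N) (w0 : 0 < w) (nB : (n <= B)%N).
Hypotheses (ab : (2 * a + b <= d + 1)%N) (hb : b = 0%N \/ (2 * a + b = d + 1)%N) (nd : (n <= d)%N).
Hypothesis hA : forall l (r s : 'I_B), (l <= m)%N ->
  vge v (((c * s)%:R - ((r + s) %/ d)%:R) * w) (A l r s).
(* lam is the loss of valuation allowed per unit of excess.  A closed path of length one
   has an even total excess, which gives a better constant when h = 1. *)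
Hypothesis lam_bound : forall x : nat, (0 < x)%N -> (m = 0%N -> ~~ odd x) ->
  ((a * (a - 1))%N + x)%:R <= d%:R * lam * x%:R.
Hypotheses (lam0 : 0 <= lam) (lam_le : 2 * lam <= c%:R).

Definition excess (f : 'I_n -> 'I_B) : nat := (\sum_i (f i : nat) - \sum_(i < n) i)%N.
Let T : nat := (\sum_(i < n) i)%N.
Let E0 : rat := (c * T)%:R - b%:R.

Let twoT : (2 * T = n * (n - 1))%N.
Proof. exact: (inj_small_sum_eq (f := fun i : 'I_n => nat_of_ord i) (@val_inj _ _ _) (fun i => ltn_ord i)). Qed.

Lemma excessE (f : 'I_n -> 'I_B) : injective f -> (\sum_i (f i : nat) = T + excess f)%N.
Proof.
move=> hf; rewrite /excess subnKC //.
have [h _] := inj_sum_min (f := fun i => nat_of_ord (f i)) (inj_comp (@ord_inj _) hf).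
by rewrite -(leq_pmul2l (isT : (0 < 2)%N)) -/T twoT.
Qed.

Lemma excess0 (f : 'I_n -> 'I_B) : injective f -> excess f = 0%N -> forall i, (f i < n)%N.
Proof.
move=> hf e; have [_ h] := inj_sum_min (f := fun i => nat_of_ord (f i)) (inj_comp (@ord_inj _) hf).
by apply: h; rewrite (excessE hf) e addn0 -twoT.
Qed.

(** With total excess 0 all indices are below n and [floor_sum_small] applies. With total excess x >
    0, d times the sum of the floors is at most 2 T + x = d b + a (a - 1) + x, and [lam_bound]
    absorbs the surplus. *)
Lemma floor_sum_bound (f g : 'I_n -> 'I_B) : injective f -> injective g ->
  (m = 0%N -> ~~ odd (excess f + excess g)) ->
  (\sum_i ((f i + g i) %/ d))%:R <= b%:R + lam * (excess f + excess g)%:R :> rat.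
Proof.
move=> hf hg hev; case: (posnP (excess f + excess g)) => [/eqP|x0].
  rewrite addn_eq0 => /andP[/eqP ef /eqP eg]; rewrite ef eg mulr0 addr0 ler_nat.
  apply: (floor_sum_small d0 (erefl n) ab hb nd (f := fun i => nat_of_ord (f i)) (g := fun i => nat_of_ord (g i))) => //.
  - exact: inj_comp (@ord_inj _) hf.
  - exact: inj_comp (@ord_inj _) hg.
  - exact: excess0.
  - exact: excess0.
have h1 := floor_sum_le d (fun i => nat_of_ord (f i)) (fun i => nat_of_ord (g i)).
rewrite (excessE hf) (excessE hg) in h1; have h2 := lam_bound x0 hev.
have h3 := triangle_defect d0 (erefl n) ab hb nd.
set S := (\sum_i ((f i + g i) %/ d))%N in h1 *; set x := (excess f + excess g)%N in x0 h2 *.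
have h4 : (d * S <= d * b + (a * (a - 1) + x))%N.
  by apply: leq_trans h1 _; rewrite /x; move: twoT; rewrite h3; lia.
rewrite -(ler_pM2l (_ : 0 < d%:R)) ?ltr0n // mulrDr mulrA -!natrM.
by apply: le_trans (_ : (d * b + (a * (a - 1) + x))%:R <= _); rewrite ?ler_nat // natrD lerD2l.
Qed.

Lemma minor_vge l (f g : {ffun 'I_n -> 'I_B}) : (l <= m)%N -> injective f -> injective g ->
  (m = 0%N -> ~~ odd (excess f + excess g)) ->
  vge v ((E0 + c%:R * (excess g)%:R - lam * (excess f + excess g)%:R) * w) (minor (A l) f g).
Proof.
move=> lm hf hg hev; rewrite /minor; apply: (vge_sum hv) => s _.
apply: (vgeMl hv); first by apply: (vge0X hv); rewrite (vgeN hv) (vge01 hv).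
under eq_bigr do rewrite mxE.
have hgs : injective (fun i => g (s i)) by move=> i j /hg /perm_inj.
have exs : excess (fun i => g (s i)) = excess g.
  by rewrite /excess; congr (_ - _)%N; rewrite [RHS](reindex_inj (@perm_inj _ s)).
have := @floor_sum_bound f (fun i => g (s i)) hf hgs; rewrite exs => /(_ hev) bd.
have H : vge v (\sum_i ((c * g (s i))%:R - ((f i + g (s i)) %/ d)%:R) * w) (\prod_i A l (f i) (g (s i))).
  by apply: (vge_prod hv) => i _; apply: hA.
apply: (vge_le _ H) => {H}.
rewrite -mulr_suml ler_pM2r // sumrB -!natr_sum -big_distrr /= (excessE hgs) exs.
rewrite mulnDr natrD /E0 -natrM; move: bd; rewrite natrM; lra.
Qed.

Lemma minor_noninj (M : 'M[C]_B) (f g : {ffun 'I_n -> 'I_B}) :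
  ~~ injectiveb f \/ ~~ injectiveb g -> minor M f g = 0.
Proof.
case=> /injectivePn[i [j ij e]]; rewrite /minor.
  by apply: (determinant_alternate ij) => k; rewrite !mxE e.
by rewrite -det_tr; apply: (determinant_alternate ij) => k; rewrite !mxE e.
Qed.

Let path := {ffun 'I_m.+2 -> 'I_#|{: {ffun 'I_n -> 'I_B}}|}.

Let path_fun (u : path) k : {ffun 'I_n -> 'I_B} := enum_val (u k).

Let path_term (M : nat -> 'M[C]_B) (u : path) : C := \prod_(i < m.+1)
  minor (M i) (path_fun u (widen_ord (leqnSn _) i)) (path_fun u (lift ord0 i)).

(** On a closed path every vertex is once a source and once a target, so its excess counts c for the
    column indices and twice - lam for the floors. *)
Lemma path_term_vge (u : path) : u ord0 = u ord_max -> (forall k, injectiveb (path_fun u k)) ->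
  vge v ((m.+1%:R * E0 + (c%:R - 2 * lam) * (\sum_(i < m.+1) excess (path_fun u (lift ord0 i)))%:R) * w) (path_term A u).
Proof.
move=> ue ui; pose G k := (excess (path_fun u k))%:R : rat.
have H : vge v (\sum_(i < m.+1) (E0 + c%:R * G (lift ord0 i) - lam * (G (widen_ord (leqnSn _) i) + G (lift ord0 i))) * w) (path_term A u).
  apply: (vge_prod hv) => i _; rewrite /G -natrD; apply: minor_vge.
  - by rewrite -ltnS.
  - exact/injectiveP/ui.
  - exact/injectiveP/ui.
  move=> m0; have -> : path_fun u (widen_ord (leqnSn m.+1) i) = path_fun u (lift ord0 i).
    have i0 : nat_of_ord i = 0%N by have := ltn_ord i; lia.
    rewrite /path_fun; congr (enum_val _).
    have -> : widen_ord (leqnSn m.+1) i = ord0 by apply: val_inj; rewrite /= i0.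
    by rewrite ue; congr (u _); apply: val_inj; rewrite /= /bump leq0n i0 m0.
  by rewrite addnn odd_double.
have Gs : \sum_(i < m.+1) G (widen_ord (leqnSn _) i) = \sum_(i < m.+1) G (lift ord0 i).
  apply: (addIr (G ord_max)); transitivity (\sum_(k < m.+2) G k); first by rewrite [RHS]big_ord_recr.
  by rewrite big_ord_recl /= [RHS]addrC; congr (_ + _); rewrite /G /path_fun ue.
apply: (vge_le _ H); rewrite -mulr_suml ler_pM2r //.
have -> : \sum_(i < m.+1) (E0 + c%:R * G (lift ord0 i) - lam * (G (widen_ord (leqnSn _) i) + G (lift ord0 i))) =
    \sum_(i < m.+1) (E0 + (c%:R - lam) * G (lift ord0 i) - lam * G (widen_ord (leqnSn _) i)).
  by apply: eq_bigr => i _; ring.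
rewrite sumrB big_split /= -!mulr_sumr Gs sumr_const card_ord -[E0 *+ _]mulr_natl natr_sum.
rewrite -[X in _ <= _ + _ * X - _]/(\sum_(i < m.+1) (excess (path_fun u (lift ord0 i)))%:R).
by set S := \sum_i _; lra.
Qed.

Lemma path_term_noninj M (u : path) k : u ord0 = u ord_max -> ~~ injectiveb (path_fun u k) -> path_term M u = 0.
Proof.
move=> ue; case: (unliftP ord0 k) => [i ->|->] h; last first.
  by rewrite /path_term big_ord_recl /= minor_noninj ?mul0r //; left; apply: contra h => /injectiveP h2; apply/injectiveP; have -> : ord0 = widen_ord (leqnSn m.+1) ord0 by apply: val_inj.
by rewrite /path_term (bigD1 i) //= minor_noninj ?mul0r //; right.
Qed.

Lemma minor_truncate (M : 'M[C]_B) (f g : {ffun 'I_n -> 'I_B}) : (forall i, (f i < n)%N) -> (forall i, (g i < n)%N) ->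
  minor (truncate_mx n M) f g = minor M f g.
Proof. by move=> hf hg; rewrite /minor; congr (\det _); apply/matrixP => i j; rewrite !mxE hf hg. Qed.

Lemma minor_truncate0 (M : 'M[C]_B) (f g : {ffun 'I_n -> 'I_B}) i : ~~ (g i < n)%N -> minor (truncate_mx n M) f g = 0.
Proof.
move=> h; rewrite /minor -det_tr (expand_det_row _ i) big1 // => j _.
by rewrite !mxE (negbTE h) andbF mul0r.
Qed.

Hypothesis main_det : forall l, (l <= m)%N ->
  \det (corner_mx nB (A l)) != 0 /\ nu v (\det (corner_mx nB (A l))) = E0 * w.
Hypothesis fact_unit : (n`!)%:R != 0 :> C /\ nu v (n`!)%:R = 0.

Lemma main_term_nu : (\prod_(i < m.+1) \det (corner_mx nB (A i))) *+ n`! * (n`!)%:R ^+ m != 0 /\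
  nu v ((\prod_(i < m.+1) \det (corner_mx nB (A i))) *+ n`! * (n`!)%:R ^+ m) = m.+1%:R * E0 * w.
Proof.
have [f0 f1] := fact_unit.
have [P0 P1] : \prod_(i < m.+1) \det (corner_mx nB (A i)) != 0 /\
    nu v (\prod_(i < m.+1) \det (corner_mx nB (A i))) = m.+1%:R * E0 * w.
  have : forall l, (l <= m.+1)%N -> \prod_(i < l) \det (corner_mx nB (A i)) != 0 /\
    nu v (\prod_(i < l) \det (corner_mx nB (A i))) = l%:R * E0 * w; last by apply.
  elim=> [|l IH] lm; first by rewrite big_ord0 oner_neq0 (nu1 hv) !mul0r.
  have [I1 I2] := IH (ltnW lm); have [D1 D2] := main_det lm.
  rewrite big_ord_recr /= mulf_neq0 // (nuM hv) // I2 D2; split=> //.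
  by rewrite -natr1; ring.
rewrite -mulr_natr; split; first by rewrite !mulf_neq0 ?expf_neq0.
by rewrite !(nuM hv) ?mulf_neq0 ?expf_neq0 // (nuX hv) f1 mul0rn !addr0.
Qed.

(** Paths of excess 0 give equal terms for the truncated matrices. On the others the truncated term
    vanishes, and the excess yields the gain, strict if 2 lam < c. *)
Lemma path_diff (u : path) : u ord0 = u ord_max ->
  vge v (m.+1%:R * E0 * w) (path_term A u - path_term (fun l => truncate_mx n (A l)) u) /\
  (2 * lam < c%:R -> vgt v (m.+1%:R * E0 * w) (path_term A u - path_term (fun l => truncate_mx n (A l)) u)).
Proof.
move=> ue; case: (boolP [forall k, injectiveb (path_fun u k)]) => [/forallP ui|]; last first.
  by rewrite negb_forall => /existsP[k hk]; rewrite !(path_term_noninj _ ue hk) subr0 (vge0 hv) (vgt0 hv).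
have uE k : exists i : 'I_m.+1, path_fun u k = path_fun u (lift ord0 i).
  case: (unliftP ord0 k) => [i ->|->]; first by exists i.
  by exists ord_max; rewrite /path_fun ue; congr (enum_val (u _)); apply: val_inj; rewrite /= /bump leq0n.
set S := (\sum_(i < m.+1) excess (path_fun u (lift ord0 i)))%N.
case: (posnP S) => S0.
  have lt k i : (path_fun u k i < n)%N.
    have [l ->] := uE k; apply: excess0; first exact/injectiveP/ui.
    by apply/eqP; move/eqP: S0; rewrite /S sum_nat_eq0 => /forallP/(_ l).
  have -> : path_term A u = path_term (fun l => truncate_mx n (A l)) u.
    by apply: eq_bigr => i _; rewrite minor_truncate.
  by rewrite subrr (vge0 hv) (vgt0 hv).
have -> : path_term (fun l => truncate_mx n (A l)) u = 0.
  have [i hi] : exists i : 'I_m.+1, (0 < excess (path_fun u (lift ord0 i)))%N.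
    apply/existsP; apply: contraTT S0; rewrite negb_exists => /forallP h; rewrite lt0n negbK /S sum_nat_eq0.
    by apply/forallP => i; have := h i; rewrite lt0n negbK.
  have [j hj] : exists j, ~~ (path_fun u (lift ord0 i) j < n)%N.
    apply/existsP; apply: contraTT hi; rewrite negb_exists => /forallP h.
    have h' j : (path_fun u (lift ord0 i) j < n)%N by have := h j; rewrite negbK.
    have inj : injective (path_fun u (lift ord0 i)) by exact/injectiveP/ui.
    have := inj_small_sum_eq (f := fun j => nat_of_ord (path_fun u (lift ord0 i) j)) (inj_comp (@ord_inj _) inj) h'.
    by rewrite (excessE inj) -twoT; lia.
  by rewrite /path_term (bigD1 i) //= (minor_truncate0 _ _ hj) mul0r.
have H := path_term_vge ue ui; rewrite -/S in H; rewrite subr0; split.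
  by apply: (vge_le _ H); rewrite ler_pM2r // lerDl mulr_ge0 // subr_ge0.
move=> lt; apply: (vge_lt _ H); rewrite ltr_pM2r // ltrDl mulr_gt0 ?subr_gt0 ?ltr0n //.
Qed.

Lemma minor_sum_prod_nu :
  vge v (m.+1%:R * E0 * w) (minor_sum (\prod_(i < m.+1) A i) n) /\
  (2 * lam < c%:R -> minor_sum (\prod_(i < m.+1) A i) n != 0 /\
    nu v (minor_sum (\prod_(i < m.+1) A i) n) = m.+1%:R * E0 * w).
Proof.
set X := minor_sum _ n; have [f0 f1] := fact_unit; have [M0 M1] := main_term_nu.
set Y := _ *+ _ * _ in M0 M1.
have F0 : (n`!)%:R ^+ m != 0 :> C by rewrite expf_neq0.
have F1 : nu v ((n`!)%:R ^+ m) = 0 by rewrite (nuX hv) f1 mul0rn.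
have XE : X * (n`!)%:R ^+ m - Y = \sum_(u : path | u ord0 == u ord_max)
    (path_term A u - path_term (fun l => truncate_mx n (A l)) u).
  have XA : X *+ n`! ^ m = \sum_(u : path | u ord0 == u ord_max) path_term A u by exact: minor_sum_prod.
  have YA : minor_sum (\prod_(i < m.+1) truncate_mx n (A i)) n *+ n`! ^ m =
    \sum_(u : path | u ord0 == u ord_max) path_term (fun l => truncate_mx n (A l)) u by exact: minor_sum_prod.
  by rewrite sumrB -XA -YA (prod_truncate nB) -[X *+ _]mulr_natr natrX; congr (_ - _); rewrite -[RHS]mulr_natr natrX.
have XF : X = X * (n`!)%:R ^+ m / (n`!)%:R ^+ m by rewrite mulfK.
split.
  rewrite XF (vge_divl hv) // F1 addr0 -[X * _](subrK Y); apply: (vgeD hv); last by rewrite (vgeE hv) // M1.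
  by rewrite XE; apply: (vge_sum hv) => u /eqP ue; case: (path_diff ue).
move=> lt; have [Z0 Z1] : X * (n`!)%:R ^+ m != 0 /\ nu v (X * (n`!)%:R ^+ m) = nu v Y.
  apply: (nu_close hv M0); rewrite M1 XE; apply: (vgt_sum hv) => u /eqP ue.
  by case: (path_diff ue) => _; apply.
have X0 : X != 0 by apply: contraNneq Z0 => ->; rewrite mul0r.
by split=> //; move: Z1; rewrite (nuM hv) // F1 addr0 M1.
Qed.

End NewtonBound.

(** * Vanishing of the coefficients of degree larger than d *)

Section EulerProduct.
Variables (k : fieldType) (sg : {rmorphism k -> k}).

Definition inv_lin (y : k) : {poly k} := 1 - y *: 'X.
(** Polynomials with constant term 1 are handled through the multiset of their inverse roots; those
    over the fixed field of [sg] correspond to multisets stable under [sg], so no finite extension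
    has to be built. *)
Definition lin_prod (s : seq k) : {poly k} := \prod_(y <- s) inv_lin y.
Definition nz (s : seq k) := all (fun y => y != 0) s.

Lemma lin_prod_cat s t : lin_prod (s ++ t) = lin_prod s * lin_prod t.
Proof. exact: big_cat. Qed.

Lemma lin_prod_coef0 s : (lin_prod s)`_0 = 1.
Proof.
elim: s => [|y s IH]; first by rewrite /lin_prod big_nil coef1.
by rewrite /lin_prod big_cons coef0M -/(lin_prod s) IH coefB coef1 coefZ coefX mulr0 subr0 mulr1.
Qed.

Lemma lin_prod_neq0 s : lin_prod s != 0.
Proof. by apply/eqP => e; have := lin_prod_coef0 s; rewrite e coef0 => /eqP; rewrite eq_sym oner_eq0. Qed.

Lemma root_lin_prod s y : y != 0 -> root (lin_prod s) y^-1 = (y \in s).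
Proof.
move=> y0; elim: s => [|z s IH]; first by rewrite /lin_prod big_nil (negbTE (root1 _)).
rewrite /lin_prod big_cons rootM -/(lin_prod s) IH in_cons; congr (_ || _).
by rewrite rootE !hornerE subr_eq0 -(inj_eq (mulIf y0)) mul1r divfK.
Qed.

Lemma lin_prod_perm s t : nz s -> nz t -> lin_prod s = lin_prod t -> perm_eq s t.
Proof.
elim: s t => [|y s IH] t.
  case: t => // z t _ /= /andP[z0 _] e; have := root_lin_prod (z :: t) z0.
  by rewrite -e /lin_prod big_nil (negbTE (root1 _)) mem_head.
move=> /= /andP[y0 ns] nt e.
have yt : y \in t by rewrite -(root_lin_prod t y0) -e root_lin_prod // mem_head.
have pt := perm_to_rem yt; rewrite perm_sym (perm_trans pt) // perm_cons perm_sym; apply: IH => //.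
  by apply/allP => z /mem_rem; apply: (allP nt).
have y1 : inv_lin y != 0 by have := lin_prod_neq0 [:: y]; rewrite /lin_prod big_seq1.
apply: (mulfI y1); move: e; rewrite /lin_prod big_cons => ->.
by rewrite (perm_big _ pt) big_cons.
Qed.

Lemma size_lin_prod_nz s : nz s -> size (lin_prod s) = (size s).+1.
Proof.
elim: s => [|y s IH]; first by rewrite /lin_prod big_nil size_poly1.
move=> /= /andP[y0 ns]; rewrite /lin_prod big_cons size_mul ?lin_prod_neq0 //; last first.
  by have := lin_prod_neq0 [:: y]; rewrite /lin_prod big_seq1.
rewrite -/(lin_prod s) IH // /inv_lin addrC size_polyDl ?size_polyN ?size_scale ?size_polyX ?size_poly1 //.
Qed.

Lemma map_lin_prod s : map_poly sg (lin_prod s) = lin_prod (map sg s).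
Proof.
rewrite /lin_prod rmorph_prod big_map; apply: eq_bigr => y _.
by rewrite /inv_lin rmorphB rmorph1 /= map_polyZ map_polyX.
Qed.

Hypothesis split_monic : forall P : {poly k}, P \is monic -> exists s, P = \prod_(a <- s) ('X - a%:P).

Lemma lin_prod_split (P : {poly k}) : P`_0 = 1 -> exists2 s, nz s & P = lin_prod s.
Proof.
move=> P0; have Pn : P != 0 by apply: contra_eq_neq P0 => ->; rewrite coef0 eq_sym oner_eq0.
have l0 : lead_coef P != 0 by rewrite lead_coef_eq0.
have [s es] : exists s, (lead_coef P)^-1 *: P = \prod_(a <- s) ('X - a%:P).
  by apply: split_monic; rewrite monicE lead_coefZ mulVf.
have nzs : nz s.
  apply/allP => a ha; apply/eqP => a0.
  have := congr1 (fun R : {poly k} => R.[0]) es; rewrite hornerZ horner_coef0 P0 mulr1 => h.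
  have : root (\prod_(a <- s) ('X - a%:P)) 0 by rewrite root_prod_XsubC -a0.
  by rewrite rootE -h invr_eq0 (negbTE l0).
exists [seq a^-1 | a <- s]; first by apply/allP => _ /mapP[a ha ->]; rewrite invr_eq0 (allP nzs).
have [c ec] : exists c, P = c *: lin_prod [seq a^-1 | a <- s].
  exists (lead_coef P * \prod_(a <- s) (- a)).
  suff E : \prod_(a <- s) ('X - a%:P) = \prod_(a <- s) (- a) *: lin_prod [seq a^-1 | a <- s].
    by rewrite -scalerA -E -es scalerA mulfV // scale1r.
  rewrite /lin_prod big_map; move: nzs {es}; elim: s => [|a s IH] /=; first by rewrite !big_nil scale1r.
  move=> /andP[a0 ns]; rewrite !big_cons IH //.
  have -> : 'X - a%:P = - a *: inv_lin a^-1.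
    by rewrite /inv_lin scalerBr scalerA mulNr mulfV // scaleN1r opprK addrC alg_polyC polyCN.
  by rewrite -scalerAl -scalerAr scalerA.
have := congr1 (fun R : {poly k} => R`_0) ec; rewrite coefZ lin_prod_coef0 P0 mulr1 => e.
by rewrite ec -e scale1r.
Qed.

Definition stable (s : seq k) := perm_eq (map sg s) s.

Lemma stableP s : nz s -> stable s <-> map_poly sg (lin_prod s) = lin_prod s.
Proof.
move=> ns; rewrite map_lin_prod; split=> [h|h]; first exact: perm_big.
apply: lin_prod_perm => //; apply/allP => _ /mapP[y hy ->].
by rewrite fmorph_eq0 (allP ns).
Qed.

Lemma iter_sg_inj i : injective (iter i sg).
Proof. by elim: i => [|i IH] x y //= /fmorph_inj /IH. Qed.

Lemma stable_mem s y i : stable s -> y \in s -> iter i sg y \in s.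
Proof. by move=> st ys; elim: i => [|i IH] //=; rewrite -(perm_mem st) map_f. Qed.

Lemma traject_map y m : traject sg y m = [seq iter i sg y | i <- iota 0 m].
Proof.
apply: (@eq_from_nth _ y); rewrite size_traject ?size_map ?size_iota // => i im.
by rewrite nth_traject // (nth_map 0%N) ?size_iota // nth_iota.
Qed.

Lemma traject_stable y m : iter m sg y = y -> stable (traject sg y m).
Proof.
move=> e; rewrite /stable; case: m e => // m e.
have -> : [seq sg i | i <- traject sg y m.+1] = traject sg (sg y) m.+1.
  by rewrite !traject_map -map_comp; apply: eq_map => i /=; rewrite -iterSr.
by rewrite trajectSr -iterSr e perm_rcons -trajectS.
Qed.

Lemma period_exists (s : seq k) (y : k) : stable s -> y \in s ->
  exists e, [/\ (0 < e)%N, iter e sg y = y, uniq (traject sg y e) & {subset traject sg y e <= s}].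
Proof.
move=> st ys.
have ex : exists e, (0 < e)%N && (iter e sg y == y).
  apply/not_existsP => h; have u : uniq [seq iter i sg y | i <- iota 0 (size s).+1].
    rewrite map_inj_in_uniq ?iota_uniq // => i j _ _.
    wlog le : i j / (i <= j)%N => [W e|].
      by case/orP: (leq_total i j) => l; [apply: W|symmetry; apply: W].
    rewrite -{1}(subnKC le) iterD => /iter_sg_inj /esym e; apply/eqP; rewrite eqn_leq le leqNgt /=.
    by apply/negP => lt; apply: (h (j - i)%N); rewrite subn_gt0 lt e eqxx.
  have := uniq_leq_size u (s2 := s); rewrite size_map size_iota ltnn => h2; apply: notF; apply: h2.
  by move=> _ /mapP[i _ ->]; apply: stable_mem.
case: (ex_minnP ex) => e /andP[e0 /eqP e1] emin; exists e; split=> //.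
  rewrite traject_map map_inj_in_uniq ?iota_uniq // => i j; rewrite !mem_iota !add0n /=.
  wlog le : i j / (i <= j)%N => [W hi hj h|].
    by case/orP: (leq_total i j) => l; [apply: W|symmetry; apply: W].
  move=> _ hj; rewrite -{1}(subnKC le) iterD => /iter_sg_inj /esym h; apply/eqP; rewrite eqn_leq le leqNgt /=.
  apply/negP => lt; have := emin (j - i)%N; rewrite subn_gt0 lt h eqxx => /(_ isT); lia.
by move=> _ /trajectP[i _ ->]; apply: stable_mem.
Qed.

Lemma perm_split_uniq (T : eqType) (u s : seq T) : uniq u -> {subset u <= s} -> exists t, perm_eq s (u ++ t).
Proof.
elim: u s => [|x u IH] s; first by exists s.
move=> /= /andP[xu uu] sub; have xs : x \in s by apply: sub; rewrite mem_head.
suff sub' : {subset u <= rem x s}.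
  by have [t ht] := IH (rem x s) uu sub'; exists t; rewrite (perm_trans (perm_to_rem xs)) // perm_cons.
move=> z zu; have zs : z \in s by apply: sub; rewrite in_cons zu orbT.
by move: zs; rewrite (perm_mem (perm_to_rem xs)) in_cons => /orP[/eqP e|//]; rewrite -e zu in xu.
Qed.

Let M y m := lin_prod (traject sg y m).

Lemma lin_prod_dvdp_mem s y m : y != 0 -> M y m.+1 %| lin_prod s -> y \in s.
Proof.
move=> y0 dv; rewrite -root_lin_prod //; apply: (root_dvdp dv) => //.
by rewrite root_lin_prod // mem_head.
Qed.

(* Stripping the orbit of y off s lowers the multiplicity of y by one and the admissible
   exponents by the period. *)
Lemma count_factors (s : seq k) (y : k) N : nz s -> stable s -> y != 0 -> (size s <= N)%N ->
  (\sum_(i < N) ((iter i.+1 sg y == y) && (M y i.+1 %| lin_prod s)%R))%N = count_mem y s.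
Proof.
elim: {s}(size s).+1 {-2}s (ltnSn (size s)) N => // m IH s sm N ns st y0 sN.
have [ys|yNs] := boolP (y \in s); last first.
  rewrite (count_memPn yNs) big1 // => i _; case: andP => // -[_ dv].
  by rewrite (lin_prod_dvdp_mem y0 dv) in yNs.
have [e [e0 e1 ue sub]] := period_exists st ys.
have [t pt] : exists t : seq k, perm_eq s (traject sg y e ++ t) := perm_split_uniq ue sub.
have szt : size s = (e + size t)%N by rewrite (perm_size pt) size_cat size_traject.
have nt : nz t by apply/allP => z hz; apply: (allP ns); rewrite (perm_mem pt) mem_cat hz orbT.
have stt : stable t.
  rewrite /stable -(perm_cat2l (traject sg y e)).
  have h1 : perm_eq (traject sg y e ++ map sg t) (map sg (traject sg y e) ++ map sg t).
    by rewrite perm_cat2r perm_sym; apply: traject_stable.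
  rewrite (perm_trans h1) // -map_cat (perm_trans _ pt) // (perm_trans _ st) // perm_map // perm_sym //.
have -> : count_mem y s = (1 + count_mem y t)%N.
  have -> : count_mem y s = count_mem y (traject sg y e ++ t) by apply/seq.permP.
  rewrite count_cat count_uniq_mem //; congr (_ + _)%N.
  by case: (e) e0 => // e' _; rewrite mem_head.
have eN : (e <= N)%N by lia.
have ND : N = (e + (N - e))%N by rewrite subnKC.
rewrite ND big_split_ord /=; congr (_ + _)%N.
  case: (e) e0 e1 ue sub {szt ND eN stt} pt => // e' _ e1 ue sub pt; have e2 : sg (iter e' sg y) = y by exact: e1.
  rewrite big_ord_recr /= e2 eqxx /=.
  rewrite (_ : M y e'.+1 %| _); last by rewrite /lin_prod (perm_big _ pt) -/(lin_prod _) lin_prod_cat dvdp_mulr.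
  rewrite big1 // => i _; case: eqP => // ei.
  have := nth_uniq y (i := i.+1) (j := 0) (s := traject sg y e'.+1); rewrite size_traject !nth_traject //= ?ltnS ?ltn_ord //.
  by move=> /(_ isT isT ue); rewrite ei eqxx.
have -> : count_mem y t = (\sum_(i < N - e) ((iter i.+1 sg y == y) && (M y i.+1 %| lin_prod t)%R))%N.
  by rewrite IH //; lia.
apply: eq_bigr => i _; rewrite -addnS addnC iterD e1; congr (nat_of_bool (_ && _)).
have -> : M y (e + i.+1) = lin_prod (traject sg y e) * M y i.+1.
  rewrite -lin_prod_cat /M; congr lin_prod; rewrite !traject_map iotaD map_cat; congr (_ ++ _).
  rewrite add0n -{1}[e]addn0 iotaDl -map_comp; apply: eq_map => j /=.
  by rewrite addnC iterD e1.
have -> : lin_prod s = lin_prod (traject sg y e) * lin_prod t by rewrite -lin_prod_cat; apply: perm_big.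
by rewrite dvdp_mul2l // lin_prod_neq0.
Qed.

Definition power_sum j (s : seq k) := \sum_(y <- s) y ^+ j.

Let log_ser N (y : k) : {poly k} := - \poly_(j < N.+1) (if j == 0%N then 0 else y ^+ j).

Lemma inv_lin_ode N y : ode N (log_ser N y) (inv_lin y).
Proof.
move=> n nN; rewrite coef_eulerD /inv_lin (mulrBr (log_ser N y)) mulr1 -scalerAr !(coefB, coefZ, coefMX, coef1, coefX) /log_ser !coefN !coef_poly.
rewrite ltnS nN; case: n nN => [|[|n]] nN /=; rewrite ?mulr0n ?mulr0 ?subr0 ?oppr0 //.
  by rewrite mulr1 sub0r mulr1n mulr0 subr0 expr1.
by rewrite ltnS (ltnW nN) mul0rn mulrN opprK -exprS addNr.
Qed.

Lemma lin_prod_newton N s j : (j <= N)%N ->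
  (lin_prod s)`_j *+ j = - \sum_(i < j) power_sum i.+1 s * (lin_prod s)`_(j - i.+1).
Proof.
move=> jN; rewrite (ode_rec (ode_prod s (@inv_lin_ode N)) jN) big_ord_recl /= coef_sum big1 ?mul0r ?add0r; last first.
  by move=> y _; rewrite /log_ser coefN coef_poly /= oppr0.
rewrite -sumrN; apply: eq_bigr => i _; rewrite /bump leq0n add1n -mulNr; congr (_ * _).
rewrite coef_sum /power_sum -sumrN; apply: eq_bigr => y _.
by rewrite /log_ser coefN coef_poly /= ltnS (leq_trans (ltn_ord i) jN).
Qed.

(** By Newton's identities the power sums of index below d see only coefficients below d, and the
    coefficient of X^d enters the d-th one linearly, with factor - d. *)
Lemma power_sum_shift d c s t : (0 < d)%N -> lin_prod s = lin_prod t + c *: 'X^d ->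
  (forall j, (0 < j < d)%N -> power_sum j s = power_sum j t) /\
  power_sum d s = power_sum d t - c *+ d.
Proof.
move=> d0 e; have ce j : (j < d)%N -> (lin_prod s)`_j = (lin_prod t)`_j.
  by move=> jd; rewrite e coefD coefZ coefXn (ltn_eqF jd) mulr0 addr0.
have lt j : (0 < j < d)%N -> power_sum j s = power_sum j t.
  elim/ltn_ind: j => j IH /andP[j0 jd].
  case: j IH j0 jd => // j IH _ jd.
  have h1 := lin_prod_newton s (leqnn j.+1); have h2 := lin_prod_newton t (leqnn j.+1).
  move: h1; rewrite ce // h2 !big_ord_recr /= subnn !lin_prod_coef0 !mulr1 => /oppr_inj.
  have -> : \sum_(i < j) power_sum i.+1 s * (lin_prod s)`_(j.+1 - i.+1) =
    \sum_(i < j) power_sum i.+1 t * (lin_prod t)`_(j.+1 - i.+1); last by move/addrI.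
  apply: eq_bigr => i _; rewrite ce; last by apply: leq_ltn_trans jd; apply: leq_subr.
  by rewrite IH ?ltnS //= (leq_trans _ (ltnW jd)) // ltnS.
split=> //; case: d d0 e ce lt => // d _ e ce lt.
have h1 := lin_prod_newton s (leqnn d.+1); have h2 := lin_prod_newton t (leqnn d.+1).
move: h1; rewrite e coefD coefZ coefXn eqxx mulr1 mulrnDl h2 !big_ord_recr /= subnn.
rewrite (_ : (lin_prod t + c *: 'X^(d.+1))`_0 = 1); last by rewrite -e lin_prod_coef0.
rewrite lin_prod_coef0 !mulr1.
have -> : \sum_(i < d) power_sum i.+1 s * (lin_prod t + c *: 'X^(d.+1))`_(d.+1 - i.+1) =
    \sum_(i < d) power_sum i.+1 t * (lin_prod t)`_(d.+1 - i.+1).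
  apply: eq_bigr => i _; rewrite -e ce; last by rewrite subSS ltnS leq_subr.
  by rewrite lt //= ltnS ltn_ord.
set A := \sum_(_ < _) _; rewrite !opprD => h; apply: (addrI A); apply: oppr_inj; rewrite !opprD opprK -h; ring.
Qed.

Variables (C : fieldType) (d : nat) (al : k) (theta : k -> C) (K : seq k).
Hypotheses (d0 : (0 < d)%N) (sal : sg al = al).
Hypothesis thetaD : forall x y, sg x = x -> sg y = y -> theta (x + y) = theta x * theta y.
Hypothesis theta0 : theta 0 = 1.
Hypothesis memK : forall y, (y \in K) = (sg y == y).

Definition fsum (s : seq k) := \sum_(y <- s) (y ^+ d + al * y ^+ (d - 1)).

Lemma fsumE s : fsum s = power_sum d s + al * power_sum (d - 1) s.
Proof. by rewrite /fsum big_split /= -mulr_sumr. Qed.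

Lemma fsum_cat s t : fsum (s ++ t) = fsum s + fsum t.
Proof. exact: big_cat. Qed.

Lemma fsum_stable s : stable s -> sg (fsum s) = fsum s.
Proof.
move=> st; rewrite -{2}/(fsum s) -[RHS](perm_big _ st) big_map rmorph_sum; apply: eq_bigr => y _.
by rewrite rmorphD rmorphM !rmorphXn /= sal.
Qed.

Fixpoint words m : seq (seq k) := if m is m'.+1 then [seq x :: s | x <- K, s <- words m'] else [:: [::]].

Lemma mem_words m s : size s = m -> all (mem K) s -> s \in words m.
Proof.
elim: m s => [|m IH] [|x s] //= [es] /andP[xK sK].
by apply/allpairsP; exists (x, s); split=> //=; apply: IH.
Qed.

(** Normalising the constant term instead of the leading one excludes the root 0, in accordance with
    sums over roots of unity only. *)
Definition euler_polys n : seq {poly k} :=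
  undup [seq P : {poly k} <- [seq Poly s | s <- words n.+1] | [&& P`_0 == 1, size P == n.+1 & map_poly sg P == P]].

Lemma mem_euler_polys n (P : {poly k}) : (P \in euler_polys n) = [&& P`_0 == 1, size P == n.+1 & map_poly sg P == P].
Proof.
rewrite mem_undup mem_filter andb_idr // => /and3P[_ /eqP sP /eqP eP].
apply/mapP; exists (polyseq P); last by rewrite polyseqK.
apply: mem_words => //; apply/allP => x /(nthP 0)[i _ <-].
by rewrite inE memK -coef_map eP.
Qed.

Let roots_ex (P : {poly k}) : exists s, P`_0 = 1 -> nz s /\ P = lin_prod s.
Proof.
have [e|e] := eqVneq P`_0 1; last by exists [::] => h; rewrite h eqxx in e.
by have [s ns es] := lin_prod_split e; exists s.
Qed.

Section Chi.
Variable inv_roots : {poly k} -> seq k.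
Hypothesis inv_rootsP : forall P : {poly k}, P`_0 = 1 -> nz (inv_roots P) /\ P = lin_prod (inv_roots P).

Let chi (P : {poly k}) : C := theta (fsum (inv_roots P)).

Lemma chiE s : nz s -> chi (lin_prod s) = theta (fsum s).
Proof.
move=> ns; have [n1 n2] := inv_rootsP (lin_prod_coef0 s).
by rewrite /chi /fsum (perm_big s) //; apply: lin_prod_perm.
Qed.

Lemma chi_lin_prodM s (P : {poly k}) : nz s -> stable s -> P`_0 = 1 -> map_poly sg P = P ->
  chi (lin_prod s * P) = theta (fsum s) * chi P.
Proof.
move=> ns st P0 eP; have [n1 n2] := inv_rootsP P0.
rewrite {1}n2 -lin_prod_cat chiE; last by rewrite /nz all_cat -/(nz s) ns.
by rewrite fsum_cat thetaD //; apply: fsum_stable => //; apply/(stableP n1); rewrite -n2.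
Qed.

Lemma nz_traject y m : y != 0 -> nz (traject sg y m).
Proof. by move=> y0; apply/allP => _ /trajectP[i _ ->]; elim: i => //= i IH; rewrite fmorph_eq0. Qed.

Lemma euler_polys_dvd y m n : y != 0 -> iter m sg y = y -> (m <= n)%N ->
  perm_eq [seq M y m * P | P <- euler_polys (n - m)] [seq P <- euler_polys n | M y m %| P].
Proof.
move=> y0 ey mn; have nM : M y m != 0 := lin_prod_neq0 _.
have sM : map_poly sg (M y m) = M y m by apply/(stableP (nz_traject m y0))/traject_stable.
have zM : size (M y m) = m.+1 by rewrite size_lin_prod_nz ?size_traject // nz_traject.
apply: uniq_perm; first by rewrite map_inj_uniq ?undup_uniq //; apply: mulfI.
  by rewrite filter_uniq ?undup_uniq.
move=> P; rewrite mem_filter mem_euler_polys; apply/mapP/idP.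
  move=> [P']; rewrite mem_euler_polys => /and3P[/eqP c0 /eqP sz /eqP st] ->.
  rewrite dvdp_mulr ?dvdpp //= coef0M lin_prod_coef0 c0 mul1r eqxx /= rmorphM /= sM st eqxx andbT.
  rewrite size_mul // ?zM ?sz -?size_poly_eq0 ?sz //; apply/eqP; lia.
move=> /andP[dv /and3P[/eqP c0 /eqP sz /eqP st]]; exists (P %/ M y m); last by rewrite mulrC divpK.
have eP : P = P %/ M y m * M y m by rewrite divpK.
have nP : P %/ M y m != 0 by apply/eqP => e; move: eP sz; rewrite e mul0r => ->; rewrite size_poly0.
rewrite mem_euler_polys; apply/and3P; split.
- by have := c0; rewrite {1}eP coef0M lin_prod_coef0 mulr1 => ->.
- by move: sz; rewrite {1}eP size_mul // zM addnS /= => h; rewrite -(addnK m (size _)) h subSn.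
- have h := congr1 (map_poly sg) eP; rewrite rmorphM /= sM st in h.
  by apply/eqP/(mulIf nM); rewrite -h -eP.
Qed.

Variable U : nat -> seq k.
Hypotheses (uU : forall m, uniq (U m.+1)) (memU : forall m y, (y \in U m.+1) = (y != 0) && (iter m.+1 sg y == y)).

Let S m : C := \sum_(y <- U m) theta (fsum (traject sg y m)).
Let c n : C := \sum_(P <- euler_polys n) chi P.

(** By [count_factors] the orbit products of an inverse root y dividing P count the multiplicity of
    y, and the multiplicities add up to n. *)
Lemma factor_count n (P : {poly k}) : P \in euler_polys n -> (\sum_(i < n) \sum_(y <- U i.+1) (M y i.+1 %| P)%R)%N = n.
Proof.
rewrite mem_euler_polys => /and3P[/eqP c0 /eqP sz /eqP st]; have [nt et] := inv_rootsP c0.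
set s := inv_roots P in nt et; rewrite et in st sz *.
have sts : stable s by apply/stableP.
have sn : size s = n by move: sz; rewrite size_lin_prod_nz // => -[].
transitivity (\sum_(y <- undup s) \sum_(i < n) ((iter i.+1 sg y == y) && (M y i.+1 %| lin_prod s)%R))%N.
  rewrite exchange_big; apply: eq_bigr => i _; rewrite -!big_mkcond !sum1_count /=.
  rewrite -!size_filter; apply: perm_size; apply: uniq_perm; rewrite ?filter_uniq ?undup_uniq //.
  move=> y; rewrite !mem_filter memU mem_undup.
  apply/idP/idP => [/andP[dv /andP[y0 ey]]|/andP[/andP[ey dv] ys]].
    by rewrite ey dv /=; apply: lin_prod_dvdp_mem dv.
  by rewrite dv ey (allP nt).
transitivity (\sum_(y <- undup s) count_mem y s)%N.
  rewrite big_seq [RHS]big_seq; apply: eq_bigr => y; rewrite mem_undup => ys.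
  by apply: count_factors => //; rewrite ?sn // (allP nt).
transitivity (\sum_(x <- s) 1)%N; last by rewrite sum1_size.
transitivity (\sum_(x <- s) \sum_(y <- undup s) (x == y))%N.
  rewrite exchange_big; apply: eq_bigr => y _; rewrite -sum1_count big_mkcond.
  by apply: eq_bigr => x _ /=; case: (x == y).
rewrite big_seq [RHS]big_seq; apply: eq_bigr => x xs.
have := count_uniq_mem x (undup_uniq s); rewrite mem_undup xs -sum1_count big_mkcond => /= <-.
by apply: eq_bigr => y _; rewrite eq_sym; case: (y == x).
Qed.

(** Double counting: n copies of P are distributed over its n divisors from [factor_count], and
    multiplicativity of chi splits each divisor off. The outcome is the recursion of the exponential
    series. *)
Lemma euler_recursion n : n%:R * c n = \sum_(i < n) S i.+1 * c (n - i.+1).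
Proof.
transitivity (\sum_(i < n) \sum_(y <- U i.+1) \sum_(P <- euler_polys n | M y i.+1 %| P) chi P).
  rewrite /c mulr_sumr; transitivity (\sum_(P <- euler_polys n) \sum_(i < n) \sum_(y <- U i.+1) (if M y i.+1 %| P then chi P else 0)).
    rewrite big_seq [RHS]big_seq; apply: eq_bigr => P hP; rewrite -{1}(factor_count hP) natr_sum mulr_suml.
    apply: eq_bigr => i _; rewrite natr_sum mulr_suml; apply: eq_bigr => y _.
    by case: ifP; rewrite ?mul1r ?mul0r.
  rewrite exchange_big; apply: eq_bigr => i _; rewrite exchange_big; apply: eq_bigr => y _.
  by rewrite -big_mkcond.
apply: eq_bigr => i _; rewrite /S mulr_suml big_seq [RHS]big_seq; apply: eq_bigr => y.
rewrite memU => /andP[y0 /eqP ey]; rewrite -big_filter -(perm_big _ (euler_polys_dvd y0 ey (ltn_ord i))) big_map.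
rewrite /c mulr_sumr big_seq [RHS]big_seq; apply: eq_bigr => P; rewrite mem_euler_polys => /and3P[/eqP c0 _ /eqP st].
by apply: chi_lin_prodM => //; [apply: nz_traject|apply: traject_stable].
Qed.

(* Adding e X^d permutes the polynomials and changes only the d-th power sum. *)
Lemma euler_vanish e n : sg e = e -> theta (- (e *+ d)) != 1 -> (d < n)%N -> c n = 0.
Proof.
move=> se te dn; have sed : sg (- (e *+ d)) = - (e *+ d) by rewrite rmorphN rmorphMn /= se.
have shift (P : {poly k}) : P \in euler_polys n -> chi (P + e *: 'X^d) = theta (- (e *+ d)) * chi P.
  rewrite mem_euler_polys => /and3P[/eqP c0 /eqP sz /eqP st].
  have c0' : (P + e *: 'X^d)`_0 = 1 by rewrite coefD coefZ coefXn c0; case: (d) d0 => // d' _; rewrite mulr0 addr0.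
  have [n1 e1] := inv_rootsP c0; have [n2 e2] := inv_rootsP c0'.
  have eq : lin_prod (inv_roots (P + e *: 'X^d)) = lin_prod (inv_roots P) + e *: 'X^d by rewrite -e1 -e2.
  have [h1 h2] := power_sum_shift d0 eq.
  have szP : size (P + e *: 'X^d) = size P.
    by rewrite size_polyDl // sz (leq_ltn_trans (size_scale_leq _ _)) // size_polyXn.
  have h3 : power_sum (d - 1) (inv_roots (P + e *: 'X^d)) = power_sum (d - 1) (inv_roots P).
    case: (posnP (d - 1)) => [->|d1]; last by rewrite h1 // d1 /=; lia.
    have szs : size (inv_roots (P + e *: 'X^d)) = size (inv_roots P).
      by apply: succn_inj; rewrite -!size_lin_prod_nz // -e1 -e2.
    have p0 r : power_sum 0 r = (size r)%:R.
      by rewrite /power_sum -sum1_size natr_sum; apply: eq_bigr => y _; rewrite expr0.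
    by rewrite !p0 szs.
  rewrite /chi fsumE h2 h3 (_ : _ - _ + _ = - (e *+ d) + fsum (inv_roots P)); last by rewrite fsumE; ring.
  by rewrite thetaD //; apply: fsum_stable; apply/(stableP n1); rewrite -e1.
have pe : perm_eq [seq P + e *: 'X^d | P <- euler_polys n] (euler_polys n).
  apply: uniq_perm; rewrite ?undup_uniq //.
    by rewrite map_inj_uniq ?undup_uniq //; apply: addIr.
  have stm g (R : {poly k}) : sg g = g -> R \in euler_polys n -> R + g *: 'X^d \in euler_polys n.
    move=> sgg; rewrite !mem_euler_polys => /and3P[/eqP c0 /eqP sz /eqP st]; apply/and3P; split.
    - by rewrite coefD coefZ coefXn c0; case: (d) d0 => // d' _; rewrite mulr0 addr0.
    - by rewrite size_polyDl sz // (leq_ltn_trans (size_scale_leq _ _)) // size_polyXn.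
    - by rewrite rmorphD /= st map_polyZ map_polyXn /= sgg.
  move=> P; apply/mapP/idP => [[P' hP' ->]|hP]; first exact: stm.
  by exists (P - e *: 'X^d); rewrite ?subrK // -scaleNr; apply: stm; rewrite ?rmorphN ?se.
have : c n = theta (- (e *+ d)) * c n.
  rewrite {1}/c -(perm_big _ pe) big_map /c mulr_sumr big_seq [RHS]big_seq.
  by apply: eq_bigr => P; apply: shift.
move=> h; apply/eqP; move/eqP: h; rewrite -subr_eq0 -{1}[c n]mul1r -mulrBl mulf_eq0 subr_eq0 eq_sym.
by rewrite (negbTE te).
Qed.

Lemma euler0 : c 0 = 1.
Proof.
have -> : c 0 = \sum_(P <- [:: 1]) chi P.
  apply: perm_big; apply: uniq_perm; rewrite ?undup_uniq // => P; rewrite mem_euler_polys inE.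
  apply/and3P/eqP => [[/eqP c0 /eqP sz _]|->]; last by split; apply/eqP; rewrite ?coef1 ?size_poly1 ?rmorph1.
  by rewrite (size1_polyC (eq_leq sz)) c0.
rewrite big_seq1; have := chiE (s := [::]) isT; rewrite /lin_prod /fsum !big_nil => ->; exact: theta0.
Qed.

End Chi.

(** The recursion and the constant term identify [cf] with the coefficients of the Euler product, to
    which the vanishing applies. *)
Lemma euler_coef_vanish (U : nat -> seq k) (cf : nat -> C) e n :
  (forall m, m.+1%:R != 0 :> C) ->
  (forall m, uniq (U m.+1)) -> (forall m y, (y \in U m.+1) = (y != 0) && (iter m.+1 sg y == y)) ->
  cf 0%N = 1 ->
  (forall m, m%:R * cf m = \sum_(i < m) (\sum_(y <- U i.+1) theta (fsum (traject sg y i.+1))) * cf (m - i.+1)%N) ->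
  sg e = e -> theta (- (e *+ d)) != 1 -> (d < n)%N -> cf n = 0.
Proof.
move=> ch uU memU c0 rec se te dn.
have [rt hrt] := @choice {poly k} (seq k) (fun P s => P`_0 = 1 -> nz s /\ P = lin_prod s) roots_ex.
have := euler_vanish hrt se te dn.
move=> <-.
elim/ltn_ind: n {dn} => -[|n] IH; first by rewrite c0 (euler0 hrt).
apply: (mulfI (ch n)); rewrite rec (euler_recursion hrt uU memU); apply: eq_bigr => i _.
by rewrite IH // subSS ltnS leq_subr.
Qed.

End EulerProduct.

(** * The exponential sums *)

Lemma sum_ord_prod (V : nmodType) (f : nat -> V) h m :
  \sum_(j < m) \sum_(l < h) f (h * j + l)%N = \sum_(i < h * m) f i.
Proof.
elim: m => [|m IH]; first by rewrite muln0 !big_ord0.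
by rewrite big_ord_recr /= IH mulnS addnC big_split_ord.
Qed.

Section ExponentialSum.
Variables (p h d : nat) (hp : prime p) (hh : (0 < h)%N) (hd : (0 < d)%N).
Variables (C : closedFieldType) (v : C -> \bar rat) (hC : is_Cp v p).
Variables (F : finFieldType) (hF : #|F| = (p ^ h)%N) (red : C -> F).
Hypothesis hred : is_residue_map v (Qunr v h) red.
Variables (Psi : C -> C) (hPsi : is_character v Psi) (hPsip : has_order v Psi p).
Variables (a : F) (ha : a != 0).
Variables (k : fieldType) (rc : C -> k) (hrc : residue_map v rc).

Let hv : is_valuation v. Proof. by case: hC. Qed.
Let vp : v p%:R = 1%E. Proof. by case: hC. Qed.
Let L := Qunr v h.
Let Lf : is_subfield L. Proof. by case: (Qunr_unramified hp hC hh). Qed.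

Let OD x y : integers_of v L x -> integers_of v L y -> integers_of v L (x - y).
Proof. by move=> [Lx hx] [Ly hy]; split; [apply: (sfB Lf)|apply: (vgeB hv)]. Qed.

Let O0 : integers_of v L 0. Proof. by split; [apply: (sf0 Lf)|rewrite /= (v0 hv)]. Qed.
Let O1 : integers_of v L 1. Proof. by split; [apply: (sf1 Lf)|rewrite /= (v1 hv)]. Qed.

Let redB x y : integers_of v L x -> integers_of v L y -> red (x - y) = red x - red y.
Proof.
move=> hx hy; case: hred => _ hadd _ _; have [e _] := hadd _ _ (OD hx hy) hy.
by rewrite subrK in e; rewrite e addrK.
Qed.

Let redX x n : integers_of v L x -> integers_of v L (x ^+ n) /\ red (x ^+ n) = red x ^+ n.
Proof.
move=> hx; case: hred => e1 hadd _ _; elim: n => [|n [I1 I2]]; first by rewrite !expr0.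
have [_ e] := hadd _ _ hx I1; rewrite !exprS e I2; split=> //.
by case: hx I1 => [Lx vx] [Ln vn]; split; [apply: (sfM Lf)|apply: (vge0M hv)].
Qed.

Let red_eq0 x : integers_of v L x -> red x = 0 <-> vgt v 0 x.
Proof. by case: hred => _ _ _ h3 /h3. Qed.

(** Two residue maps meet here: [red] from the integers of L onto F, and [rc] from all integers of C
    onto k. Both detect positive valuation, so a lift of b has a residue in k fixed by the q-th
    power, and its Teichmüller lift lies in L. *)
Lemma teich_exists b : exists x, [/\ integers_of v L x, x ^+ #|F| = x & red x = b].
Proof.
case: (hred) => _ _ hsurj _; have [x hx ex] := hsurj b; have vx : vge v 0 x by case: hx.
have [hxq exq] := redX (p ^ h) hx.
have fx : rc x ^+ (p ^ h) = rc x.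
  apply/eqP; rewrite -(rcX hv hrc) // (rc_eq hv hrc) ?(vge0X hv) //.
  by apply/(red_eq0 (OD hxq hx)); rewrite redB // exq ex -hF expf_card subrr.
have [z ez rz] := teich_surj hp hv vp hrc hh fx; have [vz _] := teich_vge hp hv hh ez.
have hz : integers_of v L z by split=> //; apply: (Qunr_teich hp hC hh ez).
exists z; split=> //; first by rewrite hF.
apply/eqP; rewrite -ex -subr_eq0 -redB //; apply/eqP/(red_eq0 (OD hz hx)).
by rewrite -(rc_eq hv hrc) // rz.
Qed.

Let tm := teichmuller v L red.

Lemma teichmullerP b : [/\ integers_of v L (tm b), tm b ^+ (p ^ h) = tm b & red (tm b) = b].
Proof. by rewrite -hF; apply: (@xgetPex _ 0 (fun x => [/\ integers_of v L x, x ^+ #|F| = x & red x = b])); apply: teich_exists. Qed.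

Lemma teichmuller0 : tm 0 = 0.
Proof.
have [h1 h2 h3] := teichmullerP 0; have [_ vz] := teich_vge hp hv hh h2.
apply/eqP/negPn/negP => z0; move/(red_eq0 h1): h3.
by rewrite (vgtE hv _ z0) vz // ltxx.
Qed.

Lemma teichmuller1 : tm 1 = 1.
Proof.
have [h1 h2 h3] := teichmullerP 1; apply: (teich_inj hp hv vp hrc hh h2); first by rewrite expr1n.
have r1 : red 1 = 1 by case: hred.
apply/eqP; rewrite (rc_eq hv hrc) ?(vge01 hv) //; last by case: h1.
by apply/(red_eq0 (OD h1 O1)); rewrite redB // h3 r1 subrr.
Qed.

Let al := tm a.

Lemma teichmuller_lead : [/\ al ^+ (p ^ h) = al, vge v 0 al & rc al != 0].
Proof.
have [h1 h2 h3] := teichmullerP a; split=> //; first by case: h1.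
rewrite (rc_eq0 hrc); last by case: h1.
by apply/negP => /(red_eq0 h1); rewrite h3; apply/eqP.
Qed.

Lemma teichmuller_polyE : teichmuller_poly v L red ('X^d + a *: 'X^(d.-1)) = 'X^d + al *: 'X^(d.-1).
Proof.
apply/polyP => i; rewrite /teichmuller_poly [in LHS]coef_map_id0; last exact: teichmuller0.
rewrite [in RHS]coefD [in RHS]coefZ !coefXn [in LHS]coefD [in LHS]coefZ !coefXn.
have nd : (d == d.-1) = false by apply/negbTE; rewrite -(prednK hd) /= neq_ltn ltnSn orbT.
have [->|nid] := eqVneq i d; first by rewrite nd !mulr0 !addr0 -/tm teichmuller1.
rewrite add0r add0r; case: eqP => _; rewrite ?mulr1 ?mulr0 //; exact: teichmuller0.
Qed.

(** The trace of the lifted f at x, split into two sums because the conjugation is a p-power map on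
    each Teichmüller term but not on their sum. *)
Definition trace_arg m (x : C) : C :=
  \sum_(l < h * m) (x ^+ d) ^+ (p ^ l) + \sum_(l < h * m) (al * x ^+ d.-1) ^+ (p ^ l).

Lemma al_fix m : al ^+ (p ^ (h * m)) = al.
Proof.
have [e _ _] := teichmuller_lead; elim: m => [|m IH]; first by rewrite muln0 expr1.
by rewrite mulnS expnD exprM e.
Qed.

Lemma exp_sumE m w : (0 < m)%N -> (p ^ (h * m) - 1).-primitive_root w ->
  exp_sum v p h (teichmuller_poly v L red ('X^d + a *: 'X^(d.-1))) Psi m =
  \sum_(i < p ^ (h * m) - 1) Psi (trace_arg m (w ^+ i)).
Proof.
move=> m0 hw; have hm : (0 < h * m)%N by rewrite muln_gt0 hh.
pose s := [seq w ^+ i | i <- iota 0 (p ^ (h * m) - 1)].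
have us : uniq s.
  rewrite map_inj_in_uniq ?iota_uniq // => i j; rewrite !mem_iota !add0n => /= hi hj /eqP.
  by rewrite (eq_prim_root_expr hw) !modn_small // => /eqP.
have es : [set` s]%classic = mu_unr v p (h * m).
  apply/seteqP; split=> x /=.
    move=> /mapP[i _ ->]; have e : (w ^+ i) ^+ (p ^ (h * m) - 1) = 1.
      by rewrite exprAC (prim_expr_order hw) expr1n.
    have e2 := unity_teich hp hm e; split=> //; split; first exact: (Qunr_teich hp hC hm e2).
    by case: (teich_vge hp hv hm e2).
  move=> [_ e]; have [i ->] := prim_rootP hw e.
  by apply/mapP; exists (nat_of_ord i); rewrite ?mem_iota ?add0n /=.
rewrite /exp_sum -es -(fsbig_seq _ _ us) big_map -{1}[(p ^ (h * m) - 1)%N]subn0 big_mkord.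
apply: eq_bigr => i _; set x := w ^+ i; congr (Psi _).
have ex : x ^+ (p ^ (h * m)) = x by apply: (unity_teich hp hm); rewrite /x exprAC (prim_expr_order hw) expr1n.
rewrite teichmuller_polyE !hornerE.
have -> : x ^+ d + al * x ^+ d.-1 = \sum_(z <- [:: x ^+ d; al * x ^+ d.-1]) z by rewrite big_cons big_seq1.
rewrite (Qunr_trace hp hC hm); last first.
  by move=> z; rewrite !inE => /orP[] /eqP ->; rewrite ?exprMn exprAC ex ?al_fix.
by under eq_bigr do rewrite big_cons big_seq1; rewrite big_split.
Qed.

Let p1 := prime_gt1 hp.
Let hk := k_natr_eq0 hp hv vp hrc.

Lemma frob_rmorphism n : exists sg : {rmorphism k -> k}, forall y, sg y = y ^+ (p ^ n).
Proof.
have ch := k_pchar hp hv vp hrc; elim: n => [|n [sg IH]].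
  by exists (GRing.RMorphism.clone _ _ idfun _) => y; rewrite expr1.
exists (GRing.RMorphism.clone _ _ (pFrobenius_aut ch \o sg) _) => y /=.
by rewrite IH pFrobenius_autE -exprM -expnSr.
Qed.

Let bn_ex (y : k) : exists b : nat, y ^+ p = y -> y = b%:R.
Proof.
have [e|e] := eqVneq (y ^+ p) y; last by exists 0%N => h'; rewrite h' eqxx in e.
by have [b ->] := prime_field hp hv vp hrc e; exists b.
Qed.

Lemma natr_eq_exp b b' : b%:R = b'%:R :> k -> Psi 1 ^+ b = Psi 1 ^+ b'.
Proof.
wlog le : b b' / (b' <= b)%N => [W e|].
  by case/orP: (leq_total b' b) => l; [apply: W|symmetry; apply: W].
move=> e; have [z1 _] := char_prim hp hv vp hPsi hPsip.
rewrite -(expr_mod b z1) -(expr_mod b' z1); congr (_ ^+ _); apply/eqP.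
by rewrite eqn_mod_dvd // -hk natrB // e subrr.
Qed.

(** * The additive character induced on the residue field *)

Section AdditiveCharacter.
Variable bn : k -> nat.
Hypothesis bnP : forall y, y ^+ p = y -> y = (bn y)%:R.

Let psi y := Psi 1 ^+ bn y.

Lemma psi_nat b : psi b%:R = Psi 1 ^+ b.
Proof.
apply: natr_eq_exp; rewrite -bnP //.
by have [f hf] := frob_rmorphism 1; rewrite -[X in _ ^+ X]expn1 -hf rmorph_nat.
Qed.

Lemma psiD x y : x ^+ p = x -> y ^+ p = y -> psi (x + y) = psi x * psi y.
Proof. by move=> /bnP -> /bnP ->; rewrite -natrD !psi_nat exprD. Qed.

Lemma psi_rc t : Defs.Zp v t -> Psi t = psi (rc t).
Proof.
move=> ht; have [b hb] := Zp_approx hp hv vp 1 ht.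
rewrite (char_close hp hv vp hPsi hPsip ht (Zp_natr hp hv vp b) hb) (char_nat hp hv vp hPsi) -psi_nat; congr psi.
apply/eqP; rewrite -(rc_nat hv hrc) (rc_eq hv hrc) ?(vge_nat hv) //; last by case: ht.
by rewrite (vgt_subC hv); apply: (vge_lt _ hb); rewrite ltr01.
Qed.

Lemma psi_neq1 y : y ^+ p = y -> y != 0 -> psi y != 1.
Proof.
move=> /bnP ->; rewrite psi_nat hk; move: (bn y) => b pb; apply/eqP => e.
have [z1 nz] := char_prim hp hv vp hPsi hPsip.
have [m hm dm] := prim_order_exists (prime_gt0 hp) z1.
case/primeP: hp => _ /(_ m dm) /orP[] /eqP em; rewrite em in hm.
  by move: nz; rewrite -(expr1 (Psi 1)) (prim_expr_order hm) eqxx.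
by move/negP: pb; apply; rewrite (prim_order_dvd hm) e.
Qed.

Let tr y := \sum_(l < h) y ^+ (p ^ l) : k.
Let theta y := psi (tr y).

Lemma trD x y : tr (x + y) = tr x + tr y.
Proof. by rewrite /tr -big_split; apply: eq_bigr => l _; rewrite (k_expD hp hv vp hrc). Qed.

Lemma tr_fix y : y ^+ (p ^ h) = y -> tr y ^+ p = tr y.
Proof.
move=> e; have [f hf] := frob_rmorphism 1; rewrite expn1 in hf.
rewrite -hf rmorph_sum /tr; case: (h) hh e => // h' _ e.
rewrite big_ord_recr big_ord_recl /= addrC; congr (_ + _).
  by rewrite hf -exprM -expnSr e expn0 expr1.
by apply: eq_bigr => l _; rewrite hf -exprM -expnSr.
Qed.

(** The trace is a polynomial of degree p^(h-1), too small to vanish on p^h elements. *)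
Lemma trace_nonzero : exists x, x ^+ (p ^ h) = x /\ tr x != 0.
Proof.
apply/not_existsP => H; have [r [sr ur memr _]] := teich_roots hp hv vp hrc hh.
pose P : {poly k} := \sum_(l < h) 'X^(p ^ l).
have P0 : P != 0.
  apply/eqP => e; have := congr1 (fun R : {poly k} => R`_1) e; rewrite coef0 coef_sum.
  case: (h) hh => // h' _; rewrite big_ord_recl coefXn expn0 eqxx big1 ?addr0 => [/eqP|l _]; first by rewrite oner_eq0.
  rewrite coefXn /= /bump leq0n add1n; case: eqP => // e1.
  by have : (p ^ 0 < p ^ l.+1)%N; [rewrite ltn_exp2l|rewrite expn0 -e1 ltnn].
have ar : all (root P) [seq rc z | z <- r].
  apply/allP => _ /mapP[z hz ->]; rewrite memr in hz; have [vz _] := teich_vge hp hv hh (eqP hz).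
  have fz : rc z ^+ (p ^ h) = rc z by rewrite -(rcX hv hrc) // (eqP hz).
  rewrite rootE horner_sum; under eq_bigr do rewrite hornerXn.
  by apply/negPn/negP => ne; apply: (H (rc z)).
have ur' : uniq [seq rc z | z <- r].
  rewrite map_inj_in_uniq // => z z'; rewrite !memr => /eqP e /eqP e'; exact: (teich_inj hp hv vp hrc hh e e').
have := max_poly_roots P0 ar ur'; rewrite size_map sr => lt.
have : (size P <= p ^ h.-1 + 1)%N.
  apply: leq_trans (size_sum _ _ _) _; apply/bigmax_leqP => l _; rewrite size_polyXn addn1 ltnS leq_exp2l //.
  by have := ltn_ord l; lia.
have : (p ^ h.-1 + 1 <= p ^ h)%N by rewrite addn1 ltn_exp2l //; lia.
by move=> l1 l2; have := leq_trans lt (leq_trans l2 l1); rewrite ltnn.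
Qed.

Lemma trace_argP m x : (0 < m)%N -> x ^+ (p ^ (h * m)) = x ->
  Defs.Zp v (trace_arg m x) /\ rc (trace_arg m x) =
    tr (\sum_(j < m) ((rc x ^+ (p ^ (h * j))) ^+ d + rc al * (rc x ^+ (p ^ (h * j))) ^+ (d - 1))).
Proof.
move=> m0 ex; have hm : (0 < h * m)%N by rewrite muln_gt0 hh.
have [vx _] := teich_vge hp hv hm ex; have [eal val _] := teichmuller_lead.
have e1 : (x ^+ d) ^+ (p ^ (h * m)) = x ^+ d by rewrite exprAC ex.
have e2 : (al * x ^+ d.-1) ^+ (p ^ (h * m)) = al * x ^+ d.-1 by rewrite exprMn exprAC ex al_fix.
have v1' : vge v 0 (x ^+ d) by apply: (vge0X hv).
have v2' : vge v 0 (al * x ^+ d.-1) by apply: (vge0M hv) => //; apply: (vge0X hv).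
have [Z1 Z2] := (teich_trace_Zp hp hv vp hm e1, teich_trace_Zp hp hv vp hm e2).
split; first by rewrite /trace_arg; split; [apply: (sfD (Qp_subfield hp hv vp)); [case: Z1|case: Z2]|apply: (vgeD hv); [case: Z1|case: Z2]].
rewrite /trace_arg -big_split (rc_sum hv hrc) => [|l _]; last by apply: (vgeD hv); apply: (vge0X hv).
have fal j : rc al ^+ (p ^ (h * j)) = rc al.
  elim: j => [|j IH]; first by rewrite muln0 expr1.
  by rewrite mulnS expnD exprM -(rcX hv hrc) // eal.
rewrite /tr; under [RHS]eq_bigr => l _.
  have [sg hsg] := frob_rmorphism l; rewrite -hsg rmorph_sum /=.
  under eq_bigr => j _.
    have -> : (rc x ^+ (p ^ (h * j))) ^+ d + rc al * (rc x ^+ (p ^ (h * j))) ^+ (d - 1) =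
      (rc x ^+ d + rc al * rc x ^+ (d - 1)) ^+ (p ^ (h * j)).
      by rewrite (k_expD hp hv vp hrc) exprMn fal -!exprM ![(_ ^ _ * _)%N]mulnC.
    rewrite hsg -exprM -expnD; over.
  over.
rewrite exchange_big /= (sum_ord_prod (fun i => (rc x ^+ d + rc al * rc x ^+ (d - 1)) ^+ (p ^ i))).
apply: eq_bigr => l _; rewrite (rcD hrc) ?(vge0X hv) // !(rcX hv hrc) // (rcM hrc) ?(vge0X hv) // !(rcX hv hrc) //.
by rewrite (k_expD hp hv vp hrc) subn1.
Qed.

End AdditiveCharacter.

Let Lc := Lstar_coef v p h red ('X^d + a *: 'X^(d.-1)) Psi.
Let S := exp_sum v p h (teichmuller_poly v L red ('X^d + a *: 'X^(d.-1))) Psi.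

Let ch0 : forall n, (0 < n)%N -> n%:R != 0 :> C.
Proof. by move=> n n0; apply: (nat_neq0 hp hv vp n0). Qed.

Lemma Lstar_coef0 : Lc 0 = 1. Proof. exact: exp_series_coef0. Qed.

Lemma Lstar_coef_rec n : n%:R * Lc n = \sum_(i < n) S i.+1 * Lc (n - i.+1).
Proof.
case: n => [|n]; first by rewrite mul0r big_ord0.
rewrite mulr_natl (exp_series_coef_rec ch0).
by apply: eq_bigr => i _; rewrite subSS.
Qed.

Lemma Lstar_coef_vanish n : ~~ (p %| d)%N -> (d < n)%N -> Lc n = 0.
Proof.
move=> pd dn; have [bn bnP] := @choice k nat (fun y b => y ^+ p = y -> y = b%:R) bn_ex.
have [sg hsg] := frob_rmorphism h; have [eal val al0] := teichmuller_lead.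
have itsg m y : iter m sg y = y ^+ (p ^ (h * m)).
  by elim: m => [|m IH]; rewrite ?muln0 ?expr1 //= IH hsg -exprM -expnD mulnS addnC.
have [r [sr ur memr _]] := teich_roots hp hv vp hrc hh.
have [W hW] : exists W : nat -> C, forall m, (p ^ (h * m.+1) - 1).-primitive_root (W m.+1).
  have ex m : exists w : C, (p ^ (h * m.+1) - 1).-primitive_root w.
    by apply: (prim_root_exists hp hC); rewrite muln_gt0 hh.
  have [f hf] := @choice nat C (fun m w => (p ^ (h * m.+1) - 1).-primitive_root w) ex.
  by exists (fun m => f m.-1).
pose U m := [seq rc (W m ^+ i) | i <- iota 0 (p ^ (h * m) - 1)].
have hm m : (0 < h * m.+1)%N by rewrite muln_gt0 hh.
have Wt m i : (W m.+1 ^+ i) ^+ (p ^ (h * m.+1)) = W m.+1 ^+ i.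
  by apply: (unity_teich hp (hm m)); rewrite exprAC (prim_expr_order (hW m)) expr1n.
have d0 : (d%:R : k) != 0 by rewrite hk.
have [x0 [ex0 tx0]] := trace_nonzero.
(* Chosen so that - (e d) is x0, an element of nonzero trace, on which the additive character is not
   1; this needs d to be invertible in k. *)
pose e := - x0 / d%:R.
have ede : - (e *+ d) = x0 by rewrite /e -mulr_natr divfK // opprK.
have nfix b : (b%:R : k) ^+ (p ^ h) = b%:R by rewrite -hsg rmorph_nat.
apply: (@euler_coef_vanish k sg (residue_closed hv hrc) C d (rc al) (fun y => Psi 1 ^+ bn (\sum_(l < h) y ^+ (p ^ l)))
  [seq rc z | z <- r] hd _ _ _ _ U Lc e n) => //.
- by rewrite hsg -(rcX hv hrc) // eal.
- move=> x y; rewrite !hsg => hx hy; rewrite -(psiD bnP) ?tr_fix //; congr (Psi 1 ^+ bn _); exact: trD.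
- rewrite big1 => [|l _]; last by rewrite expr0n expn_eq0 eqn0Ngt prime_gt0.
  by rewrite -[0]/(0%:R) (psi_nat bnP) expr0.
- move=> y; rewrite hsg; apply/mapP/eqP => [[z hz ->]|ey].
    rewrite memr in hz; have [vz _] := teich_vge hp hv hh (eqP hz).
    by rewrite -(rcX hv hrc) // (eqP hz).
  by have [z ez <-] := teich_surj hp hv vp hrc hh ey; exists z; rewrite ?memr ?ez.
- by move=> m; apply: ch0.
- move=> m; rewrite map_inj_in_uniq ?iota_uniq // => i j; rewrite !mem_iota !add0n => /= hi hj eij.
  have := teich_inj hp hv vp hrc (hm m) (Wt m i) (Wt m j) eij => /eqP.
  by rewrite (eq_prim_root_expr (hW m)) !modn_small // => /eqP.
- move=> m y; rewrite itsg; apply/mapP/andP => [[i _ ->]|[y0 /eqP ey]].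
    have [vw nw] := teich_vge hp hv (hm m) (Wt m i).
    have u : (W m.+1 ^+ i) ^+ (p ^ (h * m.+1) - 1) = 1 by rewrite exprAC (prim_expr_order (hW m)) expr1n.
    have w0 : W m.+1 ^+ i != 0.
      apply/eqP => e1; move: u; rewrite e1 expr0n eqn0Ngt (prim_order_gt0 (hW m)) /= => /eqP.
      by rewrite eq_sym oner_eq0.
    rewrite -(rcX hv hrc) // Wt eqxx (rc_eq0 hrc) // (vgtE hv _ w0) nw // ltxx //.
  have [z ez rz] := teich_surj hp hv vp hrc (hm m) ey.
  have z0 : z != 0 by apply: contraNneq y0 => z0; rewrite -rz z0 (rc0 hv hrc).
  have [_ uz] := teich_unity hp (hm m) ez z0; have [i ei] := prim_rootP (hW m) uz.
  by exists (nat_of_ord i); [rewrite mem_iota add0n ltn_ord|rewrite -ei rz].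
- exact: Lstar_coef0.
- move=> m; rewrite Lstar_coef_rec; apply: eq_bigr => i _; congr (_ * _).
  rewrite /S (exp_sumE (ltn0Sn i) (hW i)) big_map -(big_mkord xpredT (fun j => Psi (trace_arg i.+1 (W i.+1 ^+ j)))) /index_iota subn0.
  apply: eq_bigr => j _; have [Z1 Z2] := trace_argP (ltn0Sn i) (Wt i j).
  rewrite (psi_rc bnP Z1) Z2; congr (Psi 1 ^+ bn _); apply: eq_bigr => l _; congr (_ ^+ _).
  rewrite /fsum traject_map big_map -[LHS](big_mkord xpredT (fun t => (rc (W i.+1 ^+ j) ^+ (p ^ (h * t))) ^+ d +
    rc al * (rc (W i.+1 ^+ j) ^+ (p ^ (h * t))) ^+ (d - 1))) /index_iota subn0.
  by apply: eq_bigr => t _; rewrite itsg.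
- by rewrite hsg /e expr_div_n nfix -mulN1r exprMn ex0 -[(-1) ^+ _]hsg rmorphN1.
- rewrite ede; apply: (psi_neq1 bnP) => //; exact: tr_fix.
Qed.

End ExponentialSum.

(** * Valuations of the coefficients of L *)

Lemma ode_poly (C : fieldType) N (f S : nat -> C) :
  (forall n, (n <= N)%N -> n%:R * f n = \sum_(i < n) S i.+1 * f (n - i.+1)%N) ->
  ode N (\poly_(i < N.+1) (if i == 0%N then 0 else S i)) (\poly_(i < N.+1) f i).
Proof.
move=> h n nN; rewrite coef_eulerD coefM big_ord_recl /= !coef_poly !ltnS nN leq0n /= mul0r add0r -mulr_natl h //.
apply: eq_bigr => i _; rewrite /bump leq0n add1n !coef_poly !ltnS /=.
by rewrite (leq_trans (ltn_ord i) nN) (leq_trans (leq_subr _ _) nN).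
Qed.

Lemma double_succ_lt x q : (1 < q -> 2 * x + 1 <= q -> x + 1 < q)%N.
Proof. lia. Qed.

Lemma pred_add_leq x y s t : (x <= s + 1 -> y <= t + 1 -> (x + y).-1 <= s + t + 1)%N.
Proof. lia. Qed.

(** * The quotient of characteristic series *)

Section TraceSeries.
Variables (C : fieldType) (b : nat) (A : 'M[C]_b) (Q : C).
Hypothesis ch0 : forall n, (0 < n)%N -> n%:R != 0 :> C.

(** The coefficient of t^n in det(1 - t A), expressed by principal minors. *)
Definition det_coef n : C := (-1) ^+ n * minor_sum A n / n`!%:R.

Let f0 n : (n`!)%:R != 0 :> C. Proof. by apply: ch0; apply: fact_gt0. Qed.

Lemma det_coef0 : det_coef 0 = 1.
Proof. by rewrite /det_coef expr0 mul1r minor_sum0 fact0 divr1. Qed.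

Lemma det_coef_rec n : n%:R * det_coef n = \sum_(i < n) - \tr (A ^+ i.+1) * det_coef (n - i.+1).
Proof.
case: n => [|n]; first by rewrite mul0r big_ord0.
have -> : n.+1%:R * det_coef n.+1 = (-1) ^+ n.+1 * minor_sum A n.+1 / (n`!)%:R.
  by rewrite /det_coef factS natrM invfM mulrCA mulVKf // ch0.
rewrite minor_sum_newton mulr_sumr mulr_suml; apply: eq_bigr => i _.
have ni : (i <= n)%N by rewrite -ltnS.
rewrite subSS /det_coef -(ffact_fact ni) natrM.
have g : ((n ^_ i)%:R : C) != 0 by apply: ch0; rewrite ffact_gt0.
have -> : (-1) ^+ n.+1 = - ((-1) ^+ (n - i) * (-1) ^+ i) :> C by rewrite -exprD subnK // exprS mulN1r.
have si : (-1) ^+ i * (-1) ^+ i = 1 :> C by rewrite -expr2 sqrr_sign.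
have := f0 (n - i) => h1.
transitivity (- ((-1) ^+ (n - i) * ((-1) ^+ i * (-1) ^+ i)) * \tr (A ^+ i.+1) * minor_sum A (n - i) / ((n - i)`!)%:R).
  by field; rewrite g h1.
by rewrite si; ring.
Qed.

(* exp (\sum_m (Q^m - 1) tr(A^m) t^m / m) * det(1 - Q t A) = det(1 - t A). *)
Lemma trace_series_conv (f : nat -> C) n : f 0%N = 1 ->
  (forall m, m%:R * f m = \sum_(i < m) ((Q ^+ i.+1 - 1) * \tr (A ^+ i.+1)) * f (m - i.+1)%N) ->
  \sum_(j < n.+1) f j * (Q ^+ (n - j) * det_coef (n - j)) = det_coef n.
Proof.
move=> e0 rec.
have o1 := @ode_poly C n f (fun i => (Q ^+ i - 1) * \tr (A ^+ i)) (fun m _ => rec m).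
have o2 := @ode_poly C n det_coef (fun i => - \tr (A ^+ i)) (fun m _ => det_coef_rec m).
have o3 := odeM o1 (ode_scale Q o2); set H2 := \poly_(i < n.+1) (if i == 0%N then 0 else - \tr (A ^+ i)) in o2 o3.
have eH : eqN n (\poly_(i < n.+1) (if i == 0%N then 0 else (Q ^+ i - 1) * \tr (A ^+ i)) + (H2 \Po (Q *: 'X))) H2.
  move=> i ni; rewrite coefD comp_scaleX_coef /H2 !coef_poly ltnS ni.
  by case: eqP => _; [rewrite mulr0 addr0|ring].
have H0 : H2`_0 = 0 by rewrite coef_poly.
have e1 : ((\poly_(i < n.+1) f i) * ((\poly_(i < n.+1) det_coef i) \Po (Q *: 'X)))`_0 = (\poly_(i < n.+1) det_coef i)`_0.
  by rewrite coef0M comp_scaleX_coef !coef_poly /= expr0 !mul1r e0 mul1r.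
have := ode_unique ch0 H0 e1 (ode_eqH eH o3) o2 (leqnn n); rewrite coef_poly ltnSn => <-.
rewrite coefM; apply: eq_bigr => j _; rewrite comp_scaleX_coef !coef_poly ltn_ord ltnS leq_subr //.
Qed.

End TraceSeries.

(** * Transfer of valuations from traces to coefficients *)

Section Comparison.
Variables (C : closedFieldType) (v : C -> \bar rat).
Hypothesis hv : is_valuation v.
Variables (D R h : nat) (E : nat -> rat) (Q : C) (g f t S S' : nat -> C).
Hypotheses (unitD : forall n, (0 < n <= D)%N -> n%:R != 0 :> C /\ nu v n%:R = 0).
Hypotheses (vQ : vge v h%:R Q) (ER : forall n, (n <= D)%N -> E n < R%:R).
Hypothesis Esub : forall j n, (0 < j <= n)%N -> (n <= D)%N -> E n < (h * j)%:R + E j + E (n - j)%N.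
Hypotheses (t0 : t 0%N = 1) (f0 : f 0%N = 1) (g0 : g 0%N = 1).
Hypothesis conv : forall n, \sum_(j < n.+1) f j * (Q ^+ (n - j) * t (n - j)%N) = t n.
Hypothesis tE : forall n, (n <= D)%N -> vge v (E n) (t n).
Hypothesis frec : forall n, n%:R * f n = \sum_(i < n) S' i.+1 * f (n - i.+1)%N.
Hypothesis grec : forall n, n%:R * g n = \sum_(i < n) S i.+1 * g (n - i.+1)%N.
Hypotheses (Sint : forall m, vge v 0 (S m.+1)) (S'int : forall m, vge v 0 (S' m.+1)).
Hypothesis Sclose : forall m, vge v R%:R (S m.+1 - S' m.+1).

(** In [conv] every term with j < n carries the power Q^(n-j); by [Esub] its valuation makes the
    term strictly smaller than E n allows, so f n and t n have the same leading part. *)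
Lemma quotient_coef_bound n : (n <= D)%N -> vge v (E n) (f n) /\ vgt v (E n) (f n - t n).
Proof.
elim/ltn_ind: n => n IH nD.
have h1 : vgt v (E n) (f n - t n).
  have e := conv n; rewrite big_ord_recr /= subnn expr0 t0 !mulr1 in e.
  have -> : f n - t n = - \sum_(i < n) f i * (Q ^+ (n - i) * t (n - i)%N) by rewrite -e; ring.
  rewrite (vgtN hv); apply: (vgt_sum hv) => i _; have ni := ltn_ord i.
  have iD : (i <= D)%N by apply: leq_trans nD; apply: ltnW.
  have [fi _] := IH i ni iD.
  have es := Esub (j := (n - i)%N) (n := n); rewrite subn_gt0 ni leq_subr /= in es.
  have := es isT nD; rewrite subKn ?(ltnW ni) // => lt.
  apply: (@vge_lt _ _ (E i + ((h * (n - i))%:R + E (n - i)%N))); first by lra.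
  apply: (vgeM hv fi); apply: (vgeM hv); last by apply: tE; apply: leq_trans nD; apply: leq_subr.
  by rewrite natrM mulr_natr; apply: (vgeX hv).
split=> //; rewrite -(subrK (t n) (f n)); apply: (vgeD hv); [exact: vgtW|exact: tE].
Qed.

Let div_unit n r x : (0 < n <= D)%N -> vge v r (n%:R * x) -> vge v r x.
Proof.
move=> hn; have [n0 un] := unitD hn; rewrite -{2}(mulKf n0 x) [X in _ -> vge v r X]mulrC (vge_divl hv) // un addr0 //.
Qed.

(** The recursions divide only by n <= D, which is a unit, so closeness of the sums is not lost. *)
Lemma coef_close n : (n <= D)%N -> [/\ vge v 0 (f n), vge v 0 (g n) & vge v R%:R (g n - f n)].
Proof.
elim/ltn_ind: n => -[|n] IH nD; first by rewrite f0 g0 (vge01 hv) subrr (vge0 hv).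
have hn : (0 < n.+1 <= D)%N by [].
have IH' (i : 'I_n.+1) : [/\ vge v 0 (f (n.+1 - i.+1)%N), vge v 0 (g (n.+1 - i.+1)%N) & vge v R%:R (g (n.+1 - i.+1)%N - f (n.+1 - i.+1)%N)].
  by apply: IH; rewrite subSS ?ltnS ?leq_subr // (leq_trans (leq_subr _ _)) // ltnW.
split; apply: (div_unit hn).
- by rewrite frec; apply: (vge_sum hv) => i _; apply: (vge0M hv) => //; case: (IH' i).
- by rewrite grec; apply: (vge_sum hv) => i _; apply: (vge0M hv) => //; case: (IH' i).
rewrite mulrBr frec grec -sumrB; apply: (vge_sum hv) => i _; have [h1 h2 h3] := IH' i.
rewrite (_ : _ - _ = g (n.+1 - i.+1)%N * (S i.+1 - S' i.+1) + S' i.+1 * (g (n.+1 - i.+1)%N - f (n.+1 - i.+1)%N)); last by ring.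
by apply: (vgeD hv); apply: (vgeMl hv).
Qed.

Lemma coef_bound n : (n <= D)%N -> vge v (E n) (g n) /\
  (t n != 0 -> nu v (t n) = E n -> g n != 0 /\ nu v (g n) = E n).
Proof.
move=> nD; have [h1 h2] := quotient_coef_bound nD; have [_ _ h3] := coef_close nD.
have h4 : vgt v (E n) (g n - f n) := vge_lt (ER nD) h3.
have h5 : vgt v (E n) (g n - t n) := vgt_trans hv h4 h2.
split; first by rewrite -(subrK (f n) (g n)); apply: (vgeD hv) => //; exact: vgtW.
by move=> tn en; have := nu_close hv tn (x := g n); rewrite en; apply.
Qed.

End Comparison.

Section DworkTrace.
Variables (p h' d c : nat) (hp : prime p) (hd : (0 < d)%N).
Let h := h'.+1.
Hypotheses (c2 : (1 < c)%N) (pc : (p + 1 = d * c)%N).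
Variables (C : closedFieldType) (v : C -> \bar rat) (hC : is_Cp v p).
Variables (Psi : C -> C) (hPsi : is_character v Psi) (hPsip : has_order v Psi p).
Variables (k : fieldType) (rc : C -> k) (hrc : residue_map v rc).
Variables (R N : nat) (pi al : C).
Hypotheses (pN : (p <= N)%N) (RN : (R * p.-1 <= N)%N).
Hypotheses (hpi : (artin_hasse p C N).[pi] = Psi 1) (npi : nu v pi = (p.-1)%:R^-1).
Hypotheses (alq : al ^+ (p ^ h) = al) (alint : vge v 0 al) (al0 : rc al != 0).

Let hv : is_valuation v. Proof. by case: hC. Qed.
Let vp : v p%:R = 1%E. Proof. by case: hC. Qed.
Let p1 := prime_gt1 hp.
Let AH := artin_hasse p C N.
Let e j := AH`_j.
(** At least the degree of [frob_ser], hence large enough for the degree condition in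
    [dwork_mxM]. *)
Let b := (2 * d * N)%N.

Let eint j : vge v 0 (e j). Proof. exact: Zp_vge (ah_Zp hp hv vp N j). Qed.

Let elow j : (j < p)%N -> rc (e j) = (j`!%:R)^-1.
Proof.
move=> jp; rewrite /e /AH ah_lt ?(leq_trans (ltnW jp)) //.
have f0 : (j`!%:R : k) != 0 by apply: (fact_small (k_natr_eq0 hp hv vp hrc)).
apply: (mulfI f0); rewrite mulfV // -{1}(rc_nat hv hrc) -(rcM hrc) ?(vge_nat hv) //.
  by rewrite mulfV ?(rc1 hrc) //; apply: (nat_neq0 hp hv vp); apply: fact_gt0.
by have := eint j; rewrite /e /AH ah_lt ?(leq_trans (ltnW jp)).
Qed.

(** The coefficient [al] is twisted by the l-th power of Frobenius, so that the substitutions X ->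
    X^(p^l) in the product produce the conjugates of both terms of f; the twist has period h. *)
Definition frob_ser l : {poly C} := dwork_ser N e d pi (al ^+ (p ^ l)).
Definition frob_mx l : 'M[C]_b.+1 := dwork_mx b p (frob_ser l).
Definition frob_prod : 'M[C]_b.+1 := \prod_(l < h) frob_mx l.

Lemma split_ser_size x m : (size (split_ser N e x m) <= m * N + 1)%N.
Proof.
apply: leq_trans (size_sum _ _ _) _; apply/bigmax_leqP => j _.
apply: leq_trans (size_scale_leq _ _) _; rewrite size_polyXn addn1 ltnS leq_mul2l.
by rewrite -ltnS ltn_ord orbT.
Qed.

Lemma split_serE x m z : (split_ser N e x m).[z] = AH.[x * z ^+ m].
Proof.
rewrite [RHS](@horner_coef_wide _ N.+1) ?size_poly // /split_ser horner_sum; apply: eq_bigr => j _.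
by rewrite hornerZ hornerXn exprMn -mulrA -exprM.
Qed.

Lemma frob_ser_size l : (size (frob_ser l) <= (p - 1) * b + 1)%N.
Proof.
apply: leq_trans (size_polyMleq _ _) _.
have h1 := split_ser_size pi d; have h2 := split_ser_size (pi * al ^+ (p ^ l)) (d - 1).
have h3 : ((d - 1) * N <= d * N)%N by rewrite leq_mul2r leq_subr orbT.
have h4 : (b <= (p - 1) * b)%N by rewrite leq_pmull // subn_gt0.
have h5 : (b = d * N + d * N)%N by rewrite /b -mulnA mul2n addnn.
lia.
Qed.

Let alh j : al ^+ (p ^ (h * j)) = al.
Proof. by elim: j => [|j IH]; rewrite ?muln0 ?expr1 // mulnS expnD exprM alq. Qed.

Lemma frob_prod_exp m : frob_prod ^+ m = \prod_(i < h * m) frob_mx i.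
Proof.
elim: m => [|m IH]; first by rewrite muln0 big_ord0.
have E : \prod_(i < h * m.+1) frob_mx i = (\prod_(i < h * m) frob_mx i) * \prod_(l < h) frob_mx (h * m + l)%N.
  by rewrite mulnS addnC big_split_ord.
have -> : frob_prod ^+ m.+1 = frob_prod ^+ m * frob_prod by rewrite exprSr.
rewrite IH E (_ : \prod_(l < h) _ = frob_prod) //; apply: eq_bigr => l _.
by rewrite /frob_mx /frob_ser expnD exprM alh.
Qed.

Let G m := \prod_(i < h * m) (frob_ser i \Po 'X^(p ^ i)).

Lemma frob_trace m w : (0 < m)%N -> (p ^ (h * m) - 1).-primitive_root w ->
  ((p ^ h)%:R ^+ m - 1) * \tr (frob_prod ^+ m) = \sum_(i < p ^ (h * m) - 1) (G m).[w ^+ i].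
Proof.
move=> m0 hw; have hm : (0 < h * m)%N by rewrite muln_gt0.
have q1 : (1 < p ^ (h * m))%N by rewrite -[1%N](exp1n (h * m)) ltn_exp2r.
have -> : (p ^ h)%:R ^+ m - 1 = (p ^ (h * m) - 1)%:R :> C by rewrite natrB ?(ltnW q1) // expnM !natrX.
have sG : (size (G m) <= (p ^ (h * m) - 1) * b + 1)%N.
  rewrite /G; elim: (h * m)%N => [|n IH]; first by rewrite big_ord0 size_poly1 addn1.
  rewrite big_ord_recr /=; apply: leq_trans (size_polyMleq _ _) _.
  have h1 : (size (frob_ser n \Po 'X^(p ^ n)) <= p ^ n * ((p - 1) * b) + 1)%N.
    have := size_comp_poly_leq (frob_ser n) 'X^(p ^ n); rewrite size_polyXn /= => h2; apply: leq_trans h2 _.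
    by rewrite addn1 ltnS mulnC leq_mul2l; apply/orP; right; rewrite -subn1 leq_subLR addnC; apply: frob_ser_size.
  have h2 : ((p ^ n.+1 - 1) * b = (p ^ n - 1) * b + p ^ n * ((p - 1) * b))%N.
    rewrite mulnA -mulnDl; congr (_ * _)%N; rewrite expnS mulnBr muln1 [(p * _)%N]mulnC.
    have : (0 < p ^ n)%N by rewrite expn_gt0 ltnW.
    have : (p ^ n <= p ^ n * p)%N by rewrite leq_pmulr // ltnW.
    lia.
  by rewrite h2; apply: pred_add_leq.
rewrite -(dwork_mx_trace q1 hw sG) frob_prod_exp /G; congr (_ * \tr _).
case: (h * m)%N hm => // n _; apply: dwork_mx_prod; [exact: ltnW|exact: frob_ser_size].
Qed.

Lemma close_mul r (x x' y y' : C) : vge v 0 x' -> vge v 0 y -> vge v r (x - x') -> vge v r (y - y') -> vge v r (x * y - x' * y').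
Proof.
move=> hx hy h1 h2; rewrite (_ : _ - _ = y * (x - x') + x' * (y - y')); last by ring.
by apply: (vgeD hv); apply: (vgeMl hv).
Qed.

Let Psi_int t : Defs.Zp v t -> vge v 0 (Psi t).
Proof. by move=> ht; case: hPsip => _ hP _; case: (unity_vge hv (prime_gt0 hp) (hP t ht)). Qed.

Lemma G_close m x : (0 < m)%N -> x ^+ (p ^ (h * m)) = x ->
  [/\ vge v R%:R ((G m).[x] - Psi (\sum_(l < h * m) (x ^+ d) ^+ (p ^ l) + \sum_(l < h * m) (al * x ^+ d.-1) ^+ (p ^ l))),
    vge v 0 ((G m).[x]) &
    vge v 0 (Psi (\sum_(l < h * m) (x ^+ d) ^+ (p ^ l) + \sum_(l < h * m) (al * x ^+ d.-1) ^+ (p ^ l)))].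
Proof.
move=> m0 ex; have hm : (0 < h * m)%N by rewrite muln_gt0.
have e1 : (x ^+ d) ^+ (p ^ (h * m)) = x ^+ d by rewrite exprAC ex.
have e2 : (al * x ^+ d.-1) ^+ (p ^ (h * m)) = al * x ^+ d.-1 by rewrite exprMn exprAC ex alh.
have Z1 := teich_trace_Zp hp hv vp hm e1; have Z2 := teich_trace_Zp hp hv vp hm e2.
have c1 := splitting_char hp hv vp hPsi hPsip RN hpi npi hm e1.
have c2' := splitting_char hp hv vp hPsi hPsip RN hpi npi hm e2.
have GE : (G m).[x] = (\prod_(i < h * m) AH.[pi * (x ^+ d) ^+ (p ^ i)]) * (\prod_(i < h * m) AH.[pi * (al * x ^+ d.-1) ^+ (p ^ i)]).
  rewrite /G horner_prod -big_split; apply: eq_bigr => i _ /=.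
  rewrite horner_comp hornerXn /frob_ser /dwork_ser hornerM !split_serE; congr (_ * _).
    by rewrite exprAC.
  by rewrite exprMn exprAC subn1 mulrA.
have R0 : 0 <= R%:R :> rat by rewrite ler0n.
have P12 : vge v 0 (Psi (\sum_(l < h * m) (x ^+ d) ^+ (p ^ l))) /\ vge v 0 (Psi (\sum_(l < h * m) (al * x ^+ d.-1) ^+ (p ^ l))).
  by split; apply: Psi_int.
have [P1 P2] := P12.
have i2 : vge v 0 (\prod_(i < h * m) AH.[pi * (al * x ^+ d.-1) ^+ (p ^ i)]).
  rewrite -[X in vge v 0 X](subrK (Psi (\sum_(l < h * m) (al * x ^+ d.-1) ^+ (p ^ l)))).
  by apply: (vgeD hv) => //; apply: vge_le c2'.
have PE : Psi (\sum_(l < h * m) (x ^+ d) ^+ (p ^ l) + \sum_(l < h * m) (al * x ^+ d.-1) ^+ (p ^ l)) =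
  Psi (\sum_(l < h * m) (x ^+ d) ^+ (p ^ l)) * Psi (\sum_(l < h * m) (al * x ^+ d.-1) ^+ (p ^ l)).
  by case: hPsi => _ ->.
have cl : vge v R%:R ((G m).[x] - Psi (\sum_(l < h * m) (x ^+ d) ^+ (p ^ l) + \sum_(l < h * m) (al * x ^+ d.-1) ^+ (p ^ l))).
  by rewrite GE PE; apply: close_mul.
have Pint : vge v 0 (Psi (\sum_(l < h * m) (x ^+ d) ^+ (p ^ l) + \sum_(l < h * m) (al * x ^+ d.-1) ^+ (p ^ l))).
  by rewrite PE; apply: (vge0M hv).
split=> //; rewrite -[X in vge v 0 X](subrK (Psi (\sum_(l < h * m) (x ^+ d) ^+ (p ^ l) + \sum_(l < h * m) (al * x ^+ d.-1) ^+ (p ^ l)))).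
by apply: (vgeD hv) => //; apply: vge_le cl.
Qed.

Lemma trace_close m w : (0 < m)%N -> (p ^ (h * m) - 1).-primitive_root w ->
  let S := \sum_(i < p ^ (h * m) - 1) Psi (\sum_(l < h * m) ((w ^+ i) ^+ d) ^+ (p ^ l) + \sum_(l < h * m) (al * (w ^+ i) ^+ d.-1) ^+ (p ^ l)) in
  let S' := ((p ^ h)%:R ^+ m - 1) * \tr (frob_prod ^+ m) in
  [/\ vge v R%:R (S - S'), vge v 0 S & vge v 0 S'].
Proof.
move=> m0 hw /=; rewrite (frob_trace m0 hw) -sumrB; have hm : (0 < h * m)%N by rewrite muln_gt0.
have ex i : (w ^+ i) ^+ (p ^ (h * m)) = w ^+ i.
  by apply: (unity_teich hp hm); rewrite exprAC (prim_expr_order hw) expr1n.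
split; apply: (vge_sum hv) => i _; have [g1 g2 g3] := G_close m0 (ex i) => //.
by rewrite (vge_subC hv).
Qed.

Section Weights.
Variables n a bb : nat.
Hypotheses (nab : n = (a + bb)%N) (ab : (2 * a + bb <= d + 1)%N) (hb : bb = 0%N \/ (2 * a + bb = d + 1)%N) (nd : (n <= d)%N).
Hypothesis weak : (2 * (a * (a - 1)) + 1 <= p)%N \/ h = 1%N /\ (a * (a - 1) + 1 < p)%N.

Lemma minor_sum_frob :
  vge v (h%:R * ((c * \sum_(i < n) i)%:R - bb%:R) * (p.-1)%:R^-1) (minor_sum frob_prod n) /\
  ((2 * (a * (a - 1)) + 1 < p)%N \/ h = 1%N /\ (a * (a - 1) + 1 < p)%N ->
    minor_sum frob_prod n != 0 /\
    nu v (minor_sum frob_prod n) = h%:R * ((c * \sum_(i < n) i)%:R - bb%:R) * (p.-1)%:R^-1).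
Proof.
have dp : (d < p)%N.
  by have := p1; have := pc; case: (d) hd => [//|[|d']] _; nia.
have w0 : 0 < (p.-1)%:R^-1 :> rat by rewrite invr_gt0 ltr0n; lia.
have nB : (n <= b.+1)%N.
  have N0 : (0 < N)%N by lia.
  have : (d <= d * N)%N by rewrite leq_pmulr.
  by have : (b = d * N + d * N)%N by [rewrite /b -mulnA mul2n addnn]; lia.
have alint' l : vge v 0 (al ^+ (p ^ l)) by apply: (vge0X hv).
have al0' l : rc (al ^+ (p ^ l)) != 0 by rewrite (rcX hv hrc) // expf_neq0.
have ent l (r s : 'I_b.+1) : frob_mx l r s = dwork_entry p N e d pi (al ^+ (p ^ l)) r s by rewrite mxE.
(* The least value permitted by [lam_bound]: the worst case is x = 1, or x = 2 for h = 1, where the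
   excess is even. As d c = p + 1, the condition 2 lam <= c becomes 2 a (a - 1) + 1 <= p, or a (a -
   1) + 1 <= p for h = 1. *)
pose lam : rat := if h == 1%N then ((a * (a - 1) + 2)%:R) / (2 * d%:R) else ((a * (a - 1))%N%:R + 1) / d%:R.
have d0 : (0 : rat) < d%:R by rewrite ltr0n.
have d0' : (d%:R : rat) != 0 by rewrite lt0r_neq0.
have cR : d%:R * c%:R = p%:R + 1 :> rat by rewrite -natrM -pc natrD.
have nf : (n`!)%:R != 0 :> C /\ nu v (n`!)%:R = 0.
  split; first by apply: (nat_neq0 hp hv vp); apply: fact_gt0.
  rewrite (nu_natr hp hv vp) ?fact_gt0 // lognE hp fact_gt0 -(k_natr_eq0 hp hv vp hrc).
  by rewrite (negbTE (fact_small (k_natr_eq0 hp hv vp hrc) (leq_ltn_trans nd dp))).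
subst n.
have := @minor_sum_prod_nu C v hv b.+1 h' c d a bb frob_mx (p.-1)%:R^-1 lam hd w0 nB ab hb nd.
rewrite -/h -/frob_prod => H.
have {H} : _ := H _ _ _ _ _ nf.
rewrite /lam; case: eqP => h1 H.
  have st : (a * (a - 1) + 1 < p)%N by case: weak => [/(double_succ_lt p1)|[]].
  have stR : (a * (a - 1))%:R + 2 <= p%:R :> rat by rewrite -natrD ler_nat addnS.
  have [] := H => //.
  - by move=> l r s lh; rewrite ent; apply: (@entry_vge p C v hp hv k rc N e eint d c hd c2 pc pN pi _ npi (alint' l) (al0' l)).
  - move=> x x0; have -> : h' = 0%N by move: h1; rewrite /h => -[].
    move=> /(_ erefl) xe; have x2 : (2 <= x)%N by case: (x) x0 xe => [|[|]].
    have -> : d%:R * ((a * (a - 1) + 2)%:R / (2 * d%:R)) * x%:R = ((a * (a - 1))%:R + 2) * x%:R / 2 :> rat.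
      by rewrite natrD; field.
    rewrite natrD ler_pdivlMr //; have : 2 <= x%:R :> rat by rewrite ler_nat.
    have : 0 <= (a * (a - 1))%:R :> rat by rewrite ler0n.
    nra.
  - by rewrite divr_ge0 // ?mulr_ge0 ?ler0n.
  - rewrite -(ler_pM2l d0) cR natrD [X in X <= _](_ : _ = (a * (a - 1))%:R + 2); [lra|by field].
  - move=> l lh; have := @main_minor p C v hp hv vp k rc hrc N e eint elow d c hd c2 pc pN pi _ npi (alint' l) (al0' l) a bb ab hb nd.
    by rewrite /= => M; rewrite (_ : corner_mx nB (frob_mx l) = \matrix_(r < a + bb, s < a + bb) dwork_entry p N e d pi (al ^+ (p ^ l)) r s) //; apply/matrixP => r s; rewrite !mxE.
  move=> M1 M2; split; first by rewrite -mulrA in M1 *.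
  move=> _; apply: M2; rewrite -(ltr_pM2l d0) cR natrD [X in X < _](_ : _ = (a * (a - 1))%:R + 2); [lra|by field].
have w1 : (2 * (a * (a - 1)) + 1 <= p)%N by case: weak => // -[].
have wR : 2 * (a * (a - 1))%:R + 1 <= p%:R :> rat by rewrite -natrM natr1 ler_nat -addn1.
have [] := H => //.
- by move=> l r s lh; rewrite ent; apply: (@entry_vge p C v hp hv k rc N e eint d c hd c2 pc pN pi _ npi (alint' l) (al0' l)).
- move=> x x0 _; rewrite mulrCA mulfV // mulr1 natrD; have : 1 <= x%:R :> rat by rewrite ler1n.
  have : 0 <= (a * (a - 1))%:R :> rat by rewrite ler0n.
  nra.
- by rewrite divr_ge0 // addr_ge0.
- rewrite -(ler_pM2l d0) cR [X in X <= _](_ : _ = 2 * (a * (a - 1))%:R + 2); [lra|by field].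
- move=> l lh; have := @main_minor p C v hp hv vp k rc hrc N e eint elow d c hd c2 pc pN pi _ npi (alint' l) (al0' l) a bb ab hb nd.
  by rewrite /= => M; rewrite (_ : corner_mx nB (frob_mx l) = \matrix_(r < a + bb, s < a + bb) dwork_entry p N e d pi (al ^+ (p ^ l)) r s) //; apply/matrixP => r s; rewrite !mxE.
move=> M1 M2; split=> // st; apply: M2.
have st1 : (2 * (a * (a - 1)) + 1 < p)%N by case: st => // -[].
have stR : 2 * (a * (a - 1))%:R + 2 <= p%:R :> rat by rewrite -natrM -natrD ler_nat addnS.
rewrite -(ltr_pM2l d0) cR [X in X < _](_ : _ = 2 * (a * (a - 1))%:R + 2); [lra|by field].
Qed.

End Weights.
End DworkTrace.

(** For n <= d, the number of rows r < n with d - r < n, which is the size of the antitriangular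
    block; truncated subtraction gives 0 while 2 n <= d + 1. *)
Definition deficit d n := (2 * n - (d + 1))%N.
Definition triangular n := (\sum_(i < n) i)%N.

Lemma triangularE n : (2 * triangular n = n * (n - 1))%N.
Proof.
elim: n => [|n IH]; first by rewrite /triangular big_ord0.
rewrite /triangular big_ord_recr /= mulnDr -/(triangular n) IH; case: n {IH} => [|n]; nia.
Qed.

Lemma triangularD j m : (triangular (j + m) = triangular j + triangular m + j * m)%N.
Proof.
apply/eqP; rewrite -(eqn_pmul2l (isT : (0 < 2)%N)) !mulnDr !triangularE; apply/eqP.
case: j => [|j]; first by lia.
case: m => [|m]; first by rewrite addn0; lia.
nia.
Qed.

Lemma deficit_split d n : (n <= d)%N -> let b := deficit d n in let a := (n - b)%N in
  [/\ n = (a + b)%N, (2 * a + b <= d + 1)%N & b = 0%N \/ (2 * a + b = d + 1)%N].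
Proof. rewrite /deficit /=; split; lia. Qed.

(** The condition [Esub] cleared of denominators. With p + 1 = d c and d = j + m + l it compares 2 j
    and the deficits with c j (j + l); the quadratic term suffices for j > 1, and j = 1 is treated
    apart. *)
Lemma weight_gap d c p j m l : d = (j + m + l)%N -> (0 < j)%N -> (p + 1 = d * c)%N -> (1 < c)%N -> (1 < p)%N ->
  (c * (j * m) + deficit d j + deficit d m < j * (p - 1) + deficit d (j + m))%N.
Proof.
move=> ed j0 pc c2 p1; have e : (j * (p - 1) + 2 * j = c * (j * m) + c * (j * (j + l)))%N.
  have : (j * (p - 1 + 2) = j * (d * c))%N by congr (_ * _)%N; lia.
  by rewrite ed; nia.
suff : (deficit d j + deficit d m + 2 * j < c * (j * (j + l)) + deficit d (j + m))%N by lia.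
have [j2|j1] := ltnP 1 j.
  have h1 : (2 * (j * j) <= c * (j * (j + l)))%N.
    by apply: leq_mul => //; rewrite leq_mul2l leq_addr orbT.
  have h2 : (2 * j <= j * j)%N by rewrite leq_mul2r j2 orbT.
  rewrite /deficit; lia.
have -> : j = 1%N by lia.
rewrite mul1n /deficit ed; have [c3|c3] := ltnP 2 c.
  have : (3 * (1 + l) <= c * (1 + l))%N by rewrite leq_mul2r c3 orbT.
  lia.
have ec : c = 2%N by lia.
rewrite ec in pc *; lia.
Qed.

Lemma weight_total d c p n : (n <= d)%N -> (0 < d)%N -> (p + 1 = d * c)%N -> (1 < c)%N -> (1 < p)%N ->
  (c * triangular n < d * (p - 1))%N.
Proof.
move=> nd d0 pc c2 p1; rewrite -(ltn_pmul2l (isT : (0 < 2)%N)) mulnCA triangularE.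
have h1 : (n * (n - 1) <= d * (d - 1))%N by apply: leq_mul => //; lia.
apply: leq_ltn_trans (_ : (p + 1) * (d - 1) < _)%N.
  by rewrite pc [(d * c)%N]mulnC -mulnA leq_mul2l h1 orbT.
have h2 : (2 * d <= p + 1)%N by rewrite pc mulnC leq_mul2l c2 orbT.
case: d d0 h2 {nd h1 pc} => [|[|d]] // _ h2; first by rewrite subnn muln0; lia.
have h3 : (p + 1 <= 2 * (p - 1))%N by lia.
rewrite mulnCA; apply: leq_ltn_trans (leq_mul h3 (leqnn _)) _; rewrite [(2 * _ * _)%N]mulnC.
by rewrite ltn_pmul2r; lia.
Qed.

Section LValuations.
Variables (p h' d c : nat) (hp : prime p) (hd : (0 < d)%N).
Let h := h'.+1.
Hypotheses (c2 : (1 < c)%N) (pc : (p + 1 = d * c)%N).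
Variables (C : closedFieldType) (v : C -> \bar rat) (hC : is_Cp v p).
Variables (F : finFieldType) (hF : #|F| = (p ^ h)%N) (red : C -> F).
Hypothesis hred : is_residue_map v (Qunr v h) red.
Variables (Psi : C -> C) (hPsi : is_character v Psi) (hPsip : has_order v Psi p).
Variables (a : F) (ha : a != 0).

Let hv : is_valuation v. Proof. by case: hC. Qed.
Let vp : v p%:R = 1%E. Proof. by case: hC. Qed.
Let p1 := prime_gt1 hp.
Let Lc := Lstar_coef v p h red ('X^d + a *: 'X^(d.-1)) Psi.

Definition weight n : rat := ((c * triangular n)%:R - (deficit d n)%:R) / (p.-1)%:R.

Let dp : (d < p)%N.
Proof.
have h2 : (2 * d <= p + 1)%N by rewrite pc mulnC leq_mul2l c2 orbT.
by case: d hd h2 => [|[|d2]] // _ h2; lia.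
Qed.

Let P0 : 0 < (p.-1)%:R :> rat. Proof. by rewrite ltr0n; move: p1; case: (p) => [|[|]]. Qed.

Let ch0 : forall n, (0 < n)%N -> n%:R != 0 :> C.
Proof. by move=> n n0; apply: (nat_neq0 hp hv vp n0). Qed.

Lemma weight_sub j n : (0 < j <= n)%N -> (n <= d)%N ->
  h%:R * weight n < (h * j)%:R + h%:R * weight j + h%:R * weight (n - j).
Proof.
move=> /andP[j0 jn] nd; rewrite natrM -mulrDr -mulrDr ltr_pM2l ?ltr0n // -subr_gt0.
have en : n = (j + (n - j))%N by rewrite subnKC.
set m := (n - j)%N in en *; have ed : d = (j + m + (d - n))%N by lia.
have := weight_gap ed j0 pc c2 p1; rewrite -en -(ltr_nat rat) !natrD !natrM subn1 => key.
rewrite /weight [in X in _ - X](_ : triangular n = triangular j + triangular m + j * m)%N; last by rewrite {1}en triangularD.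
have Pn := lt0r_neq0 P0.
rewrite [X in 0 < X](_ : _ = (j%:R * (p.-1)%:R + (deficit d n)%:R - (c%:R * (j%:R * m%:R) + (deficit d j)%:R + (deficit d m)%:R)) / (p.-1)%:R).
  by rewrite divr_gt0 // subr_gt0.
by rewrite !natrM !natrD !natrM; field.
Qed.

Lemma weight_lt n : (n <= d)%N -> h%:R * weight n < (h * d)%:R.
Proof.
move=> nd; rewrite natrM ltr_pM2l ?ltr0n // /weight ltr_pdivrMr //.
have := weight_total nd hd pc c2 p1; rewrite subn1 -(ltr_nat rat) [(d * _)%:R]natrM => h1.
by apply: le_lt_trans h1; rewrite lerBlDr lerDl.
Qed.

Lemma Lstar_coef_zero n : (d < n)%N -> Lc n = 0.
Proof.
have [k [rc hrc]] := residue_map_exists hv.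
by apply: (Lstar_coef_vanish hp (ltn0Sn h') hd hC hF hred hPsi hPsip ha hrc); rewrite gtnNdvd.
Qed.

Let corner n := (n - deficit d n)%N.
Definition sharp n := (2 * (corner n * (corner n - 1)) + 1 < p)%N \/ h = 1%N /\ (corner n * (corner n - 1) + 1 < p)%N.

Hypothesis weak : forall n, (n <= d)%N ->
  (2 * (corner n * (corner n - 1)) + 1 <= p)%N \/ h = 1%N /\ (corner n * (corner n - 1) + 1 < p)%N.

Lemma Lstar_coef_bound n : (n <= d)%N -> vge v (h%:R * weight n) (Lc n) /\
  (sharp n -> Lc n != 0 /\ nu v (Lc n) = h%:R * weight n).
Proof.
move=> nd; have [k [rc hrc]] := residue_map_exists hv; have hk := k_natr_eq0 hp hv vp hrc.
(* R exceeds every weight by [weight_lt], so an error of valuation R leaves the leading terms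
   intact. N is what [splitting_char] requires for this R, and at least p so that no leading term of
   a corner entry is cut off. *)
pose R := (h * d)%N; pose N := maxn p (R * p.-1).
have pN : (p <= N)%N by rewrite leq_maxl.
have RN : (R * p.-1 <= N)%N by rewrite leq_maxr.
have [z1 z2] := char_prim hp hv vp hPsi hPsip.
have [pi hpi npi] := ah_root hp hv vp (leq_trans (prime_gt0 hp) pN) z1 z2.
have [alq alint al0] := teichmuller_lead hp (ltn0Sn h') hC hF hred ha hrc.
set al := teichmuller v (Qunr v h) red a in alq alint al0.
pose A := frob_prod p h' d N pi al.
pose Q : C := (p ^ h)%:R.
pose S' m := (Q ^+ m - 1) * \tr (A ^+ m).
pose f := exp_series_coef S'.
have frec m : m%:R * f m = \sum_(i < m) S' i.+1 * f (m - i.+1)%N.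
  case: m => [|m]; first by rewrite mul0r big_ord0.
  by rewrite mulr_natl (exp_series_coef_rec ch0); apply: eq_bigr => i _; rewrite subSS.
have f0 : f 0%N = 1 by exact: exp_series_coef0.
have conv m : \sum_(j < m.+1) f j * (Q ^+ (m - j) * det_coef A (m - j)) = det_coef A m.
  exact: trace_series_conv.
have unit_nat m : (0 < m)%N -> ~~ (p %| m)%N -> nu v m%:R = 0.
  by move=> m0 pm; rewrite (nu_natr hp hv vp) // lognE hp m0 (negbTE pm).
have tE m : (m <= d)%N -> vge v (h%:R * weight m) (det_coef A m) /\
    (sharp m -> det_coef A m != 0 /\ nu v (det_coef A m) = h%:R * weight m).
  move=> md; have [e1 e2 e3] := deficit_split md.
  have := minor_sum_frob hp hd c2 pc hC hrc pN RN npi alint al0 e1 e2 e3 md (weak md).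
  rewrite -/A -/h -mulrA -/(triangular m) -/(weight m) => -[B1 B2].
  have mf : ~~ (p %| m`!)%N by rewrite -hk; apply: (fact_small hk); exact: leq_ltn_trans dp.
  have f1 : (m`!)%:R != 0 :> C by apply: ch0; apply: fact_gt0.
  have f2 := unit_nat _ (fact_gt0 m) mf.
  have s0 : (-1) ^+ m != 0 :> C by rewrite expf_neq0 // oppr_eq0 oner_eq0.
  have s1 : nu v ((-1) ^+ m) = 0 by rewrite (nuX hv) (nuN hv) (nu1 hv) mul0rn.
  rewrite /det_coef; split.
    by rewrite (vge_divl hv) // f2 addr0; apply: (vgeMl hv _ B1); rewrite (vgeE hv _ s0) s1.
  move=> /B2 [B3 B4]; split; first by rewrite !mulf_neq0 // invr_eq0.
  by rewrite !(nuM hv) ?mulf_neq0 ?invr_eq0 // (nuV hv) s1 f2 B4 subr0 add0r.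
have wex m : exists w : C, (p ^ (h * m.+1) - 1).-primitive_root w by apply: (prim_root_exists hp hC); rewrite muln_gt0.
pose S := exp_sum v p h (teichmuller_poly v (Qunr v h) red ('X^d + a *: 'X^(d.-1))) Psi.
have close m : [/\ vge v R%:R (S m.+1 - S' m.+1), vge v 0 (S m.+1) & vge v 0 (S' m.+1)].
  have [w hw] := wex m; rewrite /S (exp_sumE hp (ltn0Sn h') hd hC hF hred Psi ha hrc (ltn0Sn m) hw).
  exact: (trace_close hp hd c2 pc hC hPsi hPsip pN RN hpi npi alq alint al0 (ltn0Sn m) hw).
have uD m : (0 < m <= d)%N -> m%:R != 0 :> C /\ nu v m%:R = 0.
  move=> /andP[m0 md]; split; first exact: ch0.
  by apply: unit_nat => //; rewrite gtnNdvd //; exact: leq_ltn_trans dp.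
have vQ : vge v h%:R Q.
  by rewrite /Q natrX -[h%:R]/(1 *+ h); apply: (vgeX hv); rewrite (vgeE hv) ?(nu_p vp) //; apply: (p_neq0 hv vp).
have := @coef_bound C v hv d R h (fun m => h%:R * weight m) Q Lc f (det_coef A) S S' uD vQ weight_lt
  weight_sub (det_coef0 A) f0 (exp_series_coef0 _) conv (fun m md => (tE m md).1) frec
  (Lstar_coef_rec h d hp hC red Psi a) (fun m => let: And3 _ x _ := close m in x) (fun m => let: And3 _ _ x := close m in x)
  (fun m => let: And3 x _ _ := close m in x) n nd.
move=> [b1 b2]; split=> // sh; have [t1 t2] := (tE n nd).2 sh; exact: b2.
Qed.

End LValuations.

(** * The Newton polygon *)

Section ConvexPolygon.
Variables (C : closedFieldType) (v : C -> \bar rat) (h d : nat) (L : {poly C}) (E w : nat -> rat).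
Hypotheses (d0 : (0 < d)%N) (sL : size L = d.+1).
Hypothesis Ew : forall i, (i < d)%N -> E i.+1 = E i + w i.
Hypothesis wmon : forall i, w i <= w i.+1.
Hypothesis below : forall i, (i <= d)%N -> L`_i != 0 -> E i <= fine (v L`_i) / h%:R.

Definition on_polygon i := L`_i != 0 /\ fine (v L`_i) / h%:R = E i.
(** A point that is not known to be on the polygon is tolerated between two neighbours that are,
    provided the three heights are aligned. *)
Hypothesis vertices : forall i, (i <= d)%N -> on_polygon i \/
  [/\ (0 < i < d)%N, on_polygon i.-1, on_polygon i.+1 & 2 * E i = E i.-1 + E i.+1].

Lemma slope_mono i j : (i <= j)%N -> w i <= w j.
Proof.
move=> /subnKC <-; elim: (j - i)%N => [|m IH]; first by rewrite addn0.
by rewrite addnS (le_trans IH).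
Qed.

(** Convexity: the line through the k-th point with the slope of the next segment, or of the last
    one at the right end, stays below since the slopes increase. *)
Lemma supporting_line k i : (k <= d)%N -> (i <= d)%N ->
  E k + w (minn k d.-1) * (i%:R - k%:R) <= E i.
Proof.
move=> kd id; case/orP: (leq_total k i) => le.
  rewrite -(subnKC le) natrD addrAC subrr add0r; move: id; rewrite -{1}(subnKC le).
  elim: (i - k)%N => [|m IH] md; first by rewrite addn0 mulr0 addr0.
  have md' : (k + m < d)%N by rewrite -addnS.
  have := IH (ltnW md'); rewrite addnS Ew // -natr1.
  have : w (minn k d.-1) <= w (k + m)%N by apply: slope_mono; rewrite geq_min leq_addr.
  lra.
rewrite -opprB -natrB // mulrN; rewrite -{2}(subKn le); move: (leq_subr i k).
elim: (k - i)%N => [|m IH] mk; first by rewrite subn0 mulr0 subr0.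
have := IH (ltnW mk); have em : (k - m = (k - m.+1).+1)%N by lia.
rewrite em Ew; last by lia.
have : w (k - m.+1)%N <= w (minn k d.-1) by apply: slope_mono; rewrite leq_min; lia.
rewrite -natr1; lra.
Qed.

Lemma hull_above k y : (k <= d)%N -> newton_hull v h L k%:R y -> E k <= y.
Proof.
move=> kd [t [t0 tz t1 tx <-]]; set s := w (minn k d.-1).
have -> : E k = \sum_i t i * (E k + s * ((i : nat)%:R - k%:R)).
  have -> : \sum_i t i * (E k + s * ((i : nat)%:R - k%:R)) = (\sum_i t i) * (E k - s * k%:R) + s * \sum_i t i * (i : nat)%:R.
    rewrite mulr_suml mulr_sumr -big_split; apply: eq_bigr => i _ /=; ring.
  by rewrite t1 tx; ring.
apply: ler_sum => i _; have [e|ne] := eqVneq L`_i 0; first by rewrite tz // !mul0r.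
have id : (i <= d)%N by rewrite -ltnS -sL.
by apply: ler_wpM2l => //; apply: le_trans (supporting_line kd id) (below id ne).
Qed.

Lemma hull_vertex k : (k <= d)%N -> newton_hull v h L k%:R (E k).
Proof.
move=> kd; have ks : (k < size L)%N by rewrite sL.
case: (vertices kd) => [[ne ek]|[/andP[k0 kd'] [n1 e1] [n2 e2] mid]].
  exists (fun i => (i == Ordinal ks)%:R); split.
  - by move=> i; case: eqP.
  - by move=> i; case: eqP => // -> /= e; rewrite e eqxx in ne.
  - by rewrite (bigD1 (Ordinal ks)) //= eqxx big1 ?addr0 // => i /negbTE ->.
  - by rewrite (bigD1 (Ordinal ks)) //= eqxx big1 ?addr0 ?mul1r // => i /negbTE ->; rewrite mul0r.
  - by rewrite (bigD1 (Ordinal ks)) //= eqxx big1 ?addr0 ?mul1r // => i /negbTE ->; rewrite mul0r.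
have k1 : (k.-1 < size L)%N by rewrite sL; lia.
have k2 : (k.+1 < size L)%N by rewrite sL ltnS.
have sum2 (f : nat -> rat) : \sum_(i < size L) (((i == Ordinal k1)%:R + (i == Ordinal k2)%:R) / 2) * f i = (f k.-1 + f k.+1) / 2.
  transitivity ((\sum_(i < size L) (i == Ordinal k1)%:R * f i + \sum_(i < size L) (i == Ordinal k2)%:R * f i) / 2).
    by rewrite -big_split mulr_suml; apply: eq_bigr => i _ /=; ring.
  congr (_ / 2); congr (_ + _).
    by rewrite (bigD1 (Ordinal k1)) //= eqxx big1 ?addr0 ?mul1r // => i /negbTE ->; rewrite mul0r.
  by rewrite (bigD1 (Ordinal k2)) //= eqxx big1 ?addr0 ?mul1r // => i /negbTE ->; rewrite mul0r.
exists (fun i => ((i == Ordinal k1)%:R + (i == Ordinal k2)%:R) / 2); split.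
- by move=> i; rewrite divr_ge0 // addr_ge0 // ler0n.
- move=> i e; case: eqP => [ei|_]; first by rewrite ei /= in e; rewrite e eqxx in n1.
  by case: eqP => [ei|_]; [rewrite ei /= in e; rewrite e eqxx in n2|rewrite addr0 mul0r].
- by have := sum2 (fun=> 1); under eq_bigr do rewrite mulr1; move=> ->; field.
- rewrite (sum2 (fun i => i%:R)); have -> : k%:R = k.-1%:R + 1 :> rat by rewrite natr1 prednK.
  by rewrite -[k.+1]addn1 natrD (_ : k%:R = k.-1%:R + 1); [field|rewrite natr1 prednK].
- by rewrite (sum2 (fun i => fine (v L`_i) / h%:R)) e1 e2 -mid; field.
Qed.

Lemma newton_slopes_convex : newton_slopes v h L [seq w i | i <- iota 0 d].
Proof.
exists E; rewrite sL; split=> [k|] /=.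
  rewrite ltnS => kd; split; [exact: hull_vertex|move=> y; exact: hull_above].
suff -> : [seq w i | i <- iota 0 d] = [seq E k.+1 - E k | k <- iota 0 d] by apply: perm_refl.
by apply/eq_in_map => i; rewrite mem_iota add0n => /= id; rewrite Ew // addrAC subrr add0r.
Qed.

End ConvexPolygon.

(** * Consequences of the bound on p *)

Section Numerics.
Variables p h d c : nat.
Hypotheses (hp : prime p) (hd : (0 < d)%N) (pc : (p + 1 = d * c)%N) (hN : Nbound h d < p%:R).

Lemma Nbound_nat : if h == 1%N then (d * d + 3 < 4 * p)%N else (d * d < 2 * p)%N.
Proof.
move: hN; rewrite /Nbound; case: ifP => _ lt.
  by rewrite -(ltr_nat rat) natrD !natrM; move: lt; rewrite ltr_pdivrMr // expr2; lra.
by rewrite -(ltr_nat rat) !natrM; move: lt; rewrite ltr_pdivrMr // expr2; lra.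
Qed.

(** c = 1 would mean d = p + 1, which is too large for the bound on p. *)
Lemma cofactor_gt1 : (1 < c)%N.
Proof.
have p1 := prime_gt1 hp; case: c pc => [|[|//]]; first by rewrite muln0; lia.
rewrite muln1 => e; exfalso; have := Nbound_nat; rewrite -e; case: ifP => _; nia.
Qed.

(** The left side is (2 a - 1)^2, and 2 a <= d + 1. *)
Lemma corner_square n : (n <= d)%N -> let a := (n - deficit d n)%N in (4 * (a * (a - 1)) + 1 <= d * d)%N.
Proof.
move=> nd /=; set a := (n - deficit d n)%N; have h2 : (2 * a <= d + 1)%N by rewrite /a /deficit; lia.
case: a h2 => [|a] h2; first by rewrite muln0 muln_gt0 hd.
have h3 : (2 * a + 1 <= d)%N by lia.
by apply: leq_trans (leq_mul h3 h3); rewrite subn1 /=; nia.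
Qed.

(** The origin of N(d): 4 a (a - 1) + 1 <= d^2 is combined with d^2 < 2 p, or with d^2 + 3 < 4 p
    when h = 1. *)
Lemma weak_bound n : (n <= d)%N -> let a := (n - deficit d n)%N in
  (2 * (a * (a - 1)) + 1 <= p)%N \/ h = 1%N /\ (a * (a - 1) + 1 < p)%N.
Proof.
move=> nd /=; have := corner_square nd; have := Nbound_nat => /=; set x := (_ * (_ - 1))%N.
by case: eqP => h1; [right|left]; lia.
Qed.

(* Domination is strict except for d = 3, p = 5, h > 1, n = 2, where the point lies on the
   segment joining its neighbours and the weak bound suffices. *)
Lemma sharp_bound n : (n <= d)%N -> let a := (n - deficit d n)%N in
  ((2 * (a * (a - 1)) + 1 < p)%N \/ h = 1%N /\ (a * (a - 1) + 1 < p)%N) \/ [/\ d = 3%N, p = 5%N & n = 2%N].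
Proof.
move=> nd /=; have := corner_square nd; have := Nbound_nat => /=; set a := (n - deficit d n)%N.
set x := (a * (a - 1))%N; case: eqP => h1 H1 H2; first by left; right; lia.
have [lt|ge] := ltnP (2 * x + 1) p; first by left; left.
(* The estimates now leave no room: d^2 = 2 p - 1, that is d^2 + 3 = 2 d c, so d divides 3. *)
right; have p2 := prime_gt1 hp; have e1 : (2 * x + 1 = p)%N by lia.
have e2 : (d * d + 3 = 2 * (d * c))%N by rewrite -pc; lia.
have d3 : (d %| 3)%N by rewrite -(dvdn_addr 3 (dvdn_mulr d (dvdnn d))) e2 mulnCA dvdn_mulr.
have e3 : (d * d = 2 * p - 1)%N by lia.
have dE : d = 1%N \/ d = 3%N.
  have le3 := dvdn_leq (ltn0Sn 2) d3; move: le3 d3 hd; case: (d) => [|[|[|[|q]]]] // _ _ _; by [left|right].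
have [d1|d3'] := dE; first by rewrite d1 in e3; lia.
have p5 : p = 5%N by rewrite d3' in e3; lia.
have x2 : x = 2%N by lia.
split=> //; move: nd x2; rewrite /x /a /deficit d3'.
by case: (n) => [|[|[|[|]]]].
Qed.

End Numerics.

Definition slope_defect d i := (if (2 * i < d)%N then 0 else if (2 * i == d)%N then 1 else 2)%N.

Lemma deficitS d i : (i < d)%N -> deficit d i.+1 = (deficit d i + slope_defect d i)%N.
Proof. rewrite /deficit /slope_defect => lt; case: ltnP => h1; [lia|case: eqP => h2; lia]. Qed.

Definition slope p d c i : rat := ((c * i)%:R - (slope_defect d i)%:R) / (p.-1)%:R.

Lemma weightS p d c i : (i < d)%N -> weight p d c i.+1 = weight p d c i + slope p d c i.
Proof.
move=> id; rewrite /weight /slope deficitS // -mulrDl; congr (_ / _).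
by rewrite /triangular big_ord_recr /= mulnDr !natrD; ring.
Qed.

Lemma slope_nondecreasing p d c i : (1 < c)%N -> slope p d c i <= slope p d c i.+1.
Proof.
move=> c2; rewrite /slope ler_wpM2r ?invr_ge0 ?ler0n // lerBrDr addrAC lerBlDr -!natrD ler_nat.
rewrite mulnS /slope_defect.
by case: ltnP => h1; case: ltnP => h2; try case: eqP => h3; try case: eqP => h4; lia.
Qed.

Lemma expected_slopeE p d c i : (1 < p)%N -> (0 < d)%N -> (p + 1 = d * c)%N ->
  expected_slope p d i = slope p d c i.
Proof.
move=> p1 d0 pc; rewrite /expected_slope /slope /slope_defect.
have pe : p%:R + 1 = d%:R * c%:R :> rat by rewrite -natrM -pc natrD.
have pp : (p.-1)%:R = p%:R - 1 :> rat by rewrite -subn1 natrB // ltnW.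
have dn : (d%:R : rat) != 0 by rewrite pnatr_eq0 -lt0n.
have pn : (p%:R - 1 : rat) != 0 by rewrite -pp pnatr_eq0 -lt0n -ltnS prednK // ltnW.
have -> : (i%:R < d%:R / 2 :> rat) = (2 * i < d)%N by rewrite ltr_pdivlMr // -natrM ltr_nat mulnC.
have -> : (i%:R == d%:R / 2 :> rat) = (2 * i == d)%N.
  have two : (2 : rat) != 0 by [].
  by rewrite -(inj_eq (mulIf two)) divfK // -natrM eqr_nat mulnC.
rewrite pe pp natrM; case: ifP => _; first by field; rewrite pn dn.
by case: ifP => _; field; rewrite pn dn.
Qed.

Lemma cofactor_exists p d : (p%:Z = - 1 %[mod d%:Z])%Z -> exists c, (p + 1 = d * c)%N.
Proof.
move/eqP; rewrite eqz_mod_dvd opprK => h.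
have : (d %| p + 1)%N by move: h; rewrite dvdzE.
by move/dvdnP => [c ->]; exists c; rewrite mulnC.
Qed.

Theorem theorem1p1 (p h d : nat) (hp : prime p) (hh : (0 < h)%N) (hd : (0 < d)%N)
  (C : closedFieldType) (v : C -> \bar rat) (hC : is_Cp v p)
  (F : finFieldType) (hF : #|F| = (p ^ h)%N)
  (red : C -> F) (hred : is_residue_map v (Qunr v h) red)
  (Psi1 : C -> C) (hPsi1 : is_character v Psi1) (hPsi1p : has_order v Psi1 p)
  (a : F) (ha : a != 0)
  (hpd : (p%:Z = - 1 %[mod d%:Z])%Z)
  (hN : Nbound h d < p%:R) :
  exists L : {poly C},
    (forall n : nat,
       L`_n = Lstar_coef v p h red ('X^d + a *: 'X^(d.-1)) Psi1 n) /\
    newton_slopes v h L [seq expected_slope p d i | i <- iota 0 d].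
Proof.
case: h hh hF hred hN => // h _ hF hred hN.
have hv : is_valuation v by case: hC.
have [c pc] := cofactor_exists hpd.
have c2 := cofactor_gt1 hp hd pc hN.
have wk n (nd : (n <= d)%N) := weak_bound hp hd pc hN nd.
have sh n (nd : (n <= d)%N) := sharp_bound hp hd pc hN nd.
set Lc := Lstar_coef _ _ _ _ _ _.
have bd n (nd : (n <= d)%N) := Lstar_coef_bound hp hd c2 pc hC hF hred hPsi1 hPsi1p ha wk nd.
have zero n (nd : (d < n)%N) : Lc n = 0 := Lstar_coef_zero hp hd c2 pc hC hF hred hPsi1 hPsi1p ha nd.
have h0 : (h.+1%:R : rat) != 0 by rewrite pnatr_eq0.
have exact_at n : (n <= d)%N -> ~ [/\ d = 3%N, p = 5%N & n = 2%N] -> Lc n != 0 /\ nu v (Lc n) / h.+1%:R = weight p d c n.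
  move=> nd ne; have [_ H] := bd n nd; case: (sh n nd) => [s|//].
  by have [H1 H2] := H s; split=> //; rewrite H2 mulrC mulKf.
have LE n : (\poly_(i < d.+1) Lc i)`_n = Lc n.
  by rewrite coef_poly ltnS; case: leqP => // /zero.
exists (\poly_(i < d.+1) Lc i); split=> //.
have -> : [seq expected_slope p d i | i <- iota 0 d] = [seq slope p d c i | i <- iota 0 d].
  by apply: eq_map => i; apply: expected_slopeE => //; apply: prime_gt1.
apply: (@newton_slopes_convex C v h.+1 d _ (weight p d c)) => //.
(* The exceptional index is 2 while d = 3, so the coefficient of degree d is always sharp, in
   particular nonzero. *)
- by apply: size_poly_eq; have [] := exact_at d (leqnn d) (fun e => let: And3 e1 _ e2 := e in eq_ind 3%N (fun x => if x == 2%N then False else True) I _ (etrans (esym e1) e2)).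
- by move=> i; apply: weightS.
- by move=> i; apply: slope_nondecreasing.
- move=> i id; rewrite LE => ne; have [H _] := bd i id; move: H; rewrite (vgeE hv _ ne) /nu => H.
  by rewrite ler_pdivlMr ?ltr0n // mulrC.
move=> i id; rewrite /on_polygon !LE.
case: (pselect [/\ d = 3%N, p = 5%N & i = 2%N]) => [[d3 p5 i2]|ne]; last by left; apply: exact_at.
(* In the exceptional case the heights at 1, 2, 3 are 0, 1/2, 1, hence aligned, and both neighbours
   are sharp. *)
right; have ce : c = 2%N by rewrite d3 p5 in pc; lia.
rewrite i2 /=; split; first by rewrite d3.
- by apply: exact_at; [rewrite d3|case].
- by apply: exact_at; [rewrite d3|case].
have [t1 t2 t3] : [/\ triangular 1 = 0%N, triangular 2 = 1%N & triangular 3 = 3%N].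
  by rewrite /triangular !big_ord_recr !big_ord0.
by rewrite /weight t1 t2 t3 d3 p5 ce; apply/eqP.
Qed.
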